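(* Let $(\xi^*,\zeta^* )\in\mathcal A^\circ_0(\mathbb F^1)\times\mathcal A^\circ_0(\mathbb F^2)$ be an optimal pair. Then, for any $\lambda\in\mathcal T_0(\mathbb F^{1,2})$, $$\begin{aligned}&\mathsf E\big[(1-\xi^*_{\lambda-})\,\mathsf E[1-\zeta^*_{\lambda-}|\mathcal F^1_\lambda]\,V^{*,1}(\lambda)\big|\mathcal F^{1,2}_\lambda\big]\\&=\mathsf E\big[(1-\zeta^*_{\lambda-})\,\mathsf E[1-\xi^*_{\lambda-}|\mathcal F^2_\lambda]\,V^{*,2}(\lambda)\big|\mathcal F^{1,2}_\lambda\big]\\&=\mathsf E\Big[\int_{[\lambda,T)}(1-\zeta^*_t)f_t\,d\xi^*_t+\int_{[\lambda,T)}\big[(1-\xi^*_t)g_t+h_t\Delta\xi^*_t\big]d\zeta^*_t+h_T\Delta\zeta^*_T\Delta\xi^*_T\Big|\mathcal F^{1,2}_\lambda\Big].\end{aligned}$$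
   Context: Let $T\in(0,\infty)$ and let $(\Omega,\mathcal F,\mathsf P)$ be a complete probability space with a right-continuous filtration $\mathbb F=(\mathcal F_t)_{t\in[0,T]}$ completed with $\mathsf P$-null sets, $\mathcal F_T\subsetneq\mathcal F$. Right-continuous filtrations $\mathbb F^i=(\mathcal F^i_t)_{t\in[0,T]}$, $i=1,2$, completed with null sets, satisfy $\mathcal F^1_t\vee\mathcal F^2_t\subseteq\mathcal F_t$. The common filtration is $\mathbb F^{1,2}=(\mathcal F^{1,2}_t)_{t\in[0,T]}$, $\mathcal F^{1,2}_t=\mathcal F^1_t\cap\mathcal F^2_t$. Equalities/inequalities between random variables are $\mathsf P$-a.s. $\mathcal L_b(\mathsf P)$ is the space of càdlàg $\mathcal B([0,T])\times\mathcal F$-measurable $X$ with $\mathsf E[\sup_{0\le t\le T}|X_t|]<\infty$. The payoff processes $f,g,h\in\mathcal L_b(\mathsf P)$ are $\mathbb F$-adapted with $f_t\ge h_t\ge g_t$ for all $t\in[0,T]$ a.s. For a filtration $\mathbb G\subseteq\mathbb F$ and a $\mathbb G$-stopping time $\theta\in[0,T]$: $\mathcal T_\theta(\mathbb G)$ is the set of $\mathbb G$-stopping times with values in $[\theta,T]$; $\mathcal A^\circ_\theta(\mathbb G)$ is the set of $\mathbb G$-adapted càdlàg non-decreasing $\rho$ with $\rho_{\theta-}=0$, $\rho_T=1$ (for $\theta=0$, $\rho_{0-}:=0$, so $d\rho$ may charge $\{0\}$); $\Delta\rho_t=\rho_t-\rho_{t-}$. The $\mathbb G$-randomised stopping time generated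 by $\rho\in\mathcal A^\circ_\theta(\mathbb G)$ is $\eta=\inf\{t\in[0,T]:\rho_t>Z\}$ with $Z\sim U([0,1])$ independent of $\mathcal F_T$; the class of these is $\mathcal T^R_\theta(\mathbb G)$. The randomisation devices $Z$ of the two players are independent. Game: $\mathcal P(\tau,\sigma)=f_\tau\mathbf 1_{\{\tau<\sigma\}}+h_\tau\mathbf 1_{\{\tau=\sigma\}}+g_\sigma\mathbf 1_{\{\sigma<\tau\}}$; Player 1 picks $\tau\in\mathcal T^R_0(\mathbb F^1)$ to minimise, Player 2 picks $\sigma\in\mathcal T^R_0(\mathbb F^2)$ to maximise $\mathsf E[\mathcal P(\tau,\sigma)]$. A pair $(\xi^*,\zeta^* )\in\mathcal A^\circ_0(\mathbb F^1)\times\mathcal A^\circ_0(\mathbb F^2)$ is optimal if it generates a saddle point $(\tau_*,\sigma_* )$: $\mathsf E[\mathcal P(\tau_*,\sigma)]\le\mathsf E[\mathcal P(\tau_*,\sigma_* )]\le\mathsf E[\mathcal P(\tau,\sigma_* )]$ for all $(\tau,\sigma)\in\mathcal T^R_0(\mathbb F^1)\times\mathcal T^R_0(\mathbb F^2)$. Truncated controls: for a stopping time $\eta$, $\xi^{*;\eta}_t=\frac{\xi^*_t-\xi^*_{\eta-}}{1-\xi^*_{\eta-}}\mathbf 1_{\{t\ge\eta\}}$, $\zeta^{*;\eta}_t=\frac{\zeta^*_t-\zeta^*_{\eta-}}{1-\zeta^*_{\eta-}}\mathbf 1_{\{t\ge\eta\}}$, with $0/0=1$ and $\xi^{*;\eta}_{\eta-}=\zeta^{*;\eta}_{\eta-}=0$.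 Set $\Pi^{*,1}_\theta=\frac{1-\zeta^*_{\theta-}}{\mathsf E[1-\zeta^*_{\theta-}|\mathcal F^1_\theta]}$, $\Pi^{*,2}_\gamma=\frac{1-\xi^*_{\gamma-}}{\mathsf E[1-\xi^*_{\gamma-}|\mathcal F^2_\gamma]}$, ratios being $1$ where the denominator is $0$. For a random variable $\Pi\ge0$, a $\sigma$-algebra $\mathcal G$, and $\xi,\zeta$ started at $\theta$, $$J^\Pi(\xi,\zeta|\mathcal G)=\mathsf E\Big[\Pi\Big(\int_{[\theta,T)}f_t(1-\zeta_t)d\xi_t+\int_{[\theta,T)}g_t(1-\xi_t)d\zeta_t+\sum_{t\in[\theta,T]}h_t\Delta\zeta_t\Delta\xi_t\Big)\Big|\mathcal G\Big].$$ Equilibrium values: $V^{*,1}(\theta)=\operatorname*{ess\,inf}_{\xi\in\mathcal A^\circ_\theta(\mathbb F^1)}J^{\Pi^{*,1}_\theta}(\xi,\zeta^{*;\theta}|\mathcal F^1_\theta)$ for $\theta\in\mathcal T_0(\mathbb F^1)$, $V^{*,2}(\gamma)=\operatorname*{ess\,sup}_{\zeta\in\mathcal A^\circ_\gamma(\mathbb F^2)}J^{\Pi^{*,2}_\gamma}(\xi^{*;\gamma},\zeta|\mathcal F^2_\gamma)$ for $\gamma\in\mathcal T_0(\mathbb F^2)$. *)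

(* Defs.v *)
From HB Require Import structures.
From mathcomp Require Import all_boot all_order all_algebra.
From mathcomp Require Import all_classical all_reals all_analysis.
From mathcomp Require Import measurable_realfun.

Set Implicit Arguments.
Unset Strict Implicit.
Unset Printing Implicit Defensive.

Import Order.TTheory GRing.Theory Num.Theory.
Import numFieldNormedType.Exports.

Local Open Scope classical_set_scope.
Local Open Scope ring_scope.

(* A process is a map X : R -> Omega -> R, time first; only its values at the
   times of [0, T] are meaningful.  Sub-sigma-algebras of the ambient one are
   plain set systems on Omega. *)

Section conditioning.
Context {d : measure_display} {Omega : measurableType d} {R : realType}.
Variable P : probability Omega R.

Definition measurable_wrt {d' : measure_display} {U : measurableType d'}
    (G : set_system Omega) (X : Omega -> U) : Prop :=
  forall B : set U, measurable B -> G (X @^-1` B).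

Definition is_cond_exp_ge0 (G : set_system Omega) (X Y : Omega -> \bar R) :
    Prop :=
  [/\ measurable_wrt G Y, forall w, (0 <= Y w)%E
    & forall A, G A -> (\int[P]_(w in A) Y w = \int[P]_(w in A) X w)%E].

Definition cond_exp_ge0 (G : set_system Omega) (X : Omega -> \bar R) :
    Omega -> \bar R :=
  xget (cst 0%E) [set Y | is_cond_exp_ge0 G X Y].

(* A version of E[X | G] in the generalised sense E[X^+ | G] - E[X^- | G].
   X need not be integrable (Pi * payoff below is not in general): it is enough
   that the two terms are almost surely finite. *)
Definition cond_exp (G : set_system Omega) (X : Omega -> \bar R) :
    Omega -> \bar R :=
  fun w => (cond_exp_ge0 G X^\+ w - cond_exp_ge0 G X^\- w)%E.

Definition is_ess_inf_fam (Phi : set (Omega -> \bar R)) (Y : Omega -> \bar R) :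
    Prop :=
  [/\ measurable_fun setT Y,
      forall X, Phi X -> {ae P, forall w, (Y w <= X w)%E}
    & forall Y', measurable_fun setT Y' ->
        (forall X, Phi X -> {ae P, forall w, (Y' w <= X w)%E}) ->
        {ae P, forall w, (Y' w <= Y w)%E}].

Definition is_ess_sup_fam (Phi : set (Omega -> \bar R)) (Y : Omega -> \bar R) :
    Prop :=
  [/\ measurable_fun setT Y,
      forall X, Phi X -> {ae P, forall w, (X w <= Y w)%E}
    & forall Y', measurable_fun setT Y' ->
        (forall X, Phi X -> {ae P, forall w, (X w <= Y' w)%E}) ->
        {ae P, forall w, (Y w <= Y' w)%E}].

Definition ess_inf_fam (Phi : set (Omega -> \bar R)) : Omega -> \bar R :=
  xget (cst 0%E) [set Y | is_ess_inf_fam Phi Y].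

Definition ess_sup_fam (Phi : set (Omega -> \bar R)) : Omega -> \bar R :=
  xget (cst 0%E) [set Y | is_ess_sup_fam Phi Y].

End conditioning.

Section paths.
Context {R : realType}.
Variable T : R.

Definition cadlag (x : R -> R) : Prop :=
  (forall t, 0 <= t < T -> x s @[s --> t^'+] --> x t) /\
  (forall t, 0 < t <= T -> cvg (x s @[s --> t^'-])).

(* x_{t-}, with the convention x_{0-} = 0. *)
Definition left_lim (x : R -> R) (t : R) : R :=
  if 0 < t then lim (x s @[s --> t^'-]) else 0.

Definition jump (x : R -> R) (t : R) : R := x t - left_lim x t.

(* Extension of a path from [0, T] to R: 0 before time 0, so that the jump
   x_0 - x_{0-} = x_0 at time 0 is charged, and constant after T. *)
Definition extend_path (x : R -> R) : R -> R :=
  fun t => if t < 0 then 0 else x (Num.min t T).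

Definition is_cumulative (x : R -> R) : Prop :=
  nondecreasing x /\ right_continuous x.

Definition to_cumulative (x : R -> R) (H : is_cumulative x) : cumulative R R :=
  HB.pack x (isCumulative.Build R _ R x (proj1 H) (proj2 H)).

(* The measure dx on [0, T].  The junk value mzero is never used below: the
   paths of an admissible control satisfy is_cumulative. *)
Definition dpath (x : R -> R) : {measure set (measurableTypeR R) -> \bar R} :=
  match pselect (is_cumulative (extend_path x)) with
  | left H => lebesgue_stieltjes_measure (to_cumulative H)
  | right _ => mzero
  end.

Definition sum_over (D : set R) (a : R -> R) : R :=
  fine (\esum_(t in D) (a^\+ t)%:E) - fine (\esum_(t in D) (a^\- t)%:E).

(* rho^{eta} for a fixed scenario, at the realised value u of eta; 0 / 0 = 1. *)
Definition truncate_path (x : R -> R) (u t : R) : R :=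
  if t < u then 0
  else if 1 - left_lim x u == 0 then 1
  else (x t - left_lim x u) / (1 - left_lim x u).

End paths.

Section game.
Context {d : measure_display} {Omega : measurableType d} {R : realType}.
Variables (P : probability Omega R) (T : R).
Implicit Types (F G : R -> set_system Omega).
Implicit Types (X f g h rho xi zeta : R -> Omega -> R).
Implicit Types (theta eta tau sigma : Omega -> R).

Record usual_filtration G : Prop := {
  usual_sigma_algebra : forall t, 0 <= t <= T -> sigma_algebra setT (G t);
  usual_sub : forall t, 0 <= t <= T -> G t `<=` measurable;
  usual_mono : forall s t, 0 <= s -> s <= t -> t <= T -> G s `<=` G t;
  usual_right_continuous : forall t, 0 <= t < T ->
    \bigcap_(s in `]t, T]) G s = G t;
  usual_null : forall t, 0 <= t <= T -> P.-negligible `<=` G t }.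

Definition common_filtration F1 F2 : R -> set_system Omega :=
  fun t => F1 t `&` F2 t.

Definition adapted G X : Prop :=
  forall t, 0 <= t <= T -> measurable_wrt (G t) (X t).

Definition Lb X : Prop :=
  [/\ forall w, cadlag T (X ^~ w),
      measurable_fun (`[0, T] `*` setT) (fun p : R * Omega => X p.1 p.2)
    & (\int[P]_w ereal_sup [set `|X t w|%:E | t in `[0%R, T]] < +oo)%E].

Definition stopping_time G theta : Prop :=
  (forall w, 0 <= theta w <= T) /\
  (forall t, 0 <= t <= T -> G t [set w | theta w <= t]).

(* The sigma-algebra G_theta. *)
Definition stopped_algebra G theta : set_system Omega :=
  [set A | G T A /\
    forall t, 0 <= t <= T -> G t (A `&` [set w | theta w <= t])].

Definition left_at X theta : Omega -> R :=
  fun w => left_lim (X ^~ w) (theta w).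

(* The class A^o_theta(G).  The condition 0 <= rho_t is the monotonicity of rho
   at time 0, where rho_{0-} = 0. *)
Record admissible G theta rho : Prop := {
  admissible_adapted : adapted G rho;
  admissible_cadlag : forall w, cadlag T (rho ^~ w);
  admissible_ge0 : forall w t, 0 <= t <= T -> 0 <= rho t w;
  admissible_mono : forall w s t, 0 <= s -> s <= t -> t <= T ->
    rho s w <= rho t w;
  admissible_start : forall w, left_at rho theta w = 0;
  admissible_end : forall w, rho T w = 1 }.

Definition truncate rho eta : R -> Omega -> R :=
  fun t w => truncate_path (rho ^~ w) (eta w) t.

(* The set is empty only on the null event 1 <= Z, where inf returns 0. *)
Definition generated_time rho (Z : Omega -> R) : Omega -> R :=
  fun w => inf [set t | 0 <= t <= T /\ Z w < rho t w].

(* Each device is U([0, 1]), and Z1, Z2 and the sigma-algebra A (F_T below) are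
   mutually independent. *)
Definition randomisation_devices (A : set_system Omega)
    (Z1 Z2 : {RV P >-> R}) : Prop :=
  [/\ forall B, measurable B -> distribution P Z1 B = uniform_prob (@ltr01 R) B,
      forall B, measurable B -> distribution P Z2 B = uniform_prob (@ltr01 R) B
    & forall E B1 B2, A E -> measurable B1 -> measurable B2 ->
        (P (E `&` Z1 @^-1` B1 `&` Z2 @^-1` B2) =
         P E * P (Z1 @^-1` B1) * P (Z2 @^-1` B2))%E].

(* The G-randomised stopping times of T^R_theta(G) with device Z. *)
Definition randomised_time G theta (Z : Omega -> R) : set (Omega -> R) :=
  [set generated_time rho Z | rho in admissible G theta].

Definition payoff f g h tau sigma : Omega -> R := fun w =>
  if tau w < sigma w then f (tau w) w
  else if tau w == sigma w then h (tau w) w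
  else g (sigma w) w.

(* (xi, zeta) generates a saddle point; a deviating player may use any device
   that is admissible together with the device of the opponent. *)
Definition optimal (F F1 F2 : R -> set_system Omega) f g h xi zeta : Prop :=
  exists Z1 Z2 : {RV P >-> R},
    let tau' := generated_time xi Z1 in
    let sigma' := generated_time zeta Z2 in
    [/\ randomisation_devices (F T) Z1 Z2,
        forall (Z : {RV P >-> R}) sigma,
          randomisation_devices (F T) Z1 Z ->
          randomised_time F2 (cst 0) Z sigma ->
          ('E_P[payoff f g h tau' sigma] <= 'E_P[payoff f g h tau' sigma'])%E
      & forall (Z : {RV P >-> R}) tau,
          randomisation_devices (F T) Z Z2 ->
          randomised_time F1 (cst 0) Z tau ->
          ('E_P[payoff f g h tau' sigma'] <= 'E_P[payoff f g h tau sigma'])%E].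

Definition J f g h (Pi : Omega -> R) (A : set_system Omega) theta xi zeta :
    Omega -> \bar R :=
  cond_exp P A (fun w => (Pi w * (
    \int[dpath T (xi ^~ w)]_(t in `[theta w, T[) (f t w * (1 - zeta t w)) +
    \int[dpath T (zeta ^~ w)]_(t in `[theta w, T[) (g t w * (1 - xi t w)) +
    sum_over `[theta w, T]
      (fun t => h t w * jump (zeta ^~ w) t * jump (xi ^~ w) t)))%:E).

(* E[1 - rho_{theta-} | G_theta]. *)
Definition survival G rho theta : Omega -> \bar R :=
  cond_exp P (stopped_algebra G theta) (fun w => (1 - left_at rho theta w)%:E).

(* The ratio Pi: player G's weight of the opponent's control rho. *)
Definition weight G rho theta : Omega -> R := fun w =>
  if fine (survival G rho theta w) == 0 then 1
  else (1 - left_at rho theta w) / fine (survival G rho theta w).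

Definition value1 F1 f g h zeta theta : Omega -> \bar R :=
  ess_inf_fam P
    [set J f g h (weight F1 zeta theta) (stopped_algebra F1 theta) theta
           xi (truncate zeta theta)
    | xi in admissible F1 theta].

Definition value2 F2 f g h xi theta : Omega -> \bar R :=
  ess_sup_fam P
    [set J f g h (weight F2 xi theta) (stopped_algebra F2 theta) theta
           (truncate xi theta) zeta
    | zeta in admissible F2 theta].

End game.

(* Main.v *)
(* Write p and q for the values of xi and zeta just before lambda, and N for the
   bracket of J.  Let a player follow his equilibrium control before lambda and,
   on an event A of his own sigma-algebra at lambda, the rescaled copy p + (1-p) x
   of a control x started at lambda.  This is an admissible control, and since
   randomisation turns the expected payoff into E[N_0], where N_0 changes only by
   the part of the game after lambda, optimality gives
     E[1_A (M(x) - M(xi))] >= 0,  M(x) = (1-p)(1-q) N_lambda(x, truncated zeta),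
   for all such A and x.  As (1-p) E[1-q | G] Pi = (1-p)(1-q), this says that
   (1-p) E[1-q | G] J(x) >= E[M(xi) | G], with equality at the truncation of xi;
   hence (1-p) E[1-q | G] V = E[M(xi) | G].  M(xi) is the integrand of the third
   expression and does not depend on the player, so conditioning on the common
   sigma-algebra concludes. *)
From HB Require Import structures.
Require Import Defs.
From mathcomp Require Import all_boot all_order all_algebra.
From mathcomp Require Import all_classical all_reals all_analysis.
From mathcomp Require Import measurable_realfun ring lra.
Import Order.TTheory GRing.Theory Num.Theory.
Import numFieldNormedType.Exports.
Local Open Scope classical_set_scope.
Local Open Scope ring_scope.
Set Implicit Arguments.
Unset Strict Implicit.
Unset Printing Implicit Defensive.

(** * Conditional expectation given a sub-sigma-algebra *)

(** Conditional expectations are therefore built for arbitrary nonnegative finite functions, a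
    factor is taken out when only the product is integrable, and the essential extremum is
    identified after multiplication by (1-p) E[1-q | G], where 0 times infinity is 0.

    Randomisation rests on the inverse transform: a generated time is the quantile function of a
    path evaluated at the device, and this function carries the uniform law to the measure of the
    path. The same representation turns an integral against a random measure into one against a
    fixed law, which yields its measurability in the scenario. The devices are independent of F_T
    only, so Fubini is applied on Omega equipped with F_T.

    The sum over common jumps is a single integral against the measure of either player. The bracket
    is therefore symmetric under exchanging the players together with f and g, and the second player
    is covered by the lemmas for the first. *)

Section sub_sigma_algebra.
Context {d : measure_display} {Omega : measurableType d} {R : realType}.
Context (P : probability Omega R) (G : set_system Omega).
Hypotheses (sG : sigma_algebra setT G) (GM : G `<=` measurable).

Local Notation GT := (g_sigma_algebraType G).

Lemma measurable_wrtP d' (U : measurableType d') (X : Omega -> U) :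
  measurable_wrt G X <-> measurable_fun [set: GT] X.
Proof.
split=> [GX _ B mB|mX B mB].
  by rewrite setTI measurable_g_measurableTypeE//; exact: GX.
by have := mX measurableT B mB; rewrite setTI measurable_g_measurableTypeE.
Qed.

Lemma measurable_wrt_fun d' (U : measurableType d') (X : Omega -> U) :
  measurable_wrt G X -> measurable_fun setT X.
Proof. by move=> GX _ B mB; rewrite setTI; exact/GM/GX. Qed.

Definition to_sub (w : Omega) : GT := w.

Lemma measurable_to_sub : measurable_fun setT to_sub.
Proof.
move=> _ B; rewrite measurable_g_measurableTypeE// setTI => GB.
exact: GM.
Qed.

HB.instance Definition _ :=
  isMeasurableFun.Build _ _ _ _ to_sub measurable_to_sub.

(** This is the restriction of [P] to [G]. Written as the law of the identity map into the coarser
    space, it inherits the change of variables formulas. *)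
Definition Psub : probability GT R := distribution P to_sub.

End sub_sigma_algebra.

Section induced_sub_measure.
Context {d : measure_display} {Omega : measurableType d} {R : realType}.
Context (P : probability Omega R) (G : set_system Omega).
Hypotheses (sG : sigma_algebra setT G) (GM : G `<=` measurable).

Local Notation GT := (g_sigma_algebraType G).

Let GTM (A : set GT) : measurable A -> (measurable : set_system Omega) A.
Proof. by rewrite measurable_g_measurableTypeE// => /GM. Qed.

Variable X : Omega -> \bar R.
Hypotheses (mX : measurable_fun setT X) (X0 : forall w, (0 <= X w)%E).
Hypothesis (iX : (\int[P]_w X w < +oo)%E).

Definition induced_sub (A : set GT) : \bar R :=
  (\int[P]_(w in (A : set Omega)) X w)%E.

Let induced_sub0 : induced_sub set0 = 0%E.
Proof. by rewrite /induced_sub integral_set0. Qed.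

Let induced_sub_ge0 A : (0 <= induced_sub A)%E.
Proof. by rewrite /induced_sub; apply: integral_ge0. Qed.

Let induced_sub_additive : semi_sigma_additive induced_sub.
Proof.
move=> F mF tF mUF.
apply: (@semi_sigma_additive_nng_induced _ _ _ P X mX X0 F) => //.
  by move=> i; exact: GTM.
exact: GTM.
Qed.

HB.instance Definition _ := isMeasure.Build _ _ _ induced_sub
  induced_sub0 induced_sub_ge0 induced_sub_additive.

Let induced_sub_fin : fin_num_fun induced_sub.
Proof.
move=> A /GTM mA; rewrite ge0_fin_numE//; apply: le_lt_trans iX.
exact: ge0_subset_integral.
Qed.

HB.instance Definition _ :=
  Measure_isFinite.Build _ _ _ induced_sub induced_sub_fin.

(** The finite measure sending A in [G] to the integral of X over A is dominated by the restriction
    of [P]. Its density is taken on the space that carries [G], hence is measurable for [G]. *)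
Lemma radon_nikodym_sub : exists Y, is_cond_exp_ge0 P G X Y.
Proof.
have dom : induced_sub `<< Psub P sG GM.
  apply/null_content_dominatesP => A /GTM mA PA.
  by apply: null_set_integral => //; exact: measurable_funTS.
have [Y [Y0 Yfin iY YE]] :=
  @radon_nikodym_sigma_finite _ _ _ (Psub P sG GM) induced_sub dom.
have GY : measurable_wrt G Y by apply/measurable_wrtP => //; exact: measurable_int iY.
exists Y; split=> // A GA.
have mA : measurable (A : set GT) by rewrite measurable_g_measurableTypeE.
transitivity (\int[Psub P sG GM]_(x in A) Y x)%E; last by rewrite -YE.
rewrite ge0_integral_pushforward//.
by apply: measurable_funTS; exact: measurable_int iY.
Qed.

End induced_sub_measure.

(** * Pointwise comparison from integrals over all events *)

Section integral_comparison.
Context {d : measure_display} {Omega : measurableType d} {R : realType}.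
Context (mu : {finite_measure set Omega -> \bar R}).
Local Open Scope ereal_scope.
Implicit Types f g : Omega -> \bar R.

(** On D the pointwise order and the order of integrals are opposite, so f and g agree almost
    everywhere there. The strict inequality allows this only if D is null. *)
Let null_reversed f g D : measurable D -> (forall w, D w -> g w < f w) ->
  mu.-integrable D f -> mu.-integrable D g ->
  (forall A, measurable A -> A `<=` D ->
    \int[mu]_(w in A) f w <= \int[mu]_(w in A) g w) ->
  mu D = 0.
Proof.
move=> mD gf if_ ig fg.
have /= [N [mN N0 DN]] : ae_eq mu D g f.
  apply: integral_ae_eq => //; first exact: measurable_int if_.
  move=> E ED mE; apply/eqP; rewrite eq_le fg// andbT.
  apply: le_integral => //; try exact: (integrableS mD).
  by move=> x /[1!inE] /ED /gf /ltW.
apply: (subset_measure0 mD mN _ N0) => w Dw; apply: DN => /= /(_ Dw) gfw.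
by have := gf _ Dw; rewrite gfw ltxx.
Qed.

(* Tested on {g < f, g <= n}, where g is integrable. *)
Lemma ge0_ae_le f g : measurable_fun setT f -> measurable_fun setT g ->
  (forall w, 0 <= f w) -> (forall w, 0 <= g w) ->
  (forall A, measurable A ->
    \int[mu]_(w in A) f w <= \int[mu]_(w in A) g w) ->
  {ae mu, forall w, f w <= g w}.
Proof.
move=> mf mg f0 g0 fg.
pose A n := [set w | g w < f w] `&` [set w | g w <= n%:R%:E].
have mA n : measurable (A n).
  apply: measurableI; rewrite -[X in measurable X]setTI.
    exact: measurable_lte.
  exact: emeasurable_fun_infty_c.
have A0 n : mu (A n) = 0.
  have fing : \int[mu]_(w in A n) g w < +oo.
    apply: (@le_lt_trans _ _ (\int[mu]_(w in A n) (cst n%:R%:E w))).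
      by apply: ge0_le_integral => //; [exact: measurable_funTS|move=> w []].
    by rewrite integral_cst// lte_mul_pinfty ?lee_fin// ltey_eq fin_num_measure.
  apply: (@null_reversed f g) => //; first by move=> w [].
    apply/integrableP; split; first exact: measurable_funTS.
    under eq_integral do rewrite gee0_abs//.
    exact: le_lt_trans (fg _ (mA n)) fing.
    apply/integrableP; split; first exact: measurable_funTS.
    by under eq_integral do rewrite gee0_abs//.
  by move=> B mB _; exact: fg.
have [N [mN N0 AN]] : mu.-negligible (\bigcup_n A n).
  by apply: negligible_bigcup => k; exists (A k); split; [exact: mA|exact: A0|].
exists N; split=> // w /= /negP; rewrite -ltNge => gfw; apply: AN.
have gfin : g w \is a fin_num by rewrite ge0_fin_numE// (lt_le_trans gfw)// leey.
exists (Num.truncn (fine (g w))).+1 => //; split => //=.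
by rewrite -[g w]fineK// lee_fin ltW// truncnS_gt.
Qed.

Lemma integrable_ae_le f g : mu.-integrable setT f -> mu.-integrable setT g ->
  (forall A, measurable A ->
    \int[mu]_(w in A) f w <= \int[mu]_(w in A) g w) ->
  {ae mu, forall w, f w <= g w}.
Proof.
move=> if_ ig fg; pose A := [set w | g w < f w].
have mA : measurable A.
  rewrite -[X in measurable X]setTI; apply: measurable_lte => //;
  [exact: measurable_int ig|exact: measurable_int if_].
exists A; split => //; last by move=> w /= /negP; rewrite -ltNge.
by apply: (@null_reversed f g) => // [||B mB _];
  [exact: integrableS if_|exact: integrableS ig|exact: fg].
Qed.

End integral_comparison.

Section cond_exp_ge0_theory.
Context {d : measure_display} {Omega : measurableType d} {R : realType}.
Context (P : probability Omega R) (G : set_system Omega).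
Hypotheses (sG : sigma_algebra setT G) (GM : G `<=` measurable).

Local Notation GT := (g_sigma_algebraType G).
Local Open Scope ereal_scope.

Let GTM (A : set GT) : measurable A -> (measurable : set_system Omega) A.
Proof. by rewrite measurable_g_measurableTypeE// => /GM. Qed.

Let GGT (A : set Omega) : G A -> measurable (A : set GT).
Proof. by rewrite measurable_g_measurableTypeE. Qed.

Lemma ge0_integral_Psub A Y : G A -> measurable_wrt G Y ->
  (forall w, 0 <= Y w) ->
  \int[P]_(w in A) Y w = \int[Psub P sG GM]_(w in A) Y w.
Proof.
move=> /GGT mA /(measurable_wrtP sG) mY Y0.
by rewrite ge0_integral_pushforward//; exact: measurable_funTS.
Qed.

Let layer (X : Omega -> R) n := X @^-1` `[n%:R, n.+1%:R[%classic.

Let trivIset_layer X : trivIset setT (layer X).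
Proof.
move=> i j _ _ [w []]; rewrite /layer/= !in_itv/= => /andP[ix xi] /andP[jx xj].
have := le_lt_trans ix xj; have := le_lt_trans jx xi.
by rewrite !ltr_nat !ltnS => ji ij; apply/eqP; rewrite eqn_leq ij ji.
Qed.

Let bigcup_layer (X : Omega -> R) : (forall w, (0 <= X w)%R) ->
  \bigcup_n layer X n = setT.
Proof.
move=> X0; apply/seteqP; split=> // w _; exists (Num.truncn (X w)) => //=.
by rewrite /layer/= in_itv/=; exact: truncn_itv.
Qed.

Let measurable_layer (X : Omega -> R) n : measurable_fun setT X ->
  measurable (layer X n).
Proof. by move=> mX; rewrite -[X in measurable X]setTI; exact: mX. Qed.

(** X may fail to be integrable. On the slice where X lies in [n, n+1) it is bounded, so that slice
    has a version, and the versions are summed; the series may take the value +oo. *)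
Lemma cond_exp_ge0_exists (X : Omega -> R) :
  measurable_fun setT X -> (forall w, (0 <= X w)%R) ->
  exists Y, is_cond_exp_ge0 P G (EFin \o X) Y.
Proof.
move=> mX X0; pose Z n := (EFin \o X) \_ (layer X n).
have mZ n : measurable_fun setT (Z n).
  apply/(measurable_restrictT _ _).1; first exact: measurable_layer.
  by apply: measurable_funTS; exact/measurable_EFinP.
have Z0 n w : 0 <= Z n w.
  by rewrite /Z patchE; case: ifP => // _; rewrite lee_fin.
have iZ n : \int[P]_w Z n w < +oo.
  apply: (@le_lt_trans _ _ (\int[P]_w (cst n.+1%:R%:E w))).
    apply: ge0_le_integral => // w _; rewrite /Z patchE; case: ifPn => [|_].
      by rewrite inE /layer/= in_itv/= lee_fin => /andP[_ /ltW].
    by rewrite lee_fin.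
  by rewrite integral_cst// [X in _ * X]probability_setT mule1 ltry.
have /choice[Y YZ] n : exists Y, is_cond_exp_ge0 P G (Z n) Y.
  exact: (radon_nikodym_sub sG GM (mZ n) (Z0 n) (iZ n)).
have mY n : measurable_fun [set: GT] (Y n).
  by apply/(measurable_wrtP sG); case: (YZ n).
have Y0 n w : 0 <= Y n w by case: (YZ n).
have mY' n : measurable_fun [set: Omega] (Y n).
  by apply: (measurable_wrt_fun GM); case: (YZ n).
exists (fun w => \sum_(n <oo) Y n w); split.
- apply/(measurable_wrtP sG).
  by apply: ge0_emeasurable_sum => //.
- by move=> w; exact: nneseries_ge0.
- move=> A GA.
  have mA := GM GA.
  rewrite integral_nneseries//; last by move=> n; exact: measurable_funTS.
  rewrite -[X in _ = integral _ X _](setIT A) -(bigcup_layer X0) setI_bigcupr.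
  rewrite ge0_integral_bigcup//=.
  + apply: eq_eseriesr => n _; case: (YZ n) => _ _ /(_ _ GA) ->.
    by rewrite integral_mkcondr.
  + by move=> n; apply: measurableI => //; exact: measurable_layer.
  + by apply: measurable_funTS; exact/measurable_EFinP.
  + by move=> w _; rewrite lee_fin.
  + exact: trivIset_setIl.
Qed.

Lemma cond_exp_ge0P X : (exists Y, is_cond_exp_ge0 P G X Y) ->
  is_cond_exp_ge0 P G X (cond_exp_ge0 P G X).
Proof. by move=> [Y XY]; exact: (@xgetPex _ (cst 0) [set Y | _] (ex_intro _ Y XY)). Qed.

(** No existence is assumed: when there is no version, [xget] returns a constant, which is
    measurable too. *)
Lemma cond_exp_ge0_measurable X : measurable_wrt G (cond_exp_ge0 P G X).
Proof.
rewrite /cond_exp_ge0; case: xgetP => [Y _ []//|_].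
by apply/(measurable_wrtP sG); exact: measurable_cst.
Qed.

Lemma cond_exp_measurable X : measurable_wrt G (cond_exp P G X).
Proof.
apply/(measurable_wrtP sG); rewrite /cond_exp.
by apply: emeasurable_funB; apply/(measurable_wrtP sG);
  exact: cond_exp_ge0_measurable.
Qed.

Lemma ae_Psub (Q : Omega -> Prop) : {ae Psub P sG GM, forall w, Q w} ->
  {ae P, forall w, Q w}.
Proof.
by move=> [N [mN PN QN]]; exists N; split => //; exact: GTM.
Qed.

Lemma ge0_ae_le_sub (Y1 Y2 : Omega -> \bar R) :
  measurable_wrt G Y1 -> measurable_wrt G Y2 ->
  (forall w, 0 <= Y1 w) -> (forall w, 0 <= Y2 w) ->
  (forall A, G A -> \int[P]_(w in A) Y1 w <= \int[P]_(w in A) Y2 w) ->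
  {ae P, forall w, Y1 w <= Y2 w}.
Proof.
move=> GY1 GY2 Y10 Y20 Y12; apply: ae_Psub; apply: ge0_ae_le => //.
- exact/(measurable_wrtP sG).
- exact/(measurable_wrtP sG).
- move=> A; rewrite (measurable_g_measurableTypeE sG) => GA.
  by rewrite -!ge0_integral_Psub//; exact: Y12.
Qed.

Lemma ge0_ae_eq_sub (Y1 Y2 : Omega -> \bar R) :
  measurable_wrt G Y1 -> measurable_wrt G Y2 ->
  (forall w, 0 <= Y1 w) -> (forall w, 0 <= Y2 w) ->
  (forall A, G A -> \int[P]_(w in A) Y1 w = \int[P]_(w in A) Y2 w) ->
  {ae P, forall w, Y1 w = Y2 w}.
Proof.
move=> GY1 GY2 Y10 Y20 Y12.
have le12 : {ae P, forall w, Y1 w <= Y2 w}.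
  by apply: ge0_ae_le_sub => // A GA; rewrite Y12.
have le21 : {ae P, forall w, Y2 w <= Y1 w}.
  by apply: ge0_ae_le_sub => // A GA; rewrite Y12.
by apply: filterS2 le12 le21 => w w12 w21; apply/eqP; rewrite eq_le w12.
Qed.

Lemma integrable_ae_le_sub (Y1 Y2 : Omega -> \bar R) :
  measurable_wrt G Y1 -> measurable_wrt G Y2 ->
  P.-integrable setT Y1 -> P.-integrable setT Y2 ->
  (forall A, G A -> \int[P]_(w in A) Y1 w <= \int[P]_(w in A) Y2 w) ->
  {ae P, forall w, Y1 w <= Y2 w}.
Proof.
move=> /(measurable_wrtP sG) mY1 /(measurable_wrtP sG) mY2 iY1 iY2 Y12.
apply: ae_Psub; apply: integrable_ae_le => //.
- by apply: integrable_pushforward => //; exact: measurable_to_sub.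
- by apply: integrable_pushforward => //; exact: measurable_to_sub.
- move=> A; rewrite (measurable_g_measurableTypeE sG) => GA.
  have mA := GGT GA.
  rewrite !integral_pushforward//; try exact: measurable_to_sub.
  + exact: Y12.
  + by apply: integrableS iY2 => //; exact: GM.
  + by apply: integrableS iY1 => //; exact: GM.
Qed.

End cond_exp_ge0_theory.

(** * Taking out a measurable factor, and conditioning of integrable functions *)

Section take_out.
Context {d : measure_display} {Omega : measurableType d} {R : realType}.
Context (P : probability Omega R) (G : set_system Omega).
Hypotheses (sG : sigma_algebra setT G) (GM : G `<=` measurable).

Local Notation GT := (g_sigma_algebraType G).
Local Open Scope ereal_scope.

Import HBNNSimple.

Let GMT (A : set GT) : measurable A -> (measurable : set_system Omega) A.
Proof. by rewrite measurable_g_measurableTypeE// => /GM. Qed.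

Let mGT (W : GT -> \bar R) : measurable_fun [set: GT] W ->
  measurable_fun [set: Omega] (W : Omega -> \bar R).
Proof. by move/(measurable_wrtP sG); exact: measurable_wrt_fun. Qed.

Let integral_simple_density (h : {nnsfun GT >-> R}) (Z : Omega -> \bar R) A :
  G A -> measurable_fun [set: Omega] Z -> (forall w, 0 <= Z w) ->
  \int[P]_(w in A) ((h w)%:E * Z w) =
  \sum_(r \in range h) (r%:E * \int[P]_(w in A `&` h @^-1` [set r]) Z w).
Proof.
move=> GA mZ Z0; have mA : measurable A := GM GA.
have mh r : measurable (h @^-1` [set r] : set Omega).
  by apply: GMT; exact: measurable_funPTI.
have mind r : measurable_fun A
    (fun w => (r * \1_(h @^-1` [set r] : set Omega) w)%:E).
  by apply/measurable_EFinP; apply: measurable_funM => //;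
    exact: measurable_indic.
transitivity (\int[P]_(w in A) (\sum_(r \in range h)
    (r * \1_(h @^-1` [set r] : set Omega) w)%:E * Z w)).
  apply: eq_integral => w _.
  rewrite -ge0_mule_fsuml => [|y]; last exact: nnfun_muleindic_ge0.
  by rewrite fsumEFin // -fimfunE.
rewrite ge0_integral_fsum//; last 2 first.
  - by move=> y; apply: emeasurable_funM => //; exact: measurable_funTS.
  - by move=> m y Ey; rewrite mule_ge0// nnfun_muleindic_ge0.
apply: eq_fsbigr => r rhn.
under eq_integral do rewrite EFinM -muleA.
rewrite ge0_integralZl//.
- congr (_ * _); rewrite integral_mkcondr; apply: eq_integral => w _.
  by rewrite epatch_indic muleC.
- apply: emeasurable_funM; last exact: measurable_funTS.
  by apply/measurable_EFinP; exact: measurable_indic.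
- by move=> w _; rewrite mule_ge0 ?lee_fin.
- by move: rhn; rewrite inE => -[t _ <-]; rewrite lee_fin.
Qed.

(** W is the increasing limit of simple functions measurable for [G]. Their level sets lie in [G],
    so the hypothesis applies to each level set intersected with A, and monotone convergence does
    the rest. *)
Lemma ge0_integral_take_out (W : Omega -> R) (Z1 Z2 : Omega -> \bar R) :
  measurable_wrt G W -> (forall w, (0 <= W w)%R) ->
  measurable_fun setT Z1 -> measurable_fun setT Z2 ->
  (forall w, 0 <= Z1 w) -> (forall w, 0 <= Z2 w) ->
  (forall A, G A -> \int[P]_(w in A) Z1 w = \int[P]_(w in A) Z2 w) ->
  forall A, G A ->
    \int[P]_(w in A) ((W w)%:E * Z1 w) = \int[P]_(w in A) ((W w)%:E * Z2 w).
Proof.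
move=> GW W0 mZ1 mZ2 Z10 Z20 Z12 A GA.
have mA : measurable A := GM GA.
have mW : measurable_fun [set: GT] (EFin \o W).
  by apply/measurable_EFinP; exact/measurable_wrtP.
pose h := nnsfun_approx measurableT mW.
have key Z : measurable_fun setT Z -> (forall w, 0 <= Z w) ->
    \int[P]_(w in A) ((W w)%:E * Z w) =
    limn (fun n => \int[P]_(w in A) ((h n w)%:E * Z w)).
  move=> mZ Z0.
  have hcvg w : (h n w)%:E * Z w @[n --> \oo] --> (W w)%:E * Z w.
    have hW : (EFin \o h n) w @[n --> \oo] --> (W w)%:E.
      by apply: (cvg_nnsfun_approx measurableT mW) => // x _; rewrite lee_fin.
    (* Multiplication is not continuous at 0 times +oo. Where W vanishes, the approximations lie
       below W and vanish as well, so the sequence of products is constant. *)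
    have [W0w|W0w] := eqVneq (W w) 0%R; last first.
      apply: cvgeM => //; last exact: cvg_cst.
      by have [Zf|Zf] := boolP (Z w \is a fin_num); [exact: mule_def_fin|exact: mule_def_neq0_infty].
    rewrite (_ : (fun n => _) = cst ((W w)%:E * Z w)); first exact: cvg_cst.
    apply/funext => n /=; rewrite W0w mul0e.
    suff -> : h n w = 0%R by rewrite mul0e.
    apply/eqP; rewrite eq_le; apply/andP; split => //.
    have nd : nondecreasing_seq (fun n => (EFin \o h n) w).
      by move=> a b ab; rewrite lee_fin; exact/lefP/nd_nnsfun_approx.
    have := cvg_unique _ hW (ereal_nondecreasing_cvgn nd).
    rewrite W0w -lee_fin => -> //; apply: ereal_sup_ubound.
    by exists n.
  rewrite -monotone_convergence//.
  - by apply: eq_integral => w _; apply/esym/cvg_lim.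
  - move=> n; apply: emeasurable_funM; last exact: measurable_funTS.
    by apply: measurable_funTS; apply: mGT; apply/measurable_EFinP.
  - by move=> n w _; rewrite mule_ge0// lee_fin.
  - move=> w _ a b ab; apply: lee_wpmul2r => //; rewrite lee_fin.
    by have /lefP := nd_nnsfun_approx measurableT mW ab; exact.
rewrite !key//; congr (limn _); apply/funext => n.
rewrite !integral_simple_density//; apply: eq_fsbigr => r _.
congr (_ * _); apply: Z12.
have mGA : measurable (A : set GT) by rewrite (measurable_g_measurableTypeE sG).
have : measurable ((A : set GT) `&` h n @^-1` [set r]) by exact: measurableI.
by rewrite (measurable_g_measurableTypeE sG).
Qed.

Lemma cond_exp_ge0_mull (W X : Omega -> R) :
  measurable_wrt G W -> (forall w, (0 <= W w)%R) ->
  measurable_fun setT X -> (forall w, (0 <= X w)%R) ->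
  {ae P, forall w, (W w)%:E * cond_exp_ge0 P G (EFin \o X) w =
    cond_exp_ge0 P G (EFin \o (W \* X)%R) w}.
Proof.
move=> GW W0 mX X0; have mW := measurable_wrt_fun GM GW.
have [GY Y0 YX] := cond_exp_ge0P (cond_exp_ge0_exists P sG GM mX X0).
have [GZ Z0 ZX] := cond_exp_ge0P (cond_exp_ge0_exists P sG GM
  (measurable_funM mW mX) (fun w => mulr_ge0 (W0 w) (X0 w))).
apply: (ge0_ae_eq_sub sG GM) => //.
- apply/(measurable_wrtP sG); apply: emeasurable_funM; last exact/measurable_wrtP.
  by apply/measurable_EFinP; exact/measurable_wrtP.
- by move=> w; rewrite mule_ge0 ?lee_fin.
- move=> A GA; rewrite ZX//; under [RHS]eq_integral do rewrite /= EFinM.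
  apply: ge0_integral_take_out => //.
  + exact: (measurable_wrt_fun GM GY).
  + exact/measurable_EFinP.
Qed.

Lemma cond_exp_ge0_fin (X : Omega -> \bar R) : (exists Y, is_cond_exp_ge0 P G X Y) ->
  \int[P]_w X w < +oo ->
  P.-integrable setT (cond_exp_ge0 P G X).
Proof.
move=> /cond_exp_ge0P[GY Y0 YX] iX; apply/integrableP; split.
  exact: (measurable_wrt_fun GM GY).
under eq_integral do rewrite gee0_abs//.
by rewrite YX//; rewrite -(measurable_g_measurableTypeE sG).
Qed.

Section integrable.
Variable X : Omega -> \bar R.
Hypothesis iX : P.-integrable setT X.

Let mX : measurable_fun setT X. Proof. exact: measurable_int iX. Qed.

Let expos : exists Y, is_cond_exp_ge0 P G X^\+ Y.
Proof.
apply: radon_nikodym_sub => //; first exact: measurable_funepos.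
exact: integral_funepos_lt_pinfty iX.
Qed.

Let exneg : exists Y, is_cond_exp_ge0 P G X^\- Y.
Proof.
apply: radon_nikodym_sub => //; first exact: measurable_funeneg.
exact: integral_funeneg_lt_pinfty iX.
Qed.

Let ipos := cond_exp_ge0_fin expos (integral_funepos_lt_pinfty measurableT iX).
Let ineg := cond_exp_ge0_fin exneg (integral_funeneg_lt_pinfty measurableT iX).

Lemma integrable_cond_exp : P.-integrable setT (cond_exp P G X).
Proof. exact: integrableB. Qed.

Lemma integral_cond_exp A : G A ->
  \int[P]_(w in A) cond_exp P G X w = \int[P]_(w in A) X w.
Proof.
move=> GA; have mA := GM GA.
rewrite integralB//; try exact: (integrableS measurableT).
rewrite [RHS]integralE; congr (_ - _).
  by have [_ _ ->] := cond_exp_ge0P expos.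
by have [_ _ ->] := cond_exp_ge0P exneg.
Qed.

Lemma cond_exp_unique (Y : Omega -> \bar R) : measurable_wrt G Y ->
  P.-integrable setT Y ->
  (forall A, G A -> \int[P]_(w in A) Y w = \int[P]_(w in A) X w) ->
  {ae P, forall w, Y w = cond_exp P G X w}.
Proof.
move=> GY iY YX.
have le1 : {ae P, forall w, Y w <= cond_exp P G X w}.
  apply: (integrable_ae_le_sub sG GM) => //.
  - exact: cond_exp_measurable.
  - exact: integrable_cond_exp.
  - by move=> A GA; rewrite integral_cond_exp// YX.
have le2 : {ae P, forall w, cond_exp P G X w <= Y w}.
  apply: (integrable_ae_le_sub sG GM) => //.
  - exact: cond_exp_measurable.
  - exact: integrable_cond_exp.
  - by move=> A GA; rewrite integral_cond_exp// YX.
by apply: filterS2 le1 le2 => w w12 w21; apply/eqP; rewrite eq_le w12.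
Qed.

End integrable.

Lemma cond_exp_le (X1 X2 : Omega -> \bar R) :
  P.-integrable setT X1 -> P.-integrable setT X2 ->
  (forall A, G A -> \int[P]_(w in A) X1 w <= \int[P]_(w in A) X2 w) ->
  {ae P, forall w, cond_exp P G X1 w <= cond_exp P G X2 w}.
Proof.
move=> iX1 iX2 X12; apply: (integrable_ae_le_sub sG GM).
- exact: cond_exp_measurable.
- exact: cond_exp_measurable.
- exact: integrable_cond_exp.
- exact: integrable_cond_exp.
- by move=> A GA; rewrite !integral_cond_exp// X12.
Qed.

(** Only the product is integrable. Where W = 0, both sides are 0 whatever the conditional
    expectations of the two parts of X. Where W > 0, finiteness of W E[X^- | G] forces that of
    E[X^- | G], and the multiplication distributes over the difference. *)
Lemma cond_exp_mull (W X : Omega -> R) :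
  measurable_wrt G W -> (forall w, (0 <= W w)%R) ->
  measurable_fun setT X -> P.-integrable setT (EFin \o (W \* X)%R) ->
  {ae P, forall w, (W w)%:E * cond_exp P G (EFin \o X) w =
    cond_exp P G (EFin \o (W \* X)%R) w}.
Proof.
move=> GW W0 mX iWX.
have posE : ((EFin \o (W \* X)%R)^\+ = EFin \o (W \* (X^\+)%R)%R).
  rewrite funerpos; apply/funext => w /=; congr EFin.
  by rewrite /funrpos maxr_pMr// mulr0.
have negE : ((EFin \o (W \* X)%R)^\- = EFin \o (W \* (X^\-)%R)%R).
  rewrite funerneg; apply/funext => w /=; congr EFin.
  by rewrite /funrneg maxr_pMr// mulr0 mulrN.
have Xp0 w : (0 <= (X^\+ w))%R by exact: funrpos_ge0.
have Xn0 w : (0 <= (X^\- w))%R by exact: funrneg_ge0.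
have mp := cond_exp_ge0_mull GW W0 (measurable_funrpos mX) Xp0.
have mn := cond_exp_ge0_mull GW W0 (measurable_funrneg mX) Xn0.
have mW := measurable_wrt_fun GM GW.
have fp : P.-integrable setT (cond_exp_ge0 P G (EFin \o (W \* X^\+)%R)).
  apply: cond_exp_ge0_fin; last by rewrite -posE; exact: integral_funepos_lt_pinfty iWX.
  apply: (cond_exp_ge0_exists P sG GM) => [|w]; last by rewrite mulr_ge0.
  by apply: measurable_funM => //; exact: measurable_funrpos.
have fn : P.-integrable setT (cond_exp_ge0 P G (EFin \o (W \* X^\-)%R)).
  apply: cond_exp_ge0_fin; last by rewrite -negE; exact: integral_funeneg_lt_pinfty iWX.
  apply: (cond_exp_ge0_exists P sG GM) => [|w]; last by rewrite mulr_ge0.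
  by apply: measurable_funM => //; exact: measurable_funrneg.
move/(integrable_ae measurableT) : fp => fp.
move/(integrable_ae measurableT) : fn => fn.
near=> w.
rewrite /cond_exp posE negE funerpos funerneg.
have fpw : cond_exp_ge0 P G (EFin \o (W \* X^\+)%R) w \is a fin_num.
  by apply: (near fp w).
have fnw : cond_exp_ge0 P G (EFin \o (W \* X^\-)%R) w \is a fin_num.
  by apply: (near fn w).
have mpw : (W w)%:E * cond_exp_ge0 P G (EFin \o X^\+%R) w =
  cond_exp_ge0 P G (EFin \o (W \* X^\+)%R) w by apply: (near mp w).
have mnw : (W w)%:E * cond_exp_ge0 P G (EFin \o X^\-%R) w =
  cond_exp_ge0 P G (EFin \o (W \* X^\-)%R) w by apply: (near mn w).
rewrite -mpw -mnw.
have [W0w|W0w] := eqVneq (W w) 0%R; first by rewrite W0w !mul0e sube0.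
have Ww : (0 < W w)%R by rewrite lt_neqAle eq_sym W0w W0.
have fn' : cond_exp_ge0 P G (EFin \o X^\-%R) w \is a fin_num.
  move: fnw; rewrite -mnw; case: cond_exp_ge0 => //=.
    by rewrite gt0_muley.
  by rewrite gt0_muleNy.
by rewrite muleBr// fin_num_adde_defl// fin_numN.
Unshelve. all: by end_near. Qed.

End take_out.

(** * Essential infimum and supremum of a family *)

Section essential_extrema.
Context {d : measure_display} {Omega : measurableType d} {R : realType}.
Variable P : probability Omega R.
Local Open Scope ereal_scope.

(* The union of a sequence maximising P(\bigcup_n C n) is the essential union. *)
Lemma ess_union (C : set (set Omega)) : C `<=` measurable -> C !=set0 ->
  exists2 D : (set Omega)^nat, (forall n, C (D n)) &
    forall A, C A -> P (A `\` \bigcup_n D n) = 0.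
Proof.
move=> mC [C0 CC0].
pose S := [set P (\bigcup_n D n) | D in [set D : (set Omega)^nat | forall n, C (D n)]].
have mU (D : (set Omega)^nat) : (forall n, C (D n)) -> measurable (\bigcup_n D n).
  by move=> CD; apply: bigcupT_measurable => n; exact/mC/CD.
have supfin : ereal_sup S \is a fin_num.
  rewrite fin_numElt; apply/andP; split.
    apply: (@lt_le_trans _ _ (P (\bigcup_(n : nat) C0))).
      exact: lt_le_trans (measure_ge0 _ _).
    by apply: ereal_sup_ubound; exists (fun=> C0).
  apply: (@le_lt_trans _ _ 1); last by rewrite ltry.
  by apply: ge_ereal_sup => _ [D CD <-]; apply: probability_le1; exact: mU.
have /choice[D DP] (k : nat) : exists D : (set Omega)^nat, (forall n, C (D n)) /\
    ereal_sup S - k.+1%:R^-1%:E < P (\bigcup_n D n).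
  have e0 : (0 < k.+1%:R^-1 :> R)%R by rewrite invr_gt0.
  have [_ [D CD <-] lt] := ub_ereal_sup_adherent e0 supfin.
  by exists D.
(* All the nearly maximising sequences are merged into one; [C0] fills the codes that decode to
   nothing. *)
pose E m := if unpickle m is Some (k, n) then D k n else C0.
have CE m : C (E m).
  by rewrite /E; case: unpickle => [[k n]|//]; case: (DP k).
have DE k : \bigcup_n D k n `<=` \bigcup_m E m.
  by move=> w [n _ Dn]; exists (pickle (k, n)) => //; rewrite /E pickleK.
have PE : P (\bigcup_m E m) = ereal_sup S.
  apply/eqP; rewrite eq_le; apply/andP; split.
    by apply: ereal_sup_ubound; exists E.
  apply/lee_addgt0Pr => e e0.
  have [k ke] : exists k : nat, (k.+1%:R^-1 < e)%R.
    by have /ltr_add_invr[k /[!add0r]] := e0; exists k.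
  have [_ /ltW lt] := DP k; rewrite leeBlDr// in lt.
  apply: (le_trans lt); apply: leeD; last by rewrite lee_fin ltW.
  by apply: le_measure; rewrite ?inE; [exact: mU (DP k).1|exact: mU|exact: DE].
exists E => // A CA.
have mA := mC _ CA; have mE := mU _ CE.
(* Prefixing A to the maximising sequence gives another competitor, so its union cannot have larger
   probability. *)
have : P (A `|` \bigcup_m E m) <= P (\bigcup_m E m).
  rewrite [leRHS]PE; apply: ereal_sup_ubound.
  exists (fun n => if n is n'.+1 then E n' else A); first by case.
  congr (P _); apply/seteqP; split => w.
    by move=> [[|n] _ h]; [left|right; exists n].
  by move=> [h|[n _ h]]; [exists 0%N|exists n.+1].
have -> : A `|` \bigcup_m E m = (A `\` \bigcup_m E m) `|` \bigcup_m E m.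
  apply/seteqP; split => w; last by move=> [[]|]; [left|right].
  by have [Ew _|nEw [Aw|//]] := pselect ((\bigcup_m E m) w); [right|left].
rewrite measureU//; last 2 first.
- exact: measurableD.
- by apply/seteqP; split=> // w [[]].
have fE : P (\bigcup_m E m) \is a fin_num by rewrite PE.
rewrite -leeBrDr// subee// => PA0; apply/eqP; rewrite eq_le PA0; exact: measure_ge0.
Qed.

(** For each rational q, countably many members of the family cover almost all of every level set X
    < q. The infimum of all these members, a countable family, is the essential infimum. Level sets
    are used because the members may be infinite or not integrable. *)
Lemma ess_inf_exists (Phi : set (Omega -> \bar R)) :
  (forall X, Phi X -> measurable_fun setT X) -> exists Y, is_ess_inf_fam P Phi Y.
Proof.
move=> mPhi; have [[X0 PhiX0]|Phi0] := pselect (Phi !=set0); last first.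
  exists (cst +oo); split; first exact: measurable_cst.
    by move=> X PhiX; exfalso; apply: Phi0; exists X.
  by move=> Y _ _; apply: aeW => w; rewrite leey.
have mlt X (q : rat) : Phi X -> measurable [set w | X w < (ratr q)%:E].
  move=> /mPhi mX; rewrite -[X in measurable X]setTI.
  exact: emeasurable_fun_infty_o.
have /choice[Z ZP] (q : rat) : exists Z : (Omega -> \bar R)^nat,
    (forall n, Phi (Z n)) /\ forall X, Phi X ->
    P ([set w | X w < (ratr q)%:E] `\`
       \bigcup_n [set w | Z n w < (ratr q)%:E]) = 0.
  have [||D CD DP] := @ess_union [set [set w | X w < (ratr q)%:E] | X in Phi].
  - by move=> _ [X PhiX <-]; exact: mlt.
  - by exists [set w | X0 w < (ratr q)%:E], X0.
  - have /choice[Z ZD] n : exists X, Phi X /\ [set w | X w < (ratr q)%:E] = D n.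
      by have [X PhiX XD] := CD n; exists X.
    exists Z; split => [n|X PhiX]; first exact: (ZD n).1.
    rewrite (_ : (fun n => _) = D); first by apply: DP; exists X.
    by apply/funext => n; exact: (ZD n).2.
pose W m := if unpickle m is Some (q, n) then Z q n else X0.
have PhiW m : Phi (W m).
  by rewrite /W; case: unpickle => [[q n]|//]; exact: (ZP q).1.
exists (fun w => einfs (W ^~ w) 0%N); split.
- by apply: measurable_fun_einfs => n; exact: mPhi.
- move=> X PhiX.
  have : {ae P, forall w, forall k : nat, if unpickle k is Some q then
      ~ (([set w | X w < (ratr q)%:E] `\`
       \bigcup_n [set w | Z q n w < (ratr q)%:E]) w) else True}.
    apply: ae_foralln => k; case: unpickle => [q|]; last exact: aeW.
    exists ([set w | X w < (ratr q)%:E] `\`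
       \bigcup_n [set w | Z q n w < (ratr q)%:E]); split.
    + apply: measurableD; first exact: mlt.
      by apply: bigcupT_measurable => n; apply: mlt; exact: (ZP q).1.
    + exact: (ZP q).2.
    + by move=> w /= /contrapT.
  apply: filterS => w Xw; rewrite leNgt; apply/negP => XY.
  (* A rational between the two values is strictly above X, so some [Z q n] is almost surely below q
     at w, although the infimum is at least q. *)
  have [q /andP[Xq qY]] : exists q : rat, X w < (ratr q)%:E <= einfs (W ^~ w) 0%N.
    move: XY; case: (X w) => [x||]; case: (einfs _ _) => [y||] //=.
    + rewrite lte_fin => /rat_in_itvoo[q]; rewrite in_itv/= => /andP[xq qy].
      by exists q; rewrite lte_fin xq lee_fin ltW.
    + move=> _; have /rat_in_itvoo[q] : (x < x + 1)%R by rewrite ltrDl.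
      by rewrite in_itv/= => /andP[xq _]; exists q; rewrite lte_fin xq leey.
    + move=> _; have /rat_in_itvoo[q] : (y - 1 < y)%R by rewrite ltrBlDr ltrDl.
      rewrite in_itv/= => /andP[_ qy]; exists q; rewrite ltNyr lee_fin.
      exact: ltW.
    + by move=> _; exists 0%R; rewrite ltNyr leey.
  have := Xw (pickle q); rewrite pickleK; apply; split => // -[n _ /= Znq].
  have := lt_le_trans Znq qY; rewrite ltNge => /negP; apply.
  apply: ereal_inf_lbound; exists (pickle (q, n)) => //.
  by rewrite /W pickleK.
- move=> Y mY YPhi.
  have : {ae P, forall w, forall m, Y w <= W m w} by apply: ae_foralln => m; exact: YPhi.
  by apply: filterS => w Yw; apply: le_ereal_inf_tmp => _ [m _ <-].
Qed.

Lemma ess_inf_famP (Phi : set (Omega -> \bar R)) :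
  (forall X, Phi X -> measurable_fun setT X) ->
  is_ess_inf_fam P Phi (ess_inf_fam P Phi).
Proof.
by move=> /ess_inf_exists[Y PY];
  exact: (@xgetPex _ (cst 0) [set Y | _] (ex_intro _ Y PY)).
Qed.

Lemma ess_sup_famP (Phi : set (Omega -> \bar R)) :
  (forall X, Phi X -> measurable_fun setT X) ->
  is_ess_sup_fam P Phi (ess_sup_fam P Phi).
Proof.
move=> mPhi.
have [Y [mY YX Ymax]] : exists Y,
    is_ess_inf_fam P [set (\- X) | X in Phi] Y.
  apply: ess_inf_exists => _ [X /mPhi mX <-].
  exact: measurableT_comp mX.
suff PY : is_ess_sup_fam P Phi (\- Y).
  exact: (@xgetPex _ (cst 0) [set Y | _] (ex_intro _ _ PY)).
split; first exact: measurableT_comp mY.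
  move=> X PhiX; have := YX (\- X) (ex_intro2 _ _ X PhiX erefl).
  by apply: filterS => w /=; rewrite leeNr.
move=> Y' mY' XY'; have mNY' : measurable_fun setT (\- Y').
  exact: measurableT_comp mY'.
apply: filterS (Ymax _ mNY' _) => [w /=|_ [X PhiX <-]]; first by rewrite leeNl.
by apply: filterS (XY' _ PhiX) => w /=; rewrite leeN2.
Qed.

End essential_extrema.

(** * The measure dx of a control path *)

Lemma lebesgue_stieltjes_oc (R : realType) (c : cumulative R R) a b : a <= b ->
  lebesgue_stieltjes_measure c `]a, b]%classic = (c b - c a)%:E.
Proof.
move=> ab; rewrite /lebesgue_stieltjes_measure /measure_extension/=.
rewrite measurable_mu_extE/=; last exact: is_ocitv.
by rewrite wlength_itv_bnd// EFinB.
Qed.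

Section control.
Context {R : realType}.
Variable T : R.
Hypothesis T0 : 0 < T.

(** What an admissible control provides on each path, whatever its starting time. Left limits are
    recovered from monotonicity. *)
Record control (x : R -> R) : Prop := {
  control_ge0 : forall t, 0 <= t <= T -> 0 <= x t;
  control_mono : forall s t, 0 <= s -> s <= t -> t <= T -> x s <= x t;
  control_rcont : forall t, 0 <= t < T -> x s @[s --> t^'+] --> x t;
  control_end : x T = 1 }.

Variable x : R -> R.
Hypothesis cx : control x.
Local Notation X := (extend_path T x).

Lemma control_le1 t : 0 <= t <= T -> x t <= 1.
Proof.
by move=> /andP[t0 tT]; rewrite -(control_end cx); exact: control_mono.
Qed.

Lemma extend_pathE t : 0 <= t <= T -> X t = x t.
Proof.
by move=> /andP[t0 tT]; rewrite /extend_path ltNge t0/= min_l.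
Qed.

Lemma extend_path_lt0 t : t < 0 -> X t = 0.
Proof. by rewrite /extend_path => ->. Qed.

Lemma extend_path_ge t : T <= t -> X t = 1.
Proof.
move=> Tt; rewrite /extend_path ltNge (le_trans (ltW T0) Tt)/= min_r//.
exact: control_end.
Qed.

Lemma extend_path_nd : nondecreasing X.
Proof.
move=> s t st; rewrite /extend_path; case: ltP => s0.
  case: ltP => // t0; apply: (control_ge0 cx).
  by rewrite le_min t0 ltW//= ge_min lexx orbT.
rewrite ltNge (le_trans s0 st)/=; apply: (control_mono cx).
- by rewrite le_min s0 ltW.
- by rewrite le_min !ge_min lexx orbT st.
- by rewrite ge_min lexx orbT.
Qed.

Lemma extend_path_rc : right_continuous X.
Proof.
move=> t; case: (ltP t 0) => t0.
  rewrite extend_path_lt0//; apply: cvg_near_cst; near=> s.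
  rewrite extend_path_lt0//.
case: (ltP t T) => tT; last first.
  rewrite extend_path_ge//; apply: cvg_near_cst; near=> s.
  by rewrite extend_path_ge// (le_trans tT).
rewrite extend_pathE ?t0 ?ltW//.
have := control_rcont cx; move/(_ t); rewrite t0 tT => /(_ isT).
apply: cvg_trans; apply: near_eq_cvg; near=> s; rewrite extend_pathE//.
apply/andP; split; first by apply: (le_trans t0); near: s; exact: nbhs_right_ge.
by near: s; exact: nbhs_right_le.
Unshelve. all: by end_near. Qed.

Lemma is_cumulative_extend_path : is_cumulative X.
Proof. by split; [exact: extend_path_nd|exact: extend_path_rc]. Qed.

Lemma dpathE : dpath T x =
  lebesgue_stieltjes_measure (to_cumulative is_cumulative_extend_path).
Proof.
rewrite /dpath; case: pselect => [H|/(_ is_cumulative_extend_path)//].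
by rewrite (Prop_irrelevance H is_cumulative_extend_path).
Qed.

Lemma dpath_oc a b : a <= b -> dpath T x `]a, b]%classic = (X b - X a)%:E.
Proof. by move=> ab; rewrite dpathE; exact: lebesgue_stieltjes_oc. Qed.

(** As the extension is 0 before time 0, [X] is the distribution function of the measure, and a jump
    at time 0 is counted. *)
Lemma dpath_ray b : dpath T x `]-oo, b]%classic = (X b)%:E.
Proof.
rewrite itvNybndEbigcup; set I := fun k : nat => `]- k%:R, b]%classic.
have mI k : measurable (I k : set (measurableTypeR R)) by exact: measurable_itv.
have cI : (dpath T x \o I) n @[n --> \oo] --> dpath T x (\bigcup_n I n).
  apply: nondecreasing_cvg_mu => //; first exact: bigcupT_measurable.
  by move=> m n mn; apply/subsetPset/subset_itv; rewrite leBSide//= lerN2 ler_nat.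
apply: (cvg_unique _ cI) => //; apply: cvg_near_cst; near=> n.
rewrite /I/= dpath_oc; last first.
  by rewrite lerNl; near: n; exact: nbhs_infty_ger.
rewrite (@extend_path_lt0 (- _)) ?subr0// oppr_lt0.
by near: n; exact: nbhs_infty_gtr.
Unshelve. all: by end_near. Qed.

Lemma dpath_setT : dpath T x setT = 1%E.
Proof.
have cI : (dpath T x \o (fun n : nat => `]-oo, n%:R]%classic)) n @[n --> \oo] -->
    dpath T x (\bigcup_n `]-oo, n%:R]%classic).
  apply: nondecreasing_cvg_mu => //; first exact: bigcupT_measurable.
  by move=> m n mn; apply/subsetPset/subset_itv; rewrite // leBSide//= ler_nat.
have -> : [set: R] = \bigcup_n `]-oo, n%:R]%classic.
  apply/esym; rewrite -subTset => y _; exists (Num.truncn y).+1 => //=.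
  by rewrite in_itv/= ltW// truncnS_gt.
apply: (cvg_unique _ cI) => //; apply: cvg_near_cst; near=> n.
rewrite /= dpath_ray extend_path_ge//.
by near: n; exact: nbhs_infty_ger.
Unshelve. all: by end_near. Qed.

Lemma left_lim_cvg t : 0 < t -> t <= T ->
  x s @[s --> t^'-] --> lim (x s @[s --> t^'-]).
Proof.
move=> t0 tT; apply: nondecreasing_at_left_is_cvgr; near=> r.
  have r0 : 0 < r by near: r; exact: nbhs_left_gt.
  move=> a b; rewrite !in_itv/= => /andP[ra at_] /andP[rb bt] ab.
  by apply: (control_mono cx) => //; [apply/ltW; exact: lt_trans ra|
    exact: le_trans (ltW bt) tT].
have r0 : 0 < r by near: r; exact: nbhs_left_gt.
exists 1 => _ [s /= + <-]; rewrite in_itv/= => /andP[rs st].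
by apply: control_le1; rewrite (ltW (lt_trans r0 rs)) (le_trans (ltW st)).
Unshelve. all: by end_near. Qed.

(** The convention that the left limit at 0 is 0 agrees with the extended path, so time 0 needs no
    separate treatment in the formulas for open rays and atoms. *)
Lemma extend_path_cvg_left t : 0 <= t -> t <= T ->
  X (t - n.+1%:R^-1) @[n --> \oo] --> left_lim x t.
Proof.
move=> t0 tT; rewrite /left_lim; case: ifPn => [{}t0|]; last first.
  rewrite -leNgt => t0'; apply: cvg_near_cst; near=> n.
  rewrite /= extend_path_lt0//.
  by rewrite (le_lt_trans (lerD t0' (lexx _)))// add0r oppr_lt0 invr_gt0.
have /cvg_at_leftP := left_lim_cvg t0 tT.
move=> /(_ (fun n => t - n.+1%:R^-1)) xt.
apply: cvg_trans (xt _); last first.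
  split=> [n|]; first by rewrite ltrBlDr ltrDl invr_gt0.
  rewrite -[X in _ --> X]subr0; apply: cvgB; first exact: cvg_cst.
  exact: cvg_harmonic.
apply: near_eq_cvg; near=> n; rewrite /= extend_pathE// subr_ge0; apply/andP; split.
  by apply: ltW; near: n; exact: (near_infty_natSinv_lt (PosNum t0)).
by rewrite (le_trans _ tT)// lerBlDr lerDl invr_ge0.
Unshelve. all: by end_near. Qed.

Lemma dpath_open_ray t : 0 <= t <= T ->
  dpath T x `]-oo, t[%classic = (left_lim x t)%:E.
Proof.
move=> /andP[t0 tT].
have -> : `]-oo, t[%classic = \bigcup_n `]-oo, t - n.+1%:R^-1]%classic.
  apply/seteqP; split => s /=; rewrite in_itv/=.
    rewrite -subr_gt0 => /ltr_add_invr[k /[!add0r] kts]; exists k => //=.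
    by rewrite in_itv/= lerBrDr -lerBrDl ltW.
  move=> [k _ /=]; rewrite in_itv/= => /le_lt_trans; apply.
  by rewrite ltrBlDr ltrDl invr_gt0.
have cI : (dpath T x \o (fun n : nat => `]-oo, t - n.+1%:R^-1]%classic)) n
    @[n --> \oo] --> dpath T x (\bigcup_n `]-oo, t - n.+1%:R^-1]%classic).
  apply: nondecreasing_cvg_mu => //; first exact: bigcupT_measurable.
  move=> m n mn; apply/subsetPset/subset_itv; rewrite // leBSide//=.
  by rewrite lerD2l lerN2 lef_pV2// ?posrE// ler_nat.
apply: (cvg_unique _ cI) => //.
rewrite (_ : _ \o _ = EFin \o (fun n : nat => X (t - n.+1%:R^-1))); last first.
  by apply/funext => n; exact: dpath_ray.
apply/cvg_EFin; first by near=> n.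
exact: extend_path_cvg_left.
Unshelve. all: by end_near. Qed.

Lemma dpath_set1 t : 0 <= t <= T -> dpath T x [set t] = (jump x t)%:E.
Proof.
move=> tT; have -> : [set t] = `]-oo, t]%classic `\` `]-oo, t[%classic.
  apply/seteqP; split => s /=; rewrite !in_itv/=.
    by move=> ->; rewrite lexx ltxx.
  by move=> [st /negP]; rewrite -leNgt => ts; apply/eqP; rewrite eq_le st.
rewrite measureD//; last by rewrite [ltLHS]dpath_ray ltry.
rewrite setIidr; last by move=> s /=; rewrite !in_itv/= => /ltW.
by rewrite [X in (X - _)%E]dpath_ray [X in (_ - X)%E]dpath_open_ray// extend_pathE// /jump EFinB.
Qed.

Lemma left_lim_ge0 t : 0 <= t <= T -> 0 <= left_lim x t.
Proof. by move=> tT; rewrite -lee_fin -dpath_open_ray. Qed.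

Lemma left_lim_le t : 0 <= t <= T -> left_lim x t <= x t.
Proof.
move=> tT; rewrite -lee_fin -dpath_open_ray// -extend_pathE// -dpath_ray.
by apply: le_measure; rewrite ?inE// => s /=; rewrite !in_itv/= => /ltW.
Qed.

Lemma left_lim_le1 t : 0 <= t <= T -> left_lim x t <= 1.
Proof. by move=> tT; rewrite (le_trans (left_lim_le tT))// control_le1. Qed.

End control.

(** Finite masses of rays determine those of the intervals []a, b]] by subtraction, and these
    intervals are stable under intersection and exhaust the line. *)
Lemma measure_ray_unique (R : realType)
    (m1 m2 : {measure set (measurableTypeR R) -> \bar R}) :
  (forall b, m1 `]-oo, b]%classic = m2 `]-oo, b]%classic) ->
  (forall b, (m1 `]-oo, b]%classic < +oo)%E) ->
  forall A, measurable A -> m1 A = m2 A.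
Proof.
move=> m12 m1oo; have m2oo b : (m2 `]-oo, b]%classic < +oo)%E by rewrite -m12.
apply: (@measure_unique _ R (measurableTypeR R) (@ocitv R)
  (fun n : nat => `](- n%:R), n%:R]%classic) _ _ _ _ m1 m2) => //.
- exact: ocitvI.
- by move=> n; exact: is_ocitv.
- rewrite -subTset => /= y _; exists (Num.truncn `|y|).+1 => //=.
  have := truncnS_gt `|y|; rewrite in_itv/= ltr_norml => /andP[-> /ltW].
  by [].
- move=> _ [[a b] _ <-] /=; have [ab|ba] := leP a b; last first.
    by rewrite set_itv_ge ?measure0// bnd_simp -leNgt ltW.
  have -> : `]a, b]%classic = `]-oo, b]%classic `\` `]-oo, a]%classic.
    by rewrite -[RHS]setCK setCD setCitvl setUC -[LHS]setCK setCitv.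
  rewrite !measureD//; try by [exact: m1oo|exact: m2oo].
  rewrite !setIidr; try by exact: subset_itvl.
  by congr (_ - _)%E; exact: m12.
- move=> n; apply: le_lt_trans (m1oo n%:R).
  by apply: le_measure; rewrite ?inE//; exact: subset_itvr.
Qed.

(** * The quantile transform of a control path *)

Section quantile.
Context {R : realType}.
Variable T : R.
Hypothesis T0 : 0 < T.

(* [generated_time T rho Z w] is [quantile T (rho ^~ w) (Z w)]. *)
Definition quantile (x : R -> R) (u : R) : R :=
  inf [set t | 0 <= t <= T /\ u < x t].

Section path.
Variable x : R -> R.
Hypothesis cx : control T x.

Let lb u : has_lbound [set t | 0 <= t <= T /\ u < x t].
Proof. by exists 0 => t [/andP[]]. Qed.

Lemma quantile_le u t : 0 <= t <= T -> u < x t -> quantile x u <= t.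
Proof. by move=> tT ut; apply: ge_inf. Qed.

Lemma quantile_ge1 u : 1 <= u -> quantile x u = 0.
Proof.
move=> u1; rewrite /quantile (_ : [set _ | _] = set0) ?inf0//.
apply/seteqP; split => // t [tT]; apply/negP; rewrite -leNgt.
by rewrite (le_trans (control_le1 cx tT)).
Qed.

Let ne u : u < 1 -> [set t | 0 <= t <= T /\ u < x t] !=set0.
Proof. by move=> u1; exists T; rewrite /= lexx ltW// (control_end cx). Qed.

Lemma quantile_range u : 0 <= quantile x u <= T.
Proof.
have [u1|u1] := leP 1 u; first by rewrite quantile_ge1// lexx ltW.
apply/andP; split; first by apply: lb_le_inf; [exact: ne|move=> t [/andP[]]].
by apply: quantile_le; rewrite ?lexx ?(ltW T0)// (control_end cx).
Qed.

Lemma quantile_lt u t : u < 1 -> quantile x u < t ->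
  exists s, [/\ 0 <= s <= T, u < x s & s < t].
Proof.
move=> u1 qt; have [s [sT us] st] := inf_lt (ne u1) qt.
by exists s.
Qed.

(** With [quantile_le], this squeezes the event quantile <= t between u < x t and u <= x t, two
    events of equal uniform probability. Right-continuity of x at t supplies this half. The bound u
    < 1 excludes the default value of [inf]. *)
Lemma le_quantile u t : u < 1 -> 0 <= t <= T -> quantile x u <= t -> u <= x t.
Proof.
move=> u1 /andP[t0]; rewrite le_eqVlt => /predU1P[->|tT].
  by rewrite (control_end cx) (ltW u1).
move=> qt; have tTT : 0 <= t < T by rewrite t0.
apply: (cvgr_to_ge (control_rcont cx tTT)); near=> s.
have st : t < s by near: s; exact: nbhs_right_gt.
have [r [/andP[r0 rT] ur rs]] := quantile_lt u1 (le_lt_trans qt st).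
apply/ltW; apply: (lt_le_trans ur); apply: (control_mono cx) => //.
  exact: ltW.
by near: s; exact: nbhs_right_le.
Unshelve. all: by end_near. Qed.

End path.

(** By monotonicity, the quantile is below t exactly when u < rho r for some rational r < t, or when
    u >= 1, where the quantile has its default value 0. This leaves a countable union of measurable
    sets. *)
Lemma measurable_quantile d (Omega : measurableType d) (rho : R -> Omega -> R) :
  (forall w, control T (rho ^~ w)) ->
  (forall t, 0 <= t <= T -> measurable_fun setT (rho t)) ->
  measurable_fun setT (fun p : Omega * R => quantile (rho ^~ p.1) p.2).
Proof.
move=> crho mrho; apply: (measurability _ (RGenInftyO.measurableE R)).
move=> _ [_ [t ->] <-]; rewrite setTI.
have [t0|t0] := leP t 0.
  rewrite (_ : _ @^-1` _ = set0)//; apply/seteqP; split => // p /=.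
  rewrite in_itv/= ltNge; have /andP[q0 _] := quantile_range (crho p.1) p.2.
  by rewrite (le_trans t0).
have [tT|tT] := ltP T t.
  rewrite (_ : _ @^-1` _ = setT)//; apply/seteqP; split => // p _ /=.
  rewrite in_itv/=; have /andP[_ qT] := quantile_range (crho p.1) p.2.
  exact: le_lt_trans tT.
pose U (r : rat) : set (Omega * R) :=
  if (0 <= ratr r :> R) && (ratr r < t) then
  [set p : Omega * R | p.2 < rho (ratr r) p.1] else set0.
have -> : (fun p : Omega * R => quantile (rho ^~ p.1) p.2) @^-1` `]-oo, t[%classic =
    [set p : Omega * R | 1 <= p.2] `|` \bigcup_r U r.
  apply/seteqP; split => [[w u]/=|[w u]/= [u1|[r _]]].
  - rewrite in_itv => /= qt; have [u1|u1] := leP 1 u; [by left|right].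
    have [s [/andP[s0 sT] us st]] := quantile_lt (crho w) u1 qt.
    have /rat_in_itvoo[r] := st; rewrite in_itv/= => /andP[sr rt].
    exists r => //; rewrite /U rt (le_trans s0 (ltW sr))/=.
    apply: (lt_le_trans us); apply: (control_mono (crho w)) => //; first exact: ltW.
    exact: le_trans (ltW rt) tT.
  - by rewrite in_itv/= (quantile_ge1 (crho w)).
  - rewrite /U; case: ifP => // /andP[r0 rt] /= ur; rewrite in_itv/=.
    apply: (le_lt_trans _ rt); apply: quantile_le => //.
    by rewrite r0 (le_trans (ltW rt)).
apply: measurableU.
  rewrite (_ : [set _ | _] = snd @^-1` `[1, +oo[%classic); last first.
    by apply/seteqP; split => p /=; rewrite in_itv/= andbT.
  by rewrite -[X in measurable X]setTI; exact: measurable_snd.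
apply: bigcupT_measurable_rat => r; rewrite /U; case: ifP => // /andP[r0 rt].
have mr : measurable_fun setT (fun p : Omega * R => rho (ratr r) p.1).
  by apply: measurableT_comp; [apply: mrho; rewrite r0 (le_trans (ltW rt))|
    exact: measurable_fst].
have /(_ measurableT [set true] I) :=
  measurable_fun_ltr (@measurable_snd _ _ Omega R) mr.
by rewrite setTI.
Qed.

End quantile.

Section uniform.
Context {R : realType}.
Local Notation Q := (uniform_prob (@ltr01 R)).

Lemma uniform_prob_itv (U : set (measurableTypeR R)) b c :
  measurable U -> 0 <= c -> U `&` `[0, 1]%classic = [set` Interval (BLeft 0) (BSide b c)] ->
  Q U = c%:E.
Proof.
move=> mU c0 UE; rewrite /uniform_prob integral_uniform_pdf UE.
rewrite (eq_integral (fun=> 1%:E)); last first.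
  move=> x; rewrite -UE inE/= in_itv/= => -[_ x01].
  by rewrite /uniform_pdf x01 subr0 invr1.
rewrite integral_cst//= mul1e lebesgue_measure_itv/= lte_fin.
by case: ltP => [_|c0']; [rewrite sube0|rewrite (@le_anti _ _ c 0)// c0 c0'].
Qed.

Lemma uniform_prob_oray c : 0 <= c <= 1 -> Q `]-oo, c[%classic = c%:E.
Proof.
move=> /andP[c0 c1]; apply: (@uniform_prob_itv _ true) => //.
apply/seteqP; split => x /=; rewrite !in_itv/=.
  by move=> [-> /andP[->]].
by move=> /andP[-> xc]; rewrite xc (le_trans (ltW xc)).
Qed.

Lemma uniform_prob_cray c : 0 <= c <= 1 -> Q `]-oo, c]%classic = c%:E.
Proof.
move=> /andP[c0 c1]; apply: (@uniform_prob_itv _ false) => //.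
apply/seteqP; split => x /=; rewrite !in_itv/=.
  by move=> [-> /andP[->]].
by move=> /andP[-> xc]; rewrite xc (le_trans xc).
Qed.

Lemma uniform_prob_ge1 : Q `[1, +oo[%classic = 0%E.
Proof.
have := @uniform_prob_oray 1; rewrite ler01 lexx => /(_ isT) Q1.
have : (Q `]-oo, 1%R[%classic + Q `[1%R, +oo[%classic = 1)%E.
  rewrite -measureU//; last first.
    apply/seteqP; split => // x /= []; rewrite !in_itv/= andbT => x1.
    by rewrite leNgt x1.
  rewrite (_ : _ `|` _ = setT); first exact: probability_setT.
  apply/seteqP; split => // x _ /=; rewrite !in_itv/= andbT.
  by have [|] := leP 1 x; [right|left].
by rewrite Q1 addeC => /(congr1 (fun z => z - 1%:E)%E); rewrite addeK// subee.
Qed.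

End uniform.

Section dpath_quantile.
Context {R : realType}.
Variable T : R.
Hypothesis T0 : 0 < T.
Local Notation Q := (uniform_prob (@ltr01 R)).

Variable x : R -> R.
Hypothesis cx : control T x.

Lemma measurable_quantile_path :
  measurable_fun [set: measurableTypeR R] (quantile T x : _ -> measurableTypeR R).
Proof.
have mq : measurable_fun [set: unit * R] (fun p => quantile T x p.2).
  by apply: (@measurable_quantile _ T T0 _ unit (fun t => (fun=> x t))).
exact: (measurableT_comp mq (pair1_measurable tt)).
Qed.

Let qmixin := isMeasurableFun.Build _ _ _ _ _ measurable_quantile_path.
Let q : {mfun measurableTypeR R >-> measurableTypeR R} :=
  HB.pack (quantile T x : measurableTypeR R -> measurableTypeR R) qmixin.

(** The inverse transform: the quantile function carries the uniform law to the measure of the path.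
    Rays suffice, and the values u >= 1, where the quantile is a default, form a null set. *)
Lemma dpath_quantile A : measurable A ->
  dpath T x A = Q (quantile T x @^-1` A).
Proof.
apply: (@measure_ray_unique _ (dpath T x) (pushforward Q q)) => b; last first.
  by rewrite dpath_ray// ltry.
rewrite dpath_ray// -[RHS]/(Q (quantile T x @^-1` `]-oo, b]%classic)).
have [b0|b0] := ltP b 0.
  rewrite extend_path_lt0// (_ : _ @^-1` _ = set0) ?measure0//.
  apply/seteqP; split => // u /=; rewrite in_itv/= leNgt.
  have /andP[q0 _] := quantile_range T0 cx u.
  by rewrite (lt_le_trans b0 q0).
have [Tb|Tb] := leP T b.
  rewrite extend_path_ge// (_ : _ @^-1` _ = setT); first by rewrite [RHS]probability_setT.
  apply/seteqP; split => // u _ /=; rewrite in_itv/=.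
  have /andP[_ qT] := quantile_range T0 cx u.
  exact: le_trans Tb.
have bT : 0 <= b <= T by rewrite b0 ltW.
have xb01 : 0 <= x b <= 1 by rewrite (control_ge0 cx)// (control_le1 cx).
have mq : measurable (quantile T x @^-1` `]-oo, b]%classic : set (measurableTypeR R)).
  by rewrite -[X in measurable X]setTI; exact: measurable_quantile_path.
rewrite extend_pathE//; apply/eqP; rewrite eq_le; apply/andP; split.
  rewrite -(uniform_prob_oray xb01); apply: le_measure; rewrite ?inE//.
  by move=> u /=; rewrite !in_itv/= => ux; exact: quantile_le.
rewrite -(uniform_prob_cray xb01) -[leRHS]adde0 -(@uniform_prob_ge1 R).
apply: (@le_trans _ _ (Q (`]-oo, x b]%classic `|` `[1%R, +oo[%classic))); last first.
  exact: measureU2.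
apply: le_measure; rewrite ?inE//; first exact: measurableU.
move=> u /=; rewrite !in_itv/= andbT => qb.
by have [u1|u1] := ltP u 1; [left; exact: (le_quantile T0 cx)|right].
Qed.

Lemma integral_dpath D (phi : R -> R) : measurable D -> measurable_fun D phi ->
  (\int[dpath T x]_(t in D) (phi t)%:E =
   \int[Q]_u ((phi \_ D) (quantile T x u))%:E)%E.
Proof.
move=> mD mphi; rewrite integral_mkcond.
rewrite (_ : _ \_ _ = EFin \o (phi \_ D)); last first.
  by apply/funext => t; rewrite /= !patchE; case: ifP.
have mphiD : measurable_fun [set: measurableTypeR R] (phi \_ D).
  exact/(measurable_restrictT _ _).1.
rewrite integralE [RHS]integralE; congr (_ - _)%E.
  transitivity (\int[pushforward Q q]_t (EFin \o phi \_ D)^\+%E t)%E.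
    by apply: eq_measure_integral => A mA _; exact: dpath_quantile.
  rewrite ge0_integral_pushforward//; last first.
    by apply: measurable_funepos; exact/measurable_EFinP.
  by rewrite preimage_setT; apply: eq_integral => u _; rewrite /= !funeposE.
transitivity (\int[pushforward Q q]_t (EFin \o phi \_ D)^\-%E t)%E.
  by apply: eq_measure_integral => A mA _; exact: dpath_quantile.
rewrite ge0_integral_pushforward//; last first.
  by apply: measurable_funeneg; exact/measurable_EFinP.
by rewrite preimage_setT; apply: eq_integral => u _; rewrite /= !funenegE.
Qed.

Lemma Rintegral_dpath D (phi : R -> R) : measurable D -> measurable_fun D phi ->
  \int[dpath T x]_(t in D) phi t = \int[Q]_u (phi \_ D) (quantile T x u).
Proof. by move=> mD mphi; congr fine; exact: integral_dpath. Qed.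

End dpath_quantile.

(** * Bounded measurable paths *)

Section regular.
Context {R : realType}.
Variable T : R.
Hypothesis T0 : 0 < T.

(** One-sided limits bound the path near each time, and compactness of [0, T] makes the local bounds
    uniform. *)
Lemma cadlag_bounded (a : R -> R) : cadlag T a ->
  exists M, forall t, 0 <= t <= T -> `|a t| <= M.
Proof.
move=> [arc all].
have loc t : `[0, T]%classic t -> exists M : R,
    \forall s \near t, `[0, T]%classic s -> `|a s| <= M.
  rewrite /= in_itv/= => /andP[t0 tT].
  have [MR HR] : exists M : R, \forall s \near t^'+, s <= T -> `|a s| <= M.
    (* At the right end, no time of [0, T] lies in the one-sided neighbourhood, so any bound serves;
       the left end is treated alike below. *)
    have [Tt|tT'] := leP T t.
      exists 0; near=> s => sT.
      suff : t < s by rewrite ltNge (le_trans sT).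
      by near: s; exact: nbhs_right_gt.
    have tTT : 0 <= t < T by rewrite t0.
    have /cvgrPdist_le/(_ 1 ltr01) := arc _ tTT.
    exists (`|a t| + 1); near=> s => _.
    rewrite -lerBlDl (le_trans (lerB_dist _ _))// distrC.
    by near: s.
  have [ML HL] : exists M : R, \forall s \near t^'-, 0 <= s -> `|a s| <= M.
    have [t0'|t0'] := leP t 0.
      exists 0; near=> s => s0.
      suff : s < t by rewrite ltNge (le_trans t0').
      by near: s; exact: nbhs_left_lt.
    have /cvg_ex[l al] : cvg (a s @[s --> t^'-]) by apply: all; rewrite t0'.
    have /cvgrPdist_le/(_ 1 ltr01) := al.
    exists (`|l| + 1); near=> s => _.
    rewrite -lerBlDl (le_trans (lerB_dist _ _))// distrC.
    by near: s.
  exists (Num.max `|a t| (Num.max MR ML)).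
  rewrite /at_right /at_left !near_withinE in HR HL.
  near=> s; rewrite /= in_itv/= => /andP[s0 sT]; rewrite !le_max.
  have [st|ts|->] := ltgtP s t; last by rewrite lexx.
    have -> : `|a s| <= ML by move: s0; apply: (near HL s).
    by rewrite !orbT.
  have -> : `|a s| <= MR by move: sT; apply: (near HR s).
  by rewrite !orbT.
have /compact_near_coveringP/near_covering_withinP := @segment_compact R 0 T.
move=> /(_ _ (pinfty_nbhs R) (fun M t => `|a t| <= M) _)[|M0 [_ HM]].
  move=> t tT; have [M HM] := loc _ tT.
  exists ([set s | `[0, T]%classic s -> `|a s| <= M], [set M' | M <= M']).
    by split => //=; apply: nbhs_pinfty_ge; rewrite num_real.
  by move=> [s M'] /= [sM MM'] /sM; move/le_trans; apply.
exists (M0 + 1) => t tT; apply: (HM (M0 + 1)) => //=.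
by rewrite ltrDl.
Unshelve. all: by end_near. Qed.

(* Paths that can be integrated over [0, T] against every finite measure. *)
Definition regular (a : R -> R) : Prop :=
  measurable_fun `[0, T]%classic a /\
  exists M, forall t, 0 <= t <= T -> `|a t| <= M.

Lemma regularN a : regular a -> regular (\- a).
Proof.
move=> [ma [M aM]]; split; first exact: measurable_funN.
by exists M => t tT; rewrite normrN; exact: aM.
Qed.

Lemma regularD a b : regular a -> regular b -> regular (a \+ b).
Proof.
move=> [ma [M aM]] [mb [N bN]]; split; first exact: measurable_funD.
by exists (M + N) => t tT; rewrite (le_trans (ler_normD _ _))// lerD ?aM ?bN.
Qed.

Lemma regularB a b : regular a -> regular b -> regular (fun t => a t - b t).
Proof. by move=> ra rb; apply: regularD => //; exact: regularN. Qed.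

Lemma regularM a b : regular a -> regular b -> regular (fun t => a t * b t).
Proof.
move=> [ma [M aM]] [mb [N bN]]; split; first exact: measurable_funM.
by exists (M * N) => t tT; rewrite normrM ler_pM ?aM ?bN.
Qed.

Lemma regular_cst c : regular (cst c).
Proof. by split; [exact: measurable_cst|exists `|c|]. Qed.

Lemma regular_control x : control T x -> regular x.
Proof.
move=> cx; split; last first.
  by exists 1 => t tT; rewrite ger0_norm ?(control_le1 cx)// (control_ge0 cx).
apply: (eq_measurable_fun (extend_path T x)).
  by move=> t; rewrite inE/= in_itv/= => tT; rewrite extend_pathE.
by apply: nondecreasing_measurable => //; exact: extend_path_nd.
Qed.

(** The left limit is the mass of an open ray, hence nondecreasing in time, hence Borel. *)
Lemma regular_left_lim x : control T x -> regular (left_lim x).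
Proof.
move=> cx; split; last first.
  exists 1 => t tT; rewrite ger0_norm ?(left_lim_le1 T0 cx)//.
  exact: (left_lim_ge0 T0 cx).
apply: (eq_measurable_fun (fun t : R => fine (dpath T x `]-oo, t[%classic))).
  by move=> t; rewrite inE/= in_itv/= => tT; rewrite (dpath_open_ray T0 cx).
apply: nondecreasing_measurable => // s t st.
have fin u : dpath T x `]-oo, u[%classic \is a fin_num.
  rewrite ge0_fin_numE//; apply: (@le_lt_trans _ _ (dpath T x setT)).
    by apply: le_measure; rewrite ?inE.
  by rewrite (dpath_setT T0 cx) ltry.
rewrite fine_le//; apply: le_measure; rewrite ?inE//.
by move=> u /=; rewrite !in_itv/= => /lt_le_trans; apply.
Qed.

Lemma regular_jump x : control T x -> regular (jump x).
Proof.
move=> cx; apply: regularB; first exact: regular_control.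
exact: regular_left_lim.
Qed.

Lemma regular_integrable x D a : control T x -> measurable D ->
  D `<=` `[0, T]%classic -> regular a -> (dpath T x).-integrable D (EFin \o a).
Proof.
move=> cx mD D0T [ma [M aM]]; apply: measurable_bounded_integrable => //.
- apply: (@le_lt_trans _ _ (dpath T x setT)).
    by apply: le_measure; rewrite ?inE.
  by rewrite (dpath_setT T0 cx) ltry.
- exact: measurable_funS ma.
- exists M; split; first exact: num_real.
  by move=> N MN t /D0T; rewrite /= in_itv/= => /aM /le_trans; apply; exact: ltW.
Qed.

End regular.

(** * Path measures under agreement before a time and rescaling after it *)

Section paste.
Context {R : realType}.
Variable T : R.
Hypothesis T0 : 0 < T.
Implicit Types x y : R -> R.

Lemma left_lim_eq x y t : (forall s, 0 <= s < t -> x s = y s) ->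
  left_lim x t = left_lim y t.
Proof.
move=> xy; rewrite /left_lim; case: ifPn => // t0; congr (lim _).
have h : {near t^'-, x =1 y}.
  near=> s; apply: xy; apply/andP; split; first by near: s; exact: nbhs_left_ge.
  by near: s; exact: nbhs_left_lt.
by apply/seteqP; split => A; apply: filterS2 h => s xs; rewrite /= xs.
Unshelve. all: by end_near. Qed.

Lemma left_lim0 t : left_lim (fun=> 0 : R) t = 0.
Proof. by rewrite /left_lim; case: ifP => // _; rewrite lim_cst. Qed.

Lemma mrestr_le1 x (D : set R) (mD : measurable D) b : control T x ->
  (mrestr (dpath T x) mD `]-oo, b]%classic < +oo)%E.
Proof.
move=> cx; apply: (@le_lt_trans _ _ (dpath T x setT)).
  by apply: le_measure; rewrite ?inE//; exact: measurableI.
by rewrite (dpath_setT T0 cx) ltry.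
Qed.

Lemma dpath_eq_before x y th B : control T x -> control T y -> 0 <= th <= T ->
  (forall s, 0 <= s < th -> x s = y s) -> measurable B -> B `<=` `]-oo, th[%classic ->
  dpath T x B = dpath T y B.
Proof.
move=> cx cy thT xy mB Bth.
pose mD := measurable_itv (`]-oo, th[ : interval R).
suff : mrestr (dpath T x) mD B = mrestr (dpath T y) mD B.
  by rewrite /mrestr setIidl.
apply: (@measure_ray_unique _ (mrestr (dpath T x) mD) (mrestr (dpath T y) mD)) => // b;
  last exact: mrestr_le1.
rewrite -[LHS]/(dpath T x (`]-oo, b]%classic `&` `]-oo, th[%classic)).
rewrite -[RHS]/(dpath T y (`]-oo, b]%classic `&` `]-oo, th[%classic)).
have [bth|thb] := ltP b th.
  rewrite setIidl; last by move=> s /=; rewrite !in_itv/= => /le_lt_trans; apply.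
  rewrite (dpath_ray T0 cx) (dpath_ray T0 cy); congr EFin.
  have [b0|b0] := ltP b 0; first by rewrite !extend_path_lt0.
  have /andP[th0 th1] := thT.
  by rewrite !extend_pathE ?xy ?b0// ltW// (lt_le_trans bth).
rewrite setIidr; last by move=> s /=; rewrite !in_itv/= => /ltW/le_trans; apply.
by rewrite (dpath_open_ray T0 cx)// (dpath_open_ray T0 cy)// (left_lim_eq xy).
Qed.

(** The affine relation holds from th on, and the left limits there are p and 0, so the atom at th
    is scaled by 1 - p like the rest. Rays restricted to times after th then identify the two
    measures. *)
Lemma dpath_scale x y th p B : control T x -> control T y -> 0 <= th <= T ->
  left_lim x th = p -> left_lim y th = 0 ->
  (forall s, th <= s <= T -> x s = p + (1 - p) * y s) ->
  measurable B -> B `<=` `[th, +oo[%classic ->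
  dpath T x B = ((1 - p)%:E * dpath T y B)%E.
Proof.
move=> cx cy thT xp y0 xy mB Bth.
have p1 : 0 <= 1 - p by rewrite subr_ge0 -xp (left_lim_le1 T0 cx).
pose mD := measurable_itv (`[th, +oo[ : interval R).
have mass z b : control T z -> th <= b ->
    mrestr (dpath T z) mD `]-oo, b]%classic = (extend_path T z b - left_lim z th)%:E.
  move=> cz thb; rewrite /mrestr/=.
  have -> : `]-oo, b]%classic `&` `[th, +oo[%classic =
      `]-oo, b]%classic `\` `]-oo, th[%classic.
    apply/seteqP; split => s /=; rewrite !in_itv/= andbT.
      by move=> [-> ths]; split => //; apply/negP; rewrite -leNgt.
    by move=> [-> /negP]; rewrite -leNgt.
  rewrite measureD//; last by rewrite [ltLHS](dpath_ray T0 cz) ltry.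
  rewrite setIidr; last by move=> s /=; rewrite !in_itv/= => /ltW/le_trans; apply.
  by rewrite [X in (X - _)%E](dpath_ray T0 cz) [X in (_ - X)%E](dpath_open_ray T0 cz).
suff : mrestr (dpath T x) mD B = mscale (NngNum p1) (mrestr (dpath T y) mD) B.
  by rewrite /mscale/= /mrestr setIidl.
apply: (@measure_ray_unique _ (mrestr (dpath T x) mD)
  (mscale (NngNum p1) (mrestr (dpath T y) mD))) => // b; last exact: mrestr_le1.
rewrite -[LHS]/(mrestr (dpath T x) mD `]-oo, b]%classic).
rewrite -[RHS]/((1 - p)%:E * mrestr (dpath T y) mD `]-oo, b]%classic)%E.
have [bth|thb] := ltP b th.
  rewrite /mrestr (_ : _ `&` _ = set0) ?measure0 ?mule0//.
  apply/seteqP; split => // s [] /=; rewrite !in_itv/= andbT => sb.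
  by rewrite leNgt (le_lt_trans sb).
rewrite !mass// -EFinM; congr EFin.
rewrite xp y0 subr0; have /andP[th0 thT'] := thT.
have [bT|Tb] := leP b T.
  by rewrite !extend_pathE ?(le_trans th0)// xy ?thb// addrC addKr.
by rewrite !(extend_path_ge T0) ?ltW// mulr1.
Qed.

End paste.

(** * Common jumps of two controls *)

Section simultaneous_jumps.
Context {R : realType}.
Variable T : R.
Hypothesis T0 : 0 < T.
Implicit Types x y a : R -> R.

Lemma jump_ge0 x t : control T x -> 0 <= t <= T -> 0 <= jump x t.
Proof. by move=> cx tT; rewrite subr_ge0 (left_lim_le T0 cx). Qed.

(** Jumps are atoms of the law of the quantile under the uniform distribution, and a random variable
    has at most countably many atoms. *)
Lemma countable_jumps y : control T y ->
  countable [set t | 0 <= t <= T /\ 0 < jump y t].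
Proof.
move=> cy.
have mq : measurable_fun [set: measurableTypeR R]
  (quantile T y : measurableTypeR R -> R) := measurable_quantile_path T0 cy.
pose q : {mfun measurableTypeR R >-> R} :=
  HB.pack (quantile T y : measurableTypeR R -> R)
    (isMeasurableFun.Build _ _ _ _ _ mq).
apply: sub_countable (pmf_gt0_countable (P := uniform_prob (@ltr01 R)) q).
apply: subset_card_le => t [tT jt]/=.
rewrite /pmf -[_ (_ @^-1` _)]/(uniform_prob (@ltr01 R) (quantile T y @^-1` [set t])).
by rewrite -(dpath_quantile T0 cy) ?(dpath_set1 T0 cy).
Qed.

(** Since e vanishes off a countable set, only the atoms of the measure at its points contribute to
    the integral. *)
Lemma ge0_esum_jumps x (e : R -> R) D S : control T x -> measurable D ->
  D `<=` `[0, T]%classic -> measurable_fun D e -> countable S ->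
  (forall t, D t -> 0 <= e t) -> (forall t, D t -> ~ S t -> e t = 0) ->
  (\esum_(t in D) (e t * jump x t)%:E = \int[dpath T x]_(t in D) (e t)%:E)%E.
Proof.
move=> cx mD DT me cS e0 eS.
have mS : measurable S by exact: countable_measurable.
have /countable_injP[idx injidx] := cS.
(* The injection of S into the integers cuts the set into pieces with at most one point, so
   countable additivity applies to both the sum and the integral. *)
pose F k := (D `&` S) `&` (idx @^-1` [set k]).
have F1 k : F k = set0 \/ exists2 t, (D `&` S) t & F k = [set t].
  have [[t [DSt tk]]|F0] := pselect (F k !=set0); last first.
    by left; apply/seteqP; split => // t Ft; apply: F0; exists t.
  right; exists t => //; apply/seteqP; split => s; last by move=> ->.
  move=> [[Ds Ss] /= sk]; apply: injidx; rewrite ?inE//; first by case: DSt.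
  by rewrite sk tk.
have tF : trivIset setT F by move=> i j _ _ [t [[_ <-] [_ <-]]].
have UF : \bigcup_k F k = D `&` S.
  apply/seteqP; split => t; first by move=> [k _ []].
  by move=> DSt; exists (idx t).
have mF k : measurable (F k : set (measurableTypeR R)).
  by have [->|[t _ ->]] := F1 k; [exact: measurable0|exact: measurable_set1].
have e00 t : D t -> (0 <= (e t)%:E)%E by move=> Dt; rewrite lee_fin e0.
transitivity (\esum_(t in D `&` S) (e t * jump x t)%:E)%E.
  rewrite esum_mkcondr; apply: eq_esum => t Dt; case: ifPn => // /negP.
  by rewrite inE => /(eS _ Dt) ->; rewrite mul0r.
transitivity (\int[dpath T x]_(t in D `&` S) (e t)%:E)%E; last first.
  rewrite integral_mkcondr; apply: eq_integral => t /[!inE] Dt.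
  rewrite patchE; case: ifPn => // /negP; rewrite inE => /(eS _ Dt) -> //.
rewrite -UF ge0_integral_bigcup//; last 2 first.
  rewrite UF; apply/measurable_EFinP; apply: measurable_funS me => //.
  by rewrite UF => t [Dt _]; exact: e00.
rewrite esum_bigcup; last 2 first.
- exact: sub_trivIset tF.
- move=> t; rewrite UF => -[Dt _]; rewrite lee_fin mulr_ge0 ?e0//.
  by apply: jump_ge0 => //; have := DT _ Dt; rewrite /= in_itv.
rewrite nneseries_esumT; last first.
  move=> k; apply: integral_ge0 => t [[Dt _] _]; exact: e00.
apply: eq_esum => k _; have [->|[t [Dt St] ->]] := F1 k.
  by rewrite esum_set0 integral_set0.
have tT : 0 <= t <= T by have := DT _ Dt; rewrite /= in_itv.
rewrite esum_set1; last by rewrite lee_fin mulr_ge0 ?e0// jump_ge0.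
rewrite (eq_integral (cst (e t)%:E)); last by move=> s /[!inE]/= ->.
by rewrite integral_cst ?[X in (_ * X)%E](dpath_set1 T0 cx)//; exact: measurable_set1.
Qed.

(** The jumps of y vanish off a countable set, so the sum is an ordinary integral against the
    measure of x, to which linearity, scaling and Fubini apply. The jumps of x are nonnegative, so
    positive and negative parts are those of the other factor. *)
Lemma sum_over_jumps x y a D : control T x -> control T y -> measurable D ->
  D `<=` `[0, T]%classic -> regular T a ->
  sum_over D (fun t => a t * jump y t * jump x t) =
  \int[dpath T x]_(t in D) (a t * jump y t).
Proof.
move=> cx cy mD DT ra.
have raj := regularM ra (regular_jump T0 cy).
have iaj := regular_integrable T0 cx mD DT raj.
have maj : measurable_fun D (fun t => a t * jump y t).
  by apply: measurable_funS raj.1.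
have jx t : D t -> 0 <= jump x t.
  by move=> /DT; rewrite /= in_itv/= => tT; exact: jump_ge0.
have e0 t : D t -> ~ [set t | 0 <= t <= T /\ 0 < jump y t] t -> a t * jump y t = 0.
  move=> /DT; rewrite /= in_itv/= => tT nj.
  have : ~~ (0 < jump y t) by apply/negP => j0; apply: nj.
  rewrite -leNgt => jle; have -> : jump y t = 0.
    by apply/eqP; rewrite eq_le jle jump_ge0.
  by rewrite mulr0.
rewrite /sum_over /Rintegral integralE fineB; last 2 first.
- exact: integrable_pos_fin_num.
- exact: integrable_neg_fin_num.
rewrite funerpos funerneg.
congr (fine _ - fine _).
- rewrite -(ge0_esum_jumps cx mD DT _ (countable_jumps cy))//.
  + apply: eq_esum => t Dt; congr EFin.
    by rewrite /funrpos/= maxr_pMl ?jx// mul0r.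
  + exact: measurable_funrpos.
  + by move=> t Dt nS; rewrite /funrpos e0// maxxx.
- rewrite -(ge0_esum_jumps cx mD DT _ (countable_jumps cy))//.
  + apply: eq_esum => t Dt; congr EFin.
    by rewrite /funrneg/= maxr_pMl ?jx// mul0r mulNr.
  + exact: measurable_funrneg.
  + by move=> t Dt nS; rewrite /funrneg e0// oppr0 maxxx.
Qed.

End simultaneous_jumps.

(** * Pasting and truncating controls *)

Section pasted_controls.
Context {R : realType}.
Variable T : R.
Hypothesis T0 : 0 < T.
Implicit Types x y xh yh : R -> R.

Lemma le_left_lim x s t : control T x -> 0 <= s < t -> t <= T ->
  x s <= left_lim x t.
Proof.
move=> cx /andP[s0 st] tT.
have tT' : 0 <= t <= T by rewrite (le_trans s0 (ltW st)).
rewrite -lee_fin -(dpath_open_ray T0 cx)// -(@extend_pathE _ T x s); last first.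
  by rewrite s0 (le_trans (ltW st)).
rewrite -(dpath_ray T0 cx); apply: le_measure; rewrite ?inE// => u /=.
by rewrite !in_itv/= => /le_lt_trans; apply.
Qed.

Definition paste_path x xh th t : R :=
  if t < th then x t else left_lim x th + (1 - left_lim x th) * xh t.

Lemma paste_path_lt x xh th s : 0 <= s < th -> paste_path x xh th s = x s.
Proof. by move=> /andP[_ sth]; rewrite /paste_path sth. Qed.

Lemma paste_path_ge x xh th s : th <= s ->
  paste_path x xh th s = left_lim x th + (1 - left_lim x th) * xh s.
Proof. by rewrite /paste_path ltNge => ->. Qed.

Lemma left_lim_paste_path x xh th :
  left_lim (paste_path x xh th) th = left_lim x th.
Proof. by apply: left_lim_eq => s; exact: paste_path_lt. Qed.

Lemma control_paste_path x xh th : control T x -> control T xh ->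
  0 <= th <= T -> control T (paste_path x xh th).
Proof.
move=> cx cxh thT; have /andP[th0 thT'] := thT.
have p0 := left_lim_ge0 T0 cx thT; have p1 := left_lim_le1 T0 cx thT.
have q0 : 0 <= 1 - left_lim x th by rewrite subr_ge0.
split.
- move=> t tT; rewrite /paste_path; case: ifP => _; first exact: (control_ge0 cx).
  by rewrite addr_ge0// mulr_ge0// (control_ge0 cxh).
- move=> s t s0 st tT; rewrite /paste_path; case: ltP => sth; case: ltP => tth.
  + exact: (control_mono cx).
  + rewrite -[leLHS]addr0 lerD//; first by rewrite le_left_lim ?s0.
    by rewrite mulr_ge0// (control_ge0 cxh)// (le_trans th0).
  + by have := lt_le_trans tth sth; rewrite ltNge st.
  + by rewrite lerD2l ler_wpM2l// (control_mono cxh).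
- move=> t tT; have [tth|tth] := ltP t th.
    rewrite paste_path_lt; last by rewrite tth; case/andP: tT => ->.
    apply: cvg_trans (control_rcont cx tT); apply: near_eq_cvg; near=> s.
    by rewrite /paste_path ifT//; near: s; exact: nbhs_right_lt.
  rewrite paste_path_ge//; apply: (@cvg_trans _
      ((left_lim x th + (1 - left_lim x th) * xh s) @[s --> t^'+])).
    apply: near_eq_cvg; near=> s; rewrite paste_path_ge// (le_trans tth)//.
  by apply: cvgD; [exact: cvg_cst|apply: cvgMr; exact: (control_rcont cxh)].
- by rewrite paste_path_ge// (control_end cxh) mulr1 addrC subrK.
Unshelve. all: by end_near. Qed.

(** When the left limit at th is 1, monotonicity forces y to be 1 from th on, so the identity holds
    whatever value 0/0 receives. *)
Lemma truncate_path_ge y th s : control T y -> 0 <= th <= T -> th <= s <= T ->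
  y s = left_lim y th + (1 - left_lim y th) * truncate_path y th s.
Proof.
move=> cy thT /andP[ths sT]; have /andP[th0 thT'] := thT.
rewrite /truncate_path ltNge ths/=; case: eqP => p1; last first.
  by rewrite mulrC divfK; [rewrite addrC subrK|exact/eqP].
rewrite p1 mul0r addr0; apply/eqP; rewrite eq_le.
have sT' : 0 <= s <= T by rewrite (le_trans th0).
have -> : left_lim y th = 1 by apply/esym/eqP; rewrite -subr_eq0; exact/eqP.
rewrite (control_le1 cy)//=.
have <- : left_lim y th = 1 by apply/esym/eqP; rewrite -subr_eq0; exact/eqP.
by rewrite (le_trans (left_lim_le T0 cy thT))// (control_mono cy).
Qed.

Lemma left_lim_truncate_path y th : left_lim (truncate_path y th) th = 0.
Proof.
rewrite -[RHS](left_lim0 th); apply: left_lim_eq => s /andP[_ sth].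
by rewrite /truncate_path sth.
Qed.

(** The convention 0/0 = 1 makes the truncated path reach 1 at T even when no mass is left at th. *)
Lemma control_truncate_path y th : control T y -> 0 <= th <= T ->
  control T (truncate_path y th).
Proof.
move=> cy thT; have /andP[th0 thT'] := thT.
have p1 := left_lim_le1 T0 cy thT.
set p := left_lim y th in p1.
have q0 : 0 <= (1 - p)^-1 by rewrite invr_ge0 subr_ge0.
have yp t : th <= t -> t <= T -> 0 <= y t - p.
  move=> tht tT; rewrite subr_ge0 (le_trans (left_lim_le T0 cy thT))//.
  exact: (control_mono cy).
split.
- move=> t /andP[t0 tT]; rewrite /truncate_path -/p; case: ltP => // tht.
  by case: ifP => // _; rewrite mulr_ge0// yp.
- move=> s t s0 st tT; rewrite /truncate_path -/p.
  case: ltP => sth; case: ltP => tth.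
  + by [].
  + by case: ifP => // _; rewrite mulr_ge0// yp.
  + by have := lt_le_trans tth sth; rewrite ltNge st.
  + by case: ifP => // _; rewrite ler_wpM2r// lerD2r (control_mono cy).
- move=> t tT; have [tth|tth] := ltP t th.
    rewrite {2}/truncate_path tth; apply: cvg_near_cst; near=> s.
    by rewrite /truncate_path ifT//; near: s; exact: nbhs_right_lt.
  rewrite {2}/truncate_path ltNge tth/= -/p; case: ifPn => p1'.
    apply: cvg_near_cst; near=> s; rewrite /truncate_path -/p p1' ifF//.
    apply/negbTE; by rewrite -leNgt (le_trans tth).
  apply: (@cvg_trans _ (((y s - p) / (1 - p)) @[s --> t^'+])).
    apply: near_eq_cvg; near=> s; rewrite /truncate_path -/p (negbTE p1') ifF//.
    apply/negbTE; by rewrite -leNgt (le_trans tth).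
  apply: cvgMl; apply: cvgB; last exact: cvg_cst.
  exact: (control_rcont cy).
- rewrite /truncate_path ltNge thT'/= -/p; case: ifPn => // p1'.
  by rewrite (control_end cy) divff.
Unshelve. all: by end_near. Qed.

End pasted_controls.

(** * The payoff of a pair of control paths *)

Section game_value.
Context {R : realType}.
Variable T : R.
Hypothesis T0 : 0 < T.
Implicit Types x y xh yh a b c : R -> R.

(** The bracket of [J] in one scenario, convertible with it. The three payoffs are parameters so
    that the players can be exchanged. *)
Definition game_value a b c th x y : R :=
  \int[dpath T x]_(t in `[th, T[) (a t * (1 - y t)) +
  \int[dpath T y]_(t in `[th, T[) (b t * (1 - x t)) +
  sum_over `[th, T] (fun t => c t * jump y t * jump x t).

(** This symmetry turns the second player into a first player with the payoffs a and b exchanged. *)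
Lemma game_valueC a b c th x y :
  game_value a b c th x y = game_value b a c th y x.
Proof.
rewrite /game_value [X in X + _ = _]addrC; congr (_ + sum_over _ _).
by apply/funext => t; rewrite mulrAC.
Qed.

Let sub_co th : 0 <= th -> `[th, T[%classic `<=` `[0, T]%classic.
Proof.
move=> th0 t /=; rewrite !in_itv/= => /andP[tht tT].
by rewrite (le_trans th0 tht) ltW.
Qed.

Let sub_cc th : 0 <= th -> `[th, T]%classic `<=` `[0, T]%classic.
Proof.
move=> th0 t /=; rewrite !in_itv/= => /andP[tht tT].
by rewrite (le_trans th0 tht).
Qed.

Lemma regular_one_sub y : control T y -> regular T (fun t => 1 - y t).
Proof.
move=> cy; apply: (@regularB _ _ (cst 1) y); last exact: regular_control.
exact: regular_cst.
Qed.

Lemma game_value_integrals a b c th x y : control T x -> control T y ->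
  0 <= th -> regular T c ->
  game_value a b c th x y =
  \int[dpath T x]_(t in `[th, T[) (a t * (1 - y t)) +
  \int[dpath T y]_(t in `[th, T[) (b t * (1 - x t)) +
  \int[dpath T x]_(t in `[th, T]) (c t * jump y t).
Proof.
by move=> cx cy th0 rc; rewrite /game_value (sum_over_jumps T0)//; exact: sub_cc.
Qed.

(** The jump sum is integrated against the measure of y, after exchanging the players, and its atom
    at T is split off; the rest joins the integral over the half-open interval. *)
Lemma game_value_end a b c th x y : control T x -> control T y ->
  0 <= th <= T -> regular T b -> regular T c ->
  game_value a b c th x y =
  \int[dpath T x]_(t in `[th, T[) ((1 - y t) * a t) +
  \int[dpath T y]_(t in `[th, T[) ((1 - x t) * b t + c t * jump x t) +
  c T * jump y T * jump x T.
Proof.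
move=> cx cy /andP[th0 thT] rb rc.
rewrite game_valueC game_value_integrals// [X in X + _ = _]addrC -!addrA.
have rbx := regularM (regular_one_sub cx) rb.
have rcj := regularM rc (regular_jump T0 cx).
congr (_ + _); first by apply: eq_Rintegral => t _; rewrite mulrC.
rewrite RintegralD//; last 2 first.
- by apply: (regular_integrable T0 cy) rbx => //; exact: sub_co.
- by apply: (regular_integrable T0 cy) rcj => //; exact: sub_co.
rewrite -addrA; congr (_ + _); first by apply: eq_Rintegral => t _; rewrite mulrC.
have -> : `[th, T]%classic = `[th, T[%classic `|` [set T].
  apply/seteqP; split => t /=; rewrite !in_itv/=.
    by move=> /andP[->]; rewrite le_eqVlt => /predU1P[->|->]; [right|left].
  by move=> [/andP[-> /ltW]|->] //; rewrite lexx thT.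
rewrite Rintegral_setU//.
- congr (_ + _).
  rewrite (@eq_Rintegral _ _ _ _ _ (cst (c T * jump x T))); last by move=> t /[!inE]/= ->.
  rewrite Rintegral_cst//.
  rewrite [X in fine X](dpath_set1 T0 cy) ?lexx ?ltW//=.
  by rewrite mulrAC.
- apply: (regular_integrable T0 cy) rcj => //; first exact: measurableU.
  move=> t [/(sub_co th0)//|->] /=; by rewrite in_itv/= lexx ltW.
- apply/disj_setPS => t /= [] /[swap] ->; by rewrite in_itv/= ltxx andbF.
Qed.

Section scaling.
Variables (x xh : R -> R) (th p : R).
Hypotheses (cx : control T x) (cxh : control T xh) (thT : 0 <= th <= T).
Hypotheses (xp : left_lim x th = p) (xh0 : left_lim xh th = 0).
Hypothesis xxh : forall s, th <= s <= T -> x s = p + (1 - p) * xh s.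

Let th0 : 0 <= th. Proof. by case/andP : thT. Qed.

Lemma jump_scale t : th <= t <= T -> jump x t = (1 - p) * jump xh t.
Proof.
move=> /andP[tht tT]; have tT' : 0 <= t <= T by rewrite (le_trans th0).
apply: EFin_inj; rewrite EFinM -!(dpath_set1 T0)//.
apply: (dpath_scale T0 cx cxh thT xp xh0 xxh) => // s /= ->.
by rewrite in_itv/= tht.
Qed.

Lemma Rintegral_scale D phi : measurable D -> D `<=` `[th, T]%classic ->
  regular T phi ->
  \int[dpath T x]_(t in D) phi t = (1 - p) * \int[dpath T xh]_(t in D) phi t.
Proof.
move=> mD DT rphi; have DT' := subset_trans DT (sub_cc th0).
have mphi : measurable_fun D (EFin \o phi).
  by apply/measurable_EFinP; exact: measurable_funS rphi.1.
have p1 : 0 <= 1 - p by rewrite subr_ge0 -xp (left_lim_le1 T0 cx).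
have iphi := regular_integrable T0 cxh mD DT' rphi.
rewrite /Rintegral.
rewrite (@eq_measure_integral _ _ _ _ (mscale (NngNum p1) (dpath T xh))); last first.
  move=> A mA AD; rewrite [LHS](dpath_scale T0 cx cxh thT xp xh0 xxh)//.
  by move=> t /AD/DT; rewrite /= !in_itv/= => /andP[->].
rewrite integralE !ge0_integral_mscale//; last 2 first.
- exact: measurable_funeneg.
- exact: measurable_funepos.
rewrite [in RHS]integralE /= -muleBr ?fineM//.
- by rewrite fin_numB integrable_pos_fin_num// integrable_neg_fin_num.
- by rewrite fin_num_adde_defl// fin_numN integrable_neg_fin_num.
Qed.

End scaling.

(** From th on, the measure, the jumps and the remaining mass 1 - x all carry the factor 1 - p, and
    those of y the factor 1 - q. Each of the three terms contains one quantity of each player. *)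
Lemma game_value_scale a b c th x xh y yh p q :
  regular T a -> regular T b -> regular T c ->
  control T x -> control T xh -> control T y -> control T yh ->
  0 <= th <= T ->
  left_lim x th = p -> left_lim xh th = 0 ->
  (forall s, th <= s <= T -> x s = p + (1 - p) * xh s) ->
  left_lim y th = q -> left_lim yh th = 0 ->
  (forall s, th <= s <= T -> y s = q + (1 - q) * yh s) ->
  game_value a b c th x y = (1 - p) * (1 - q) * game_value a b c th xh yh.
Proof.
move=> ra rb rc cx cxh cy cyh thT xp xh0 xxh yq yh0 yyh.
have /andP[th0 thT'] := thT.
have coT t : `[th, T[%classic t -> th <= t <= T.
  by rewrite /= in_itv/= => /andP[-> /ltW].
rewrite !game_value_integrals// [RHS]mulrDr [X in _ = X + _]mulrDr.
have co1 : `[th, T[%classic `<=` `[th, T]%classic.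
  by move=> t /coT; rewrite /= in_itv.
congr (_ + _ + _).
- rewrite (Rintegral_scale cx cxh thT xp xh0 xxh)//; last first.
    exact: regularM (regular_one_sub cy).
  rewrite -mulrA; congr (_ * _); rewrite -RintegralZl//; last first.
    apply: (regular_integrable T0 cxh) => //; first exact: sub_co.
    exact: regularM (regular_one_sub cyh).
  by apply: eq_Rintegral => t /[!inE] /coT tT; rewrite yyh//; ring.
- rewrite (Rintegral_scale cy cyh thT yq yh0 yyh)//; last first.
    exact: regularM (regular_one_sub cx).
  rewrite [X in _ = X * _]mulrC -mulrA; congr (_ * _); rewrite -RintegralZl//; last first.
    apply: (regular_integrable T0 cyh) => //; first exact: sub_co.
    exact: regularM (regular_one_sub cxh).
  by apply: eq_Rintegral => t /[!inE] /coT tT; rewrite xxh//; ring.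
- rewrite (Rintegral_scale cx cxh thT xp xh0 xxh)//; last first.
    exact: regularM (regular_jump T0 cy).
  rewrite -mulrA; congr (_ * _); rewrite -RintegralZl//; last first.
    apply: (regular_integrable T0 cxh) => //; first exact: sub_cc.
    exact: regularM (regular_jump T0 cyh).
  apply: eq_Rintegral => t; rewrite inE/= in_itv/= => tT.
  by rewrite (jump_scale cy cyh thT yq yh0 yyh)//; ring.
Qed.

Lemma Rintegral_split D x th phi : measurable D -> D `<=` `[0, T]%classic ->
  control T x -> regular T phi ->
  \int[dpath T x]_(t in D) phi t =
  \int[dpath T x]_(t in D `&` `]-oo, th[) phi t +
  \int[dpath T x]_(t in D `&` `[th, +oo[) phi t.
Proof.
move=> mD DT cx rphi.
have DE : D = (D `&` `]-oo, th[%classic) `|` (D `&` `[th, +oo[%classic).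
  by rewrite -setIUr -setCitvl setUv setIT.
rewrite {1}DE Rintegral_setU//.
- exact: measurableI.
- exact: measurableI.
- by rewrite -DE; exact: regular_integrable.
- apply/disj_setPS => t [[_ /=]] + [_ /=]; rewrite !in_itv/= andbT => tth.
  by rewrite leNgt tth.
Qed.

Let sum_sub (p q r p' q' r' P Q S P' Q' S' : R) :
  p' - p = P' - P -> q' - q = Q' - Q -> r' - r = S' - S ->
  (p' + q' + r') - (p + q + r) = (P' + Q' + S') - (P + Q + S).
Proof. by lra. Qed.

Let sub_cancel (u v k l m n : R) : u = k + l -> v = m + n -> k = m ->
  u - v = l - n.
Proof. by lra. Qed.

Lemma Rintegral_eq_before x x' th D phi : control T x -> control T x' ->
  0 <= th <= T -> (forall s, 0 <= s < th -> x s = x' s) ->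
  D `<=` `]-oo, th[%classic ->
  \int[dpath T x']_(t in D) phi t = \int[dpath T x]_(t in D) phi t.
Proof.
move=> cx cx' thT xx' Dth; rewrite /Rintegral.
rewrite (@eq_measure_integral _ _ _ _ (dpath T x))// => A mA AD; apply/esym.
exact: (dpath_eq_before T0 cx cx' thT xx' mA (subset_trans AD Dth)).
Qed.

Let low th (D : set R) : D `&` `]-oo, th[%classic `<=` `]-oo, th[%classic.
Proof. by move=> t []. Qed.

Let Eco th : 0 <= th ->
  `[0, T[%classic `&` `[th, +oo[%classic = `[th, T[%classic :> set R.
Proof.
move=> th0; apply/seteqP; split => t /=; rewrite !in_itv/= andbT.
  by move=> [/andP[_ ->] ->].
by move=> /andP[tht ->]; rewrite (le_trans th0).
Qed.

Let Ecc th : 0 <= th ->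
  `[0, T]%classic `&` `[th, +oo[%classic = `[th, T]%classic :> set R.
Proof.
move=> th0; apply/seteqP; split => t /=; rewrite !in_itv/= andbT.
  by move=> [/andP[_ ->] ->].
by move=> /andP[tht ->]; rewrite (le_trans th0).
Qed.

Let split_co x th phi : 0 <= th -> control T x -> regular T phi ->
  \int[dpath T x]_(t in `[0, T[) phi t =
  \int[dpath T x]_(t in `[0, T[ `&` `]-oo, th[) phi t +
  \int[dpath T x]_(t in `[th, T[) phi t.
Proof.
move=> th0 cx rphi; rewrite -Eco//.
by apply: Rintegral_split => //; exact: sub_co.
Qed.

Let split_cc x th phi : 0 <= th -> control T x -> regular T phi ->
  \int[dpath T x]_(t in `[0, T]) phi t =
  \int[dpath T x]_(t in `[0, T] `&` `]-oo, th[) phi t +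
  \int[dpath T x]_(t in `[th, T]) phi t.
Proof. by move=> th0 cx rphi; rewrite -Ecc//; exact: Rintegral_split. Qed.

Lemma game_value_sub a b c th x x' y :
  regular T a -> regular T b -> regular T c ->
  control T x -> control T x' -> control T y -> 0 <= th <= T ->
  (forall s, 0 <= s < th -> x s = x' s) ->
  game_value a b c 0 x' y - game_value a b c 0 x y =
  game_value a b c th x' y - game_value a b c th x y.
Proof.
move=> ra rb rc cx cx' cy thT xx'; have /andP[th0 _] := thT.
have ray := regularM ra (regular_one_sub cy).
have rbx := regularM rb (regular_one_sub cx).
have rbx' := regularM rb (regular_one_sub cx').
have rcj := regularM rc (regular_jump T0 cy).
rewrite (game_value_integrals a b cx' cy (lexx 0) rc).
rewrite (game_value_integrals a b cx cy (lexx 0) rc).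
rewrite (game_value_integrals a b cx' cy th0 rc).
rewrite (game_value_integrals a b cx cy th0 rc).
apply: sum_sub.
- apply: (sub_cancel (split_co th0 cx' ray) (split_co th0 cx ray)).
  exact: (Rintegral_eq_before _ cx cx' thT xx' (@low _ _)).
- apply: (sub_cancel (split_co th0 cy rbx') (split_co th0 cy rbx)).
  apply: eq_Rintegral => t; rewrite inE/= !in_itv/= => -[/andP[t0 _] tth].
  by rewrite xx'// t0.
- apply: (sub_cancel (split_cc th0 cx' rcj) (split_cc th0 cx rcj)).
  exact: (Rintegral_eq_before _ cx cx' thT xx' (@low _ _)).
Qed.

End game_value.

(** * Joint measurability *)

Section joint_measurability.
Context {d : measure_display} {Omega : measurableType d} {R : realType}.

(** The first multiple of 1/(n+1) strictly after t. Strictness keeps the approximations on the right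
    of t, where right-continuity applies. *)
Let next (n : nat) (t : R) : R := (Num.floor (t * n.+1%:R) + 1)%:~R / n.+1%:R.

Let next_gt n t : t < next n t.
Proof. by rewrite /next ltr_pdivlMr// floorD1_gt. Qed.

Let next_le n t : next n t <= t + n.+1%:R^-1.
Proof.
rewrite /next ler_pdivrMr// mulrDl mulVf// intrD lerD2r.
exact: floor_le_tmp.
Qed.

(** Sampling at [next n t] is constant in time on each interval between consecutive multiples of
    1/(n+1), hence jointly measurable, and it converges by right-continuity. *)
Lemma measurable_right_continuous_process (X : R -> Omega -> R) :
  (forall t, measurable_fun setT (X t)) ->
  (forall w t, X s w @[s --> t^'+] --> X t w) ->
  measurable_fun setT (fun p : Omega * R => X p.2 p.1).
Proof.
move=> mX rcX.
apply: (@measurable_fun_cvg _ _ _ _ (fun n (p : Omega * R) => X (next n p.2) p.1)).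
  move=> n _ B mB; rewrite setTI.
  pose F (k : int) : set (Omega * R) := ((X ((k + 1)%:~R / n.+1%:R)) @^-1` B) `*`
    `[k%:~R / n.+1%:R : R, (k + 1)%:~R / n.+1%:R[%classic.
  rewrite (_ : _ @^-1` _ = \bigcup_k F k).
    apply: countable_bigcupT_measurable; first exact: countableP.
    move=> k; apply: measurableX; last exact: measurable_itv.
    by rewrite -[X in measurable X]setTI; exact: mX.
  apply/seteqP; split => [[w t] /= XB|[w t] [k _ [/= XB]]].
    exists (Num.floor (t * n.+1%:R)) => //; split => //=; rewrite in_itv/=.
    by rewrite next_gt andbT ler_pdivrMr// floor_le_tmp.
  rewrite in_itv/= ler_pdivrMr// ltr_pdivlMr// => kt.
  rewrite /next (_ : Num.floor _ = k)//; apply: floor_def.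
  by [].
move=> [w t] _ /=; have /cvg_at_rightP := rcX w t; apply; split.
  by move=> n; exact: next_gt.
apply: (@squeeze_cvgr _ _ _ _ (cst t) (fun n : nat => t + n.+1%:R^-1)).
- by near=> n; rewrite /= (ltW (next_gt n t)) next_le.
- exact: cvg_cst.
- rewrite -[X in _ --> X]addr0; apply: cvgD; first exact: cvg_cst.
  exact: cvg_harmonic.
Unshelve. all: by end_near. Qed.

End joint_measurability.

Section process_measurability.
Context {d : measure_display} {Omega : measurableType d} {R : realType}.
Variable T : R.
Hypothesis T0 : 0 < T.

(** Freezing time outside [0, T] extends a process to the whole line while keeping
    right-continuity. *)
Definition clip (t : R) : R := Num.max 0 (Num.min t T).

Lemma clip_range t : 0 <= clip t <= T.
Proof.
by rewrite /clip le_max lexx/= ge_max (ltW T0)/= ge_min lexx orbT.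
Qed.

Lemma clip_id t : 0 <= t <= T -> clip t = t.
Proof. by move=> /andP[t0 tT]; rewrite /clip (min_l tT) max_r. Qed.

Lemma measurable_cadlag_process (X : R -> Omega -> R) :
  (forall t, 0 <= t <= T -> measurable_fun setT (X t)) ->
  (forall w, cadlag T (X ^~ w)) ->
  measurable_fun setT (fun p : Omega * R => X (clip p.2) p.1).
Proof.
move=> mX cX.
apply: (@measurable_right_continuous_process _ _ _ (fun t w => X (clip t) w)).
  by move=> t; apply: mX; exact: clip_range.
move=> w t; have [t0|t0] := ltP t 0.
  apply: cvg_near_cst; near=> s.
  have s0 : s < 0 by near: s; exact: nbhs_right_lt.
  by rewrite /clip !max_l// ge_min ltW.
have [tT|tT] := leP T t.
  apply: cvg_near_cst; near=> s.
  have Ts : T <= s by apply: (le_trans tT); near: s; exact: nbhs_right_ge.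
  by rewrite /clip !min_r.
have tTT : 0 <= t < T by rewrite t0.
rewrite (clip_id (t := t)) ?t0 ?ltW//.
apply: cvg_trans ((cX w).1 _ tTT); apply: near_eq_cvg; near=> s.
rewrite clip_id//; apply/andP; split.
  by apply: (le_trans t0); near: s; exact: nbhs_right_ge.
by near: s; exact: nbhs_right_le.
Unshelve. all: by end_near. Qed.

Lemma measurable_extend_path_process (rho : R -> Omega -> R) :
  (forall t, 0 <= t <= T -> measurable_fun setT (rho t)) ->
  (forall w, control T (rho ^~ w)) ->
  measurable_fun setT (fun p : Omega * R => extend_path T (rho ^~ p.1) p.2).
Proof.
move=> mrho crho.
apply: (@measurable_right_continuous_process _ _ _
  (fun t w => extend_path T (rho ^~ w) t)).
  move=> t; rewrite /extend_path; case: ltP => t0; first exact: measurable_cst.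
  by apply: mrho; rewrite le_min t0 ltW//= ge_min lexx orbT.
by move=> w t; exact: (extend_path_rc T0 (crho w)).
Qed.

Lemma measurable_left_lim_process (rho : R -> Omega -> R) :
  (forall t, 0 <= t <= T -> measurable_fun setT (rho t)) ->
  (forall w, control T (rho ^~ w)) ->
  measurable_fun (setT `*` `[0, T]%classic)
    (fun p : Omega * R => left_lim (rho ^~ p.1) p.2).
Proof.
move=> mrho crho.
have mX := measurable_extend_path_process mrho crho.
apply: (@measurable_fun_cvg _ _ _ _ (fun n (p : Omega * R) =>
    extend_path T (rho ^~ p.1) (p.2 - n.+1%:R^-1))).
  move=> n; apply: measurable_funTS.
  have mp : measurable_fun setT (fun p : Omega * R => (p.1, p.2 - n.+1%:R^-1)).
    apply: measurable_fun_pair; first exact: measurable_fst.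
    by apply: measurable_funB; [exact: measurable_snd|exact: measurable_cst].
  exact: (measurableT_comp mX mp).
move=> [w t] [_ /=]; rewrite in_itv/= => /andP[t0 tT].
exact: (extend_path_cvg_left (crho w) t0 tT).
Qed.

End process_measurability.

Lemma measurable_fubini_Rintegral d1 d2 (T1 : measurableType d1)
    (T2 : measurableType d2) (R : realType)
    (Q : {sigma_finite_measure set T2 -> \bar R}) (psi : T1 * T2 -> R) :
  measurable_fun setT psi -> measurable_fun setT (fun w => \int[Q]_u psi (w, u)).
Proof.
move=> mpsi; apply: (measurableT_comp (fine_measurable _)) => //=.
under eq_fun do rewrite integralE.
have mE : measurable_fun setT (EFin \o psi) by exact/measurable_EFinP.
apply: emeasurable_funB.
  rewrite (_ : (fun w => _) = fubini_F Q (EFin \o psi)^\+%E); last first.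
    by apply/funext => w; apply: eq_integral => u _; rewrite !funeposE.
  by apply: measurable_fun_fubini_tonelli_F => //; exact: measurable_funepos.
rewrite (_ : (fun w => _) = fubini_F Q (EFin \o psi)^\-%E); last first.
  by apply/funext => w; apply: eq_integral => u _; rewrite !funenegE.
by apply: measurable_fun_fubini_tonelli_F => //; exact: measurable_funeneg.
Qed.

Section payoff_measurability.
Context {d : measure_display} {Omega : measurableType d} {R : realType}.
Variable T : R.
Hypothesis T0 : 0 < T.

Record control_process (rho : R -> Omega -> R) : Prop := {
  control_process_meas : forall t, 0 <= t <= T -> measurable_fun setT (rho t);
  control_process_path : forall w, control T (rho ^~ w) }.

Record cadlag_process (X : R -> Omega -> R) : Prop := {
  cadlag_process_meas : forall t, 0 <= t <= T -> measurable_fun setT (X t);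
  cadlag_process_path : forall w, cadlag T (X ^~ w) }.

Lemma cadlag_process_regular X w : cadlag_process X -> regular T (X ^~ w).
Proof.
move=> [mX cX]; split; last exact: cadlag_bounded.
apply: (eq_measurable_fun (fun t => X (clip T t) w)).
  by move=> t; rewrite inE/= in_itv/= => tT; rewrite clip_id.
apply: measurable_funTS.
exact: (measurableT_comp (measurable_cadlag_process T0 mX cX) (pair1_measurable w)).
Qed.

(** The measure of integration depends on the scenario. The inverse transform replaces it by the
    fixed uniform law composed with the jointly measurable quantile, and Fubini gives
    measurability. *)
Lemma measurable_dpath_integral (rho : R -> Omega -> R) (E : set (Omega * R))
    (phi : R -> Omega -> R) :
  control_process rho -> measurable E ->
  measurable_fun E (fun p => phi p.2 p.1) ->
  measurable_fun setT (fun w =>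
    \int[dpath T (rho ^~ w)]_(t in [set t | E (w, t)]) phi t w).
Proof.
move=> [mrho crho] mE mphi.
pose psi := (fun p : Omega * R => phi p.2 p.1) \_ E.
have mpsi : measurable_fun setT psi := (measurable_restrictT _ mE).1 mphi.
have mq := measurable_quantile T0 crho mrho.
have mpair : measurable_fun setT
    (fun p : Omega * R => (p.1, quantile T (rho ^~ p.1) p.2)).
  by apply: measurable_fun_pair; [exact: measurable_fst|exact: mq].
have -> : (fun w => \int[dpath T (rho ^~ w)]_(t in [set t | E (w, t)]) phi t w) =
    (fun w => \int[uniform_prob (@ltr01 R)]_u
       (psi \o (fun p : Omega * R => (p.1, quantile T (rho ^~ p.1) p.2))) (w, u)).
  apply/funext => w.
  have mEw : measurable [set t | E (w, t)].
    by have := pair1_measurable w measurableT mE; rewrite setTI.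
  rewrite Rintegral_dpath//.
    move=> _ B mB; have := mphi mE B mB.
    by move/(pair1_measurable w measurableT); rewrite setTI.
apply: (@measurable_fubini_Rintegral _ _ Omega (measurableTypeR R)).
exact: measurableT_comp.
Qed.

Variable theta : Omega -> R.
Hypotheses (mtheta : measurable_fun setT theta) (thT : forall w, 0 <= theta w <= T).

Let Eco : set (Omega * R) := [set p | theta p.1 <= p.2 < T].
Let Ecc : set (Omega * R) := [set p | theta p.1 <= p.2 <= T].

Let mth : measurable_fun setT (fun p : Omega * R => theta p.1).
Proof. by apply: measurableT_comp => //; exact: measurable_fst. Qed.

Let mEco : measurable Eco.
Proof.
have /(_ measurableT [set true] I) := measurable_and
  (measurable_fun_ler mth (@measurable_snd _ _ Omega R))
  (measurable_fun_ltr (@measurable_snd _ _ Omega R) (measurable_cst T)).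
by rewrite setTI.
Qed.

Let mEcc : measurable Ecc.
Proof.
have /(_ measurableT [set true] I) := measurable_and
  (measurable_fun_ler mth (@measurable_snd _ _ Omega R))
  (measurable_fun_ler (@measurable_snd _ _ Omega R) (measurable_cst T)).
by rewrite setTI.
Qed.

Let EcoT : Eco `<=` setT `*` `[0, T]%classic.
Proof.
move=> [w t] /= /andP[wt tT]; split => //=; rewrite in_itv/=.
by have /andP[th0 _] := thT w; rewrite (le_trans th0)//= ltW.
Qed.

Let EccT : Ecc `<=` setT `*` `[0, T]%classic.
Proof.
move=> [w t] /= /andP[wt tT]; split => //=; rewrite in_itv/=.
by have /andP[th0 _] := thT w; rewrite (le_trans th0)//=.
Qed.

Let mprocess X : cadlag_process X ->
  measurable_fun (setT `*` `[0, T]%classic) (fun p : Omega * R => X p.2 p.1).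
Proof.
move=> [mX cX]; apply: (eq_measurable_fun (fun p => X (clip T p.2) p.1)).
  by move=> [w t]; rewrite inE/= => -[_]; rewrite in_itv/= => tT; rewrite clip_id.
by apply: measurable_funTS; exact: measurable_cadlag_process.
Qed.

Let mcontrol rho : control_process rho ->
  measurable_fun (setT `*` `[0, T]%classic) (fun p : Omega * R => rho p.2 p.1).
Proof.
move=> [mX cX].
apply: (eq_measurable_fun (fun p => extend_path T (rho ^~ p.1) p.2)).
  by move=> [w t]; rewrite inE/= => -[_]; rewrite in_itv/= => tT; rewrite extend_pathE.
by apply: measurable_funTS; exact: measurable_extend_path_process.
Qed.

Let mjump rho : control_process rho ->
  measurable_fun (setT `*` `[0, T]%classic)
    (fun p : Omega * R => jump (rho ^~ p.1) p.2).
Proof.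
move=> crho; apply: measurable_funB; first exact: mcontrol.
by case: crho => *; exact: measurable_left_lim_process.
Qed.

Variables (a b c rho1 rho2 : R -> Omega -> R).
Hypotheses (ca : cadlag_process a) (cb : cadlag_process b) (cc : cadlag_process c).
Hypotheses (c1 : control_process rho1) (c2 : control_process rho2).

Let th0 w : 0 <= theta w. Proof. by case/andP: (thT w). Qed.

Lemma measurable_game_value_co X rho rho' : cadlag_process X ->
  control_process rho -> control_process rho' ->
  measurable_fun setT (fun w =>
    \int[dpath T (rho ^~ w)]_(t in `[theta w, T[) (X t w * (1 - rho' t w))).
Proof.
move=> cX cr cr'.
have EcoE w : `[theta w, T[%classic = [set t | Eco (w, t)].
  by apply/seteqP; split => t /=; rewrite in_itv.
under eq_fun do rewrite EcoE.
apply: (@measurable_dpath_integral rho Eco (fun t w => X t w * (1 - rho' t w))) => //.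
apply: (measurable_funS _ EcoT) => //; first exact: measurableX.
apply: measurable_funM; first exact: mprocess.
apply: measurable_funB; [exact: measurable_cst|exact: mcontrol].
Qed.

Lemma measurable_game_value_jump : measurable_fun setT (fun w =>
    \int[dpath T (rho1 ^~ w)]_(t in `[theta w, T]) (c t w * jump (rho2 ^~ w) t)).
Proof.
have EccE w : `[theta w, T]%classic = [set t | Ecc (w, t)].
  by apply/seteqP; split => t /=; rewrite in_itv.
under eq_fun do rewrite EccE.
apply: (@measurable_dpath_integral rho1 Ecc (fun t w => c t w * jump (rho2 ^~ w) t)) => //.
apply: (measurable_funS _ EccT) => //; first exact: measurableX.
apply: measurable_funM; first exact: mprocess.
exact: mjump.
Qed.

Lemma game_value_processE : (fun w => game_value T (a ^~ w) (b ^~ w) (c ^~ w) (theta w)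
      (rho1 ^~ w) (rho2 ^~ w)) = (fun w =>
    \int[dpath T (rho1 ^~ w)]_(t in `[theta w, T[) (a t w * (1 - rho2 t w)) +
    \int[dpath T (rho2 ^~ w)]_(t in `[theta w, T[) (b t w * (1 - rho1 t w)) +
    \int[dpath T (rho1 ^~ w)]_(t in `[theta w, T]) (c t w * jump (rho2 ^~ w) t)).
Proof.
apply/funext => w; apply: game_value_integrals => //.
- exact: control_process_path.
- exact: control_process_path.
- exact: cadlag_process_regular.
Qed.

Lemma measurable_game_value : measurable_fun setT (fun w =>
  game_value T (a ^~ w) (b ^~ w) (c ^~ w) (theta w) (rho1 ^~ w) (rho2 ^~ w)).
Proof.
rewrite game_value_processE; apply: measurable_funD; first apply: measurable_funD.
- exact: measurable_game_value_co.
- exact: measurable_game_value_co.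
- exact: measurable_game_value_jump.
Qed.

End payoff_measurability.

(* Unlike [ge0_le_integral], this needs no measurability: the integral of a
   nonnegative function is a supremum over the simple functions below it. *)
Lemma ge0_le_integral_dom d (Omega : measurableType d) (R : realType)
    (mu : {measure set Omega -> \bar R}) (f g : Omega -> \bar R) :
  (forall w, 0 <= f w)%E -> (forall w, f w <= g w)%E ->
  (\int[mu]_w f w <= \int[mu]_w g w)%E.
Proof.
move=> f0 fg; have g0 w : (0 <= g w)%E by exact: le_trans (fg w).
rewrite !ge0_integralTE//; apply: le_ereal_sup => _ [h hf <-].
by exists h => // w; exact: le_trans (fg w).
Qed.

(** * Integrability of the payoff *)

Section payoff_integrability.
Context {d : measure_display} {Omega : measurableType d} {R : realType}.
Variable (P : probability Omega R) (T : R).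
Hypothesis T0 : 0 < T.

(* The supremum is not known to be measurable. *)
Lemma integrable_dominated (X : R -> Omega -> R) (Y : Omega -> R) :
  (forall w, cadlag T (X ^~ w)) ->
  (\int[P]_w ereal_sup [set `|X t w|%:E | t in `[0%R, T]] < +oo)%E ->
  measurable_fun setT Y ->
  (forall w M, (forall t, 0 <= t <= T -> `|X t w| <= M) -> `|Y w| <= M) ->
  P.-integrable setT (EFin \o Y).
Proof.
move=> cX supX mY XY; apply/integrableP; split; first exact/measurable_EFinP.
apply: le_lt_trans supX; apply: ge0_le_integral_dom => // w.
have [M XM] := cadlag_bounded (cX w).
set S := ereal_sup _.
have S0 t : 0 <= t <= T -> (`|X t w|%:E <= S)%E.
  by move=> tT; apply: ereal_sup_ubound; exists t => //=; rewrite in_itv.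
have SM : (S <= M%:E)%E.
  by apply: ge_ereal_sup => _ [t /= + <-]; rewrite in_itv/= lee_fin => /XM.
have Sf : S \is a fin_num.
  rewrite fin_numElt (le_lt_trans SM (ltry _)) andbT.
  by apply: lt_le_trans (S0 0 _); rewrite ?ltNyr// lexx ltW.
rewrite /= -(fineK Sf) lee_fin; apply: XY => t tT.
by rewrite -lee_fin fineK// S0.
Qed.

Lemma norm_dpath_integral_le x D phi M : control T x -> measurable D ->
  D `<=` `[0, T]%classic -> regular T phi -> 0 <= M ->
  (forall t, D t -> `|phi t| <= M) ->
  `| \int[dpath T x]_(t in D) phi t | <= M.
Proof.
move=> cx mD DT rphi M0 phiM.
have iphi := regular_integrable T0 cx mD DT rphi.
apply: (le_trans (le_normr_Rintegral _ iphi)) => //.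
apply: (@le_trans _ _ (\int[dpath T x]_(t in D) cst M t)).
  apply: le_Rintegral => //; first exact: integrable_norm.
  by apply: (regular_integrable T0 cx mD DT); exact: regular_cst.
rewrite Rintegral_cst// -[leRHS]mulr1 ler_wpM2l//.
have le1 : (dpath T x D <= 1)%E.
  rewrite -(dpath_setT T0 cx); apply: le_measure; rewrite ?inE//.
by rewrite -lee_fin fineK// ge0_fin_numE// (le_lt_trans le1)// ltry.
Qed.

Definition integrable_sup (X : R -> Omega -> R) : Prop :=
  (\int[P]_w ereal_sup [set `|X t w|%:E | t in `[0%R, T]] < +oo)%E.

Lemma integrable_game_value (theta : Omega -> R) (a b c rho1 rho2 : R -> Omega -> R) :
  measurable_fun setT theta -> (forall w, 0 <= theta w <= T) ->
  cadlag_process T a -> cadlag_process T b -> cadlag_process T c ->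
  integrable_sup a -> integrable_sup b -> integrable_sup c ->
  control_process T rho1 -> control_process T rho2 ->
  P.-integrable setT (EFin \o (fun w => game_value T (a ^~ w) (b ^~ w) (c ^~ w)
    (theta w) (rho1 ^~ w) (rho2 ^~ w))).
Proof.
move=> mth thT ca cb cc sa sb sc c1 c2.
rewrite (game_value_processE T0 thT a b cc c1 c2).
have th0 w : 0 <= theta w by case/andP: (thT w).
have co w : `[theta w, T[%classic `<=` `[0, T]%classic.
  by move=> t /=; rewrite !in_itv/= => /andP[tht /ltW ->]; rewrite (le_trans (th0 w)).
have term X rho rho' : cadlag_process T X -> integrable_sup X ->
    control_process T rho -> control_process T rho' ->
    P.-integrable setT (EFin \o (fun w =>
      \int[dpath T (rho ^~ w)]_(t in `[theta w, T[) (X t w * (1 - rho' t w)))).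
  move=> cX sX cr cr'; apply: (integrable_dominated (cadlag_process_path cX) sX).
    exact: measurable_game_value_co.
  move=> w M XM.
  have M0 : 0 <= M by apply: le_trans (XM 0 _) => //; rewrite lexx ltW.
  have cpr' := control_process_path cr' w.
  apply: norm_dpath_integral_le => //.
  - exact: control_process_path.
  - apply: regularM; first exact: cadlag_process_regular.
    exact: regular_one_sub.
  - move=> t /co; rewrite /= in_itv/= => tT; rewrite normrM -[M]mulr1 ler_pM ?XM//.
    by rewrite ger0_norm ?subr_ge0 ?(control_le1 cpr')// gerBl (control_ge0 cpr').
have jterm : P.-integrable setT (EFin \o (fun w =>
    \int[dpath T (rho1 ^~ w)]_(t in `[theta w, T]) (c t w * jump (rho2 ^~ w) t))).
  apply: (integrable_dominated (cadlag_process_path cc) sc).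
    exact: measurable_game_value_jump.
  move=> w M XM.
  have M0 : 0 <= M by apply: le_trans (XM 0 _) => //; rewrite lexx ltW.
  have cp2 := control_process_path c2 w.
  apply: norm_dpath_integral_le => //.
  - exact: control_process_path.
  - move=> t /=; rewrite !in_itv/= => /andP[tht ->].
    by rewrite (le_trans (th0 w)).
  - apply: regularM; first exact: cadlag_process_regular.
    exact: regular_jump.
  - move=> t; rewrite /= in_itv/= => /andP[tht tT'].
    have tT : 0 <= t <= T by rewrite (le_trans (th0 w)).
    rewrite normrM -[M]mulr1 ler_pM ?XM//.
    rewrite ger0_norm ?(jump_ge0 T0 cp2)// lerBlDr.
    by rewrite (le_trans (control_le1 cp2 tT))// lerDl (left_lim_ge0 T0 cp2).
have := integrableD measurableT (integrableD measurableT
  (term a rho1 rho2 ca sa c1 c2) (term b rho2 rho1 cb sb c2 c1)) jterm.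
by apply: eq_integrable.
Qed.

End payoff_integrability.

(** * Expected payoff of randomised stopping times *)

Section product_probability.
Context {d1 d2} {T1 : measurableType d1} {T2 : measurableType d2} {R : realType}.
Variables (P1 : probability T1 R) (P2 : probability T2 R).
Local Open Scope ereal_scope.

(** A separate name lets the product measure carry the structure of a probability. *)
Definition product_probability : set (T1 * T2) -> \bar R := (P1 \x P2).

HB.instance Definition _ := Measure.on product_probability.

Let product_probability_setT : product_probability setT = 1.
Proof.
rewrite /product_probability -setXTT.
by rewrite [LHS]product_measure1E// [X in X * _]probability_setT
  [X in _ * X]probability_setT mule1.
Qed.

HB.instance Definition _ :=
  Measure_isProbability.Build _ _ _ product_probability product_probability_setT.

End product_probability.

Section independent_devices.
Context {d : measure_display} {Omega : measurableType d} {R : realType}.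
Variable (P : probability Omega R) (F : set_system Omega).
Hypotheses (sF : sigma_algebra setT F) (FM : F `<=` measurable).
Variables Z1 Z2 : {RV P >-> R}.
Hypothesis devices : randomisation_devices F Z1 Z2.

Local Notation FT := (g_sigma_algebraType F).
Local Notation Q := (uniform_prob (@ltr01 R)).
Local Notation PF := (Psub P sF FM).
Local Notation PQ := (product_probability PF Q).
Local Open Scope ereal_scope.

(** The scenario is seen through [F] only, because the devices are independent of [F] and not of the
    whole ambient sigma-algebra. *)
Let with_first (w : Omega) : FT * measurableTypeR R := (w, Z1 w).

Let measurable_with_first : measurable_fun setT with_first.
Proof.
apply: measurable_fun_pair; first exact: measurable_to_sub.
exact: (measurable_funPT Z1).
Qed.

Let with_both (w : Omega) : (FT * measurableTypeR R) * measurableTypeR R :=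
  (with_first w, Z2 w).

Let measurable_with_both : measurable_fun setT with_both.
Proof.
apply: measurable_fun_pair; first exact: measurable_with_first.
exact: (measurable_funPT Z2).
Qed.

Let first_mfun : {mfun Omega >-> (FT * measurableTypeR R)%type} :=
  HB.pack with_first (isMeasurableFun.Build _ _ _ _ _ measurable_with_first).

Let both_mfun : {mfun Omega >-> ((FT * measurableTypeR R) * measurableTypeR R)%type} :=
  HB.pack with_both (isMeasurableFun.Build _ _ _ _ _ measurable_with_both).

(** Threefold independence is used in two stages. For fixed B, both sides are measures in A that
    agree on rectangles, by independence, and hence everywhere; B varies afterwards. *)
Let law_with_first (B : set (measurableTypeR R)) A : measurable B -> measurable A ->
  P (with_first @^-1` A `&` Z2 @^-1` B) = PQ A * Q B.
Proof.
move=> mB mA.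
have mZ2 : measurable (Z2 @^-1` B : set Omega).
  by rewrite -[X in measurable X]setTI; exact: (measurable_funPT Z2).
have QBf : Q B \is a fin_num by exact: fin_num_measure.
have QB0 : (0 <= fine (Q B))%R by exact: fine_ge0.
have rect (A' : set (FT * measurableTypeR R)) : measurable A' ->
    (PF \x mscale (NngNum QB0) Q) A' = pushforward (mrestr P mZ2) first_mfun A'.
  move=> mA'; apply: product_measure_unique => // E B1 mE mB1.
  have FE : F E by rewrite -(measurable_g_measurableTypeE sF).
  have [Z1u Z2u indep] := devices.
  rewrite -[LHS]/(P (E `&` Z1 @^-1` B1 `&` Z2 @^-1` B)) indep//.
  rewrite (_ : P (Z1 @^-1` B1) = Q B1); last exact: Z1u.
  rewrite (_ : P (Z2 @^-1` B) = Q B); last exact: Z2u.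
  rewrite -[RHS]/(P E * ((fine (Q B))%:E * Q B1)).
  by rewrite fineK// -muleA [Q B1 * _]muleC.
rewrite -[LHS]/(pushforward (mrestr P mZ2) first_mfun A) -rect//.
rewrite -[LHS]/(\int[PF]_w ((fine (Q B))%:E * Q (xsection A w))).
rewrite ge0_integralZl_EFin//; first by rewrite fineK// muleC.
exact: measurable_fun_xsection.
Qed.

(** The scenario seen through [F] and the two devices have a product law, the form in which
    independence enters Fubini. *)
Lemma joint_law A : measurable A ->
  product_probability PQ Q A = pushforward P both_mfun A.
Proof.
have rect A' B : measurable A' -> measurable B ->
    pushforward P both_mfun (A' `*` B) = PQ A' * Q B.
  by move=> mA' mB; rewrite -(law_with_first mB mA').
exact: (@product_measure_unique _ _ _ _ _ PQ Q (pushforward P both_mfun) rect).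
Qed.

Variable T : R.
Hypothesis T0 : (0 < T)%R.
Variables rho1 rho2 : R -> Omega -> R.
Hypotheses (c1 : control_process T (rho1 : R -> FT -> R))
  (c2 : control_process T (rho2 : R -> FT -> R)).
Variable X : R -> Omega -> R.
Hypothesis cX : cadlag_process T (X : R -> FT -> R).
Hypothesis sX : integrable_sup P T X.
Variable K : set (R * R).
Hypothesis mK : measurable K.
Variable kappa : R -> Omega -> R.
Hypothesis kappaE : forall w t, (0 <= t <= T)%R ->
  dpath T (rho2 ^~ w) [set s | K (t, s)] = (kappa t w)%:E.
Hypothesis rkappa : forall w, regular T (kappa ^~ w).

Let tau := generated_time T rho1 Z1.
Let sigma := generated_time T rho2 Z2.

(** The payoff term as a function of scenario and devices. The clip is inert, as quantiles lie in
    [0, T], and gives access to joint measurability of the process. *)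
Let phi (p : (FT * measurableTypeR R) * measurableTypeR R) : R :=
  (X (clip T (quantile T (rho1 ^~ p.1.1) p.1.2)) p.1.1 *
   \1_K (quantile T (rho1 ^~ p.1.1) p.1.2, quantile T (rho2 ^~ p.1.1) p.2))%R.

Let mq1 : measurable_fun setT
  (fun p : FT * measurableTypeR R => quantile T (rho1 ^~ p.1) p.2).
Proof. by case: c1 => m1 p1; exact: (@measurable_quantile _ T T0 _ FT). Qed.

Let mq2 : measurable_fun setT
  (fun p : FT * measurableTypeR R => quantile T (rho2 ^~ p.1) p.2).
Proof. by case: c2 => m1 p1; exact: (@measurable_quantile _ T T0 _ FT). Qed.

Let mX : measurable_fun setT
  (fun p : FT * measurableTypeR R => X (clip T p.2) p.1).
Proof. by case: cX => m1 p1; exact: (@measurable_cadlag_process _ FT). Qed.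

Let mphi : measurable_fun setT phi.
Proof.
apply: measurable_funM.
  apply: (measurableT_comp (f := fun p : FT * measurableTypeR R =>
    X (clip T (quantile T (rho1 ^~ p.1) p.2)) p.1)); last exact: measurable_fst.
  apply: (measurableT_comp mX (g := fun p : FT * measurableTypeR R =>
    (p.1, quantile T (rho1 ^~ p.1) p.2))).
  by apply: measurable_fun_pair; [exact: measurable_fst|exact: mq1].
have mI : measurable_fun setT (\1_K : R * R -> R) by exact: measurable_indic.
have mg : measurable_fun setT (fun p : (FT * measurableTypeR R) * measurableTypeR R =>
    (quantile T (rho1 ^~ p.1.1) p.1.2, quantile T (rho2 ^~ p.1.1) p.2) : R * R).
  apply: measurable_fun_pair.
    by apply: (measurableT_comp mq1); exact: measurable_fst.
  apply: (measurableT_comp mq2 (g := fun p : (FT * measurableTypeR R) * measurableTypeR R =>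
    (p.1.1, p.2))).
  apply: measurable_fun_pair; last exact: measurable_snd.
  by apply: (measurableT_comp (@measurable_fst _ _ FT (measurableTypeR R)));
    exact: measurable_fst.
exact: (measurableT_comp mI mg).
Qed.

Let payoffE w : (X (tau w) w * \1_K (tau w, sigma w))%R = phi (with_both w).
Proof.
rewrite /phi/= clip_id//.
exact: (quantile_range T0 (control_process_path c1 w) (Z1 w)).
Qed.

Lemma integrable_payoff_term :
  P.-integrable setT (EFin \o (fun w => X (tau w) w * \1_K (tau w, sigma w))%R).
Proof.
apply: (@integrable_dominated _ Omega R P T T0 X _ (cadlag_process_path cX) sX).
  under eq_fun do rewrite payoffE.
  exact: (measurableT_comp mphi).
move=> w M XM; rewrite normrM -[M]mulr1 ler_pM//.
  apply: XM; exact: (quantile_range T0 (control_process_path c1 w) (Z1 w)).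
by rewrite indicE; case: (_ \in _); rewrite ?normr1 ?normr0.
Qed.

Let iphi : (product_probability PQ Q).-integrable setT (EFin \o phi).
Proof.
have /integrableP[_ ip] := integrable_payoff_term.
apply/integrableP; split; first exact/measurable_EFinP.
rewrite (@eq_measure_integral _ _ _ _ (pushforward P both_mfun)); last first.
  by move=> A mA _; exact: joint_law.
rewrite ge0_integral_pushforward//; last first.
  by apply: measurableT_comp => //; exact/measurable_EFinP.
rewrite preimage_setT; move: ip; congr (_ < _); apply: eq_integral => w _.
by rewrite /= payoffE.
Qed.

Let g (z : FT * measurableTypeR R) : R :=
  (X (quantile T (rho1 ^~ z.1) z.2) z.1 *
   kappa (quantile T (rho1 ^~ z.1) z.2) z.1)%R.

Let inner_v z : \int[Q]_v (phi (z, v))%:E = (g z)%:E.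
Proof.
case: z => w u; rewrite /phi /g/=; set t := quantile T (rho1 ^~ w) u.
have cp2 := control_process_path c2 w.
have tT : (0 <= t <= T)%R.
  exact: (quantile_range T0 (control_process_path c1 w)).
rewrite clip_id//.
have mKt : measurable [set s | K (t, s)].
  by have := pair1_measurable t measurableT mK; rewrite setTI.
have mB : measurable (quantile T (rho2 ^~ w) @^-1` [set s | K (t, s)] :
    set (measurableTypeR R)).
  have := measurable_quantile_path T0 cp2 measurableT mKt.
  by rewrite setTI.
rewrite (eq_integral (fun v : measurableTypeR R => (X t w)%:E *
    (\1_(quantile T (rho2 ^~ w) @^-1` [set s | K (t, s)]) v)%:E)); last first.
  by move=> v _; rewrite -EFinM.
rewrite integralZl//; last exact: integrable_indic.
rewrite integral_indic// setIT EFinM; congr (_ * _).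
by rewrite -(kappaE w tT) (dpath_quantile T0 cp2).
Qed.

Let ig : PQ.-integrable setT (EFin \o g).
Proof.
have := integrable_fubini_F iphi; apply: eq_integrable => //.
by move=> z _; exact: inner_v.
Qed.

Let N (w : FT) : R :=
  (\int[dpath T (rho1 ^~ w)]_(t in `[0, T]) (X t w * kappa t w))%R.

Let rXkappa (w : FT) : regular T (fun t => X t w * kappa t w)%R.
Proof. by apply: regularM => //; exact: (@cadlag_process_regular _ FT _ _ T0 _ w cX). Qed.

Let inner_u w : \int[Q]_u (g (w, u))%:E = (N w)%:E.
Proof.
have cp1 := control_process_path c1 w.
have D01 : (`[0%R, T]%classic : set R) `<=` (`[0%R, T]%classic : set R) by [].
have mI : measurable (`[0%R, T]%classic : set (measurableTypeR R)).
  exact: measurable_itv.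
have fin := integrable_fin_num mI (regular_integrable T0 cp1 mI D01 (rXkappa w)).
rewrite /N /Rintegral fineK// (integral_dpath T0 cp1)//; last exact: (rXkappa w).1.
apply: eq_integral => u _; congr EFin; rewrite patchE mem_set//=.
by rewrite in_itv/=; exact: (quantile_range T0 cp1).
Qed.

Let mN : measurable_fun setT N.
Proof.
apply/measurable_EFinP.
have := measurable_fubini_F ig; apply: eq_measurable_fun.
by move=> w _; exact: inner_u.
Qed.

Lemma integrable_payoff_path : P.-integrable setT (EFin \o (fun w : Omega =>
  \int[dpath T (rho1 ^~ w)]_(t in `[0, T]) (X t w * kappa t w))%R).
Proof.
apply: (@integrable_dominated _ Omega R P T T0 X _ (cadlag_process_path cX) sX).
  by apply: (measurable_wrt_fun FM); exact/(measurable_wrtP sF).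
move=> w M XM; have cp1 := control_process_path c1 w.
have cp2 := control_process_path c2 w.
have M0 : (0 <= M)%R by apply: le_trans (XM 0%R _) => //; rewrite lexx ltW.
apply: norm_dpath_integral_le => // t; rewrite /= in_itv/= => tT.
rewrite normrM -[M]mulr1 ler_pM ?XM//.
have mKt : measurable [set s | K (t, s)].
  by have := pair1_measurable t measurableT mK; rewrite setTI.
rewrite ger0_norm -lee_fin -kappaE// -(dpath_setT T0 cp2).
by apply: le_measure; rewrite ?inE.
Qed.

(** Integrating out the second device replaces the indicator of K by [kappa], the mass that the
    opponent puts on the times related to t. Integrating out the first device replaces the quantile
    by the measure of its path. With K the relation t < s or t = s, this serves all three payoff
    terms. *)
Lemma integral_payoff_term :
  \int[P]_w (X (tau w) w * \1_K (tau w, sigma w))%:E =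
  \int[P]_w (\int[dpath T (rho1 ^~ w)]_(t in `[0%R, T]) (X t w * kappa t w))%R%:E.
Proof.
transitivity (\int[product_probability PQ Q]_p (phi p)%:E).
  rewrite (@eq_measure_integral _ _ _ _ (pushforward P both_mfun)); last first.
    by move=> A mA _; exact: joint_law.
  rewrite integral_pushforward//.
  - by rewrite preimage_setT; apply: eq_integral => w _; rewrite /= payoffE.
  - exact/measurable_EFinP.
  - rewrite preimage_setT; apply: eq_integrable integrable_payoff_term => //.
    by move=> w _; rewrite /= payoffE.
rewrite -(integral12_prod_meas1 iphi).
transitivity (\int[PQ]_z (g z)%:E); first by apply: eq_integral => z _; exact: inner_v.
transitivity (\int[PF]_w \int[Q]_u (g (w, u))%:E).
  by rewrite (integral12_prod_meas1 ig).
transitivity (\int[PF]_w (N w)%:E); first by apply: eq_integral => w _; exact: inner_u.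
have := integrable_payoff_path => iN; rewrite integral_pushforward//.
- exact/measurable_EFinP.
Qed.

End independent_devices.

Lemma randomisation_devicesC d (Omega : measurableType d) (R : realType)
    (P : probability Omega R) (F : set_system Omega) (Z1 Z2 : {RV P >-> R}) :
  randomisation_devices F Z1 Z2 -> randomisation_devices F Z2 Z1.
Proof.
move=> [u1 u2 ind]; split=> // E B1 B2 FE mB1 mB2.
by rewrite setIAC ind// muleAC.
Qed.

Section expected_payoff.
Context {d : measure_display} {Omega : measurableType d} {R : realType}.
Variable (P : probability Omega R) (F : set_system Omega).
Hypotheses (sF : sigma_algebra setT F) (FM : F `<=` measurable).
Local Notation FT := (g_sigma_algebraType F).
Variable T : R.
Hypothesis T0 : 0 < T.

Lemma dpath_gt (x : R -> R) (t : R) : control T x -> 0 <= t <= T ->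
  dpath T x [set s | t < s] = (1 - x t)%:E.
Proof.
move=> cx tT.
have E1 : [set s | t < s] = ~` (`]-oo, t]%classic : set (measurableTypeR R)).
  apply/seteqP; split => s /=; rewrite in_itv/=; first by rewrite ltNge => /negP.
  by move/negP; rewrite -ltNge.
have m : measurable (`]-oo, t]%classic : set (measurableTypeR R)) by exact: measurable_itv.
have : ((x t)%:E + dpath T x [set s | (t < s)%R] = 1)%E.
  rewrite -(extend_pathE x tT) -(dpath_ray T0 cx) E1 -(dpath_setT T0 cx).
  rewrite -(setUv (`]-oo, t]%classic : set (measurableTypeR R))).
  by rewrite [RHS]measureU ?setICr//; exact: measurableC.
by move=> /(congr1 (fun z => z - (x t)%:E)%E); rewrite addeAC subee// add0e.
Qed.

(** The terms in f and g carry 1 minus the opponent's control, which vanishes at T, so the closed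
    interval coming from randomisation may be replaced by the half-open one of [J]. *)
Lemma Rintegral_itv_end (x phi : R -> R) : phi T = 0 ->
  \int[dpath T x]_(t in `[0, T]) phi t = \int[dpath T x]_(t in `[0, T[) phi t.
Proof.
move=> phiT; rewrite Rintegral_mkcond [RHS]Rintegral_mkcond.
congr Rintegral; apply/funext => t; rewrite !patchE !mem_setE !in_itv/=.
by case: (ltgtP t T) => [tT|tT|->]; rewrite ?andbF ?andbT// phiT if_same.
Qed.

Variables Z1 Z2 : {RV P >-> R}.
Hypothesis devices : randomisation_devices F Z1 Z2.
Variables rho1 rho2 f g h : R -> Omega -> R.
Hypotheses (c1 : control_process T (rho1 : R -> FT -> R))
  (c2 : control_process T (rho2 : R -> FT -> R)).
Hypotheses (cf : cadlag_process T (f : R -> FT -> R))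
  (cg : cadlag_process T (g : R -> FT -> R))
  (ch : cadlag_process T (h : R -> FT -> R)).
Hypotheses (sf : integrable_sup P T f) (sg : integrable_sup P T g)
  (sh : integrable_sup P T h).

Let mlt : measurable [set p : R * R | p.1 < p.2].
Proof.
have /(_ measurableT [set true] I) :=
  measurable_fun_ltr (@measurable_fst _ _ R R) (@measurable_snd _ _ R R).
by rewrite setTI.
Qed.

Let meq : measurable [set p : R * R | p.1 = p.2].
Proof.
have /(_ measurableT [set true] I) :=
  measurable_fun_eqr (@measurable_fst _ _ R R) (@measurable_snd _ _ R R).
rewrite setTI; congr measurable; apply/seteqP; split => p /=; by move/eqP.
Qed.

Let tau := generated_time T rho1 Z1.
Let sigma := generated_time T rho2 Z2.

Lemma payoff_split w : payoff f g h tau sigma w =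
  f (tau w) w * \1_[set p : R * R | p.1 < p.2] (tau w, sigma w) +
  g (sigma w) w * \1_[set p : R * R | p.1 < p.2] (sigma w, tau w) +
  h (tau w) w * \1_[set p : R * R | p.1 = p.2] (tau w, sigma w).
Proof.
rewrite /payoff !indicE; case: ltgtP => [lt|gt|e].
- rewrite mem_set//= mulr1 memNset/=; last by rewrite ltNge (ltW lt).
  rewrite memNset/=; last by move=> e; move: lt; rewrite e ltxx.
  by rewrite !mulr0 !addr0.
- rewrite memNset/=; last by rewrite ltNge (ltW gt).
  rewrite mem_set//= mulr1 memNset/=; last by move=> e; move: gt; rewrite e ltxx.
  by rewrite !mulr0 add0r addr0.
- rewrite memNset/=; last by rewrite e ltxx.
  rewrite memNset/=; last by rewrite e ltxx.
  by rewrite mem_set//= mulr1 !mulr0 !add0r.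
Qed.

Let k1 (rho : R -> FT -> R) : control_process T rho -> forall w t, 0 <= t <= T ->
  dpath T (rho ^~ w) [set s | [set p : R * R | p.1 < p.2] (t, s)] = (1 - rho t w)%:E.
Proof. by move=> c w t tT; rewrite -(dpath_gt (control_process_path c w) tT). Qed.

Let k2 (rho : R -> FT -> R) : control_process T rho -> forall w t, 0 <= t <= T ->
  dpath T (rho ^~ w) [set s | [set p : R * R | p.1 = p.2] (t, s)] =
  (jump (rho ^~ w) t)%:E.
Proof.
move=> c w t tT; rewrite -(dpath_set1 T0 (control_process_path c w) tT).
by congr (dpath _ _ _); apply/seteqP; split => s /= ->.
Qed.

Let r1 (rho : R -> FT -> R) : control_process T rho ->
  forall w, regular T (fun t => 1 - rho t w).
Proof. by move=> c w; exact: (regular_one_sub T0 (control_process_path c w)). Qed.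

Let r2 (rho : R -> FT -> R) : control_process T rho ->
  forall w, regular T (jump (rho ^~ w)).
Proof. by move=> c w; exact: (regular_jump T0 (control_process_path c w)). Qed.

(** Randomisation is eliminated here: each of the three indicator terms is integrated over the
    devices. In the g term the second player stops first, so the controls and the devices are
    exchanged. *)
Lemma expected_payoff : ('E_P[payoff f g h tau sigma] =
  \int[P]_w (game_value T (f ^~ w) (g ^~ w) (h ^~ w) 0 (rho1 ^~ w) (rho2 ^~ w))%:E)%E.
Proof.
have devices' := randomisation_devicesC devices.
rewrite expectation.unlock.
transitivity (\int[P]_w (f (tau w) w * \1_[set p : R * R | p.1 < p.2] (tau w, sigma w) +
  g (sigma w) w * \1_[set p : R * R | p.1 < p.2] (sigma w, tau w) +
  h (tau w) w * \1_[set p : R * R | p.1 = p.2] (tau w, sigma w))%:E)%E.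
  by apply: eq_integral => w _; rewrite payoff_split.
have i1 := integrable_payoff_term sF FM Z1 Z2 T0 c1 c2 cf sf mlt.
have i2 := integrable_payoff_term sF FM Z2 Z1 T0 c2 c1 cg sg mlt.
have i3 := integrable_payoff_term sF FM Z1 Z2 T0 c1 c2 ch sh meq.
rewrite (integralD_EFin measurableT (integrableD measurableT i1 i2) i3).
rewrite (integralD_EFin measurableT i1 i2).
rewrite (integral_payoff_term sF FM devices T0 c1 c2 cf sf mlt (k1 c2) (r1 c2)).
rewrite (integral_payoff_term sF FM devices' T0 c2 c1 cg sg mlt (k1 c1) (r1 c1)).
rewrite (integral_payoff_term sF FM devices T0 c1 c2 ch sh meq (k2 c2) (r2 c2)).
have j1 := integrable_payoff_path sF FM devices T0 c1 c2 cf sf mlt (k1 c2) (r1 c2).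
have j2 := integrable_payoff_path sF FM devices' T0 c2 c1 cg sg mlt (k1 c1) (r1 c1).
have j3 := integrable_payoff_path sF FM devices T0 c1 c2 ch sh meq (k2 c2) (r2 c2).
rewrite -(integralD_EFin measurableT j1 j2).
rewrite -(integralD_EFin measurableT (integrableD measurableT j1 j2) j3).
apply: eq_integral => w _.
have cp1 := control_process_path c1 w.
have cp2 := control_process_path c2 w.
have rh := @cadlag_process_regular _ FT _ _ T0 _ w ch.
rewrite (game_value_integrals T0 (f ^~ w) (g ^~ w) cp1 cp2 (lexx 0) rh).
congr EFin; congr (_ + _ + _); apply: Rintegral_itv_end.
  by rewrite (control_end cp2) subrr mulr0.
by rewrite (control_end cp1) subrr mulr0.
Qed.

End expected_payoff.

(** * Filtrations and stopping times *)

Lemma measurable_invr (R : realType) : measurable_fun setT (fun x : R => x^-1).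
Proof.
have o0 : open [set x : R | x != 0].
  rewrite (_ : [set x : R | _] = ~` [set 0]); last first.
    by apply/seteqP; split => x /=; [move=> /eqP|move/eqP].
  exact: closed_openC.
have -> : (fun x : R => x^-1) = (fun x : R => x^-1) \_ [set x : R | x != 0].
  apply/funext => x; rewrite patchE; have [->|x0] := eqVneq x 0; last by rewrite mem_set.
  by rewrite invr0 memNset//= eqxx.
apply: (measurable_restrictT _ (open_measurable o0)).1.
apply: open_continuous_measurable_fun => // x; rewrite inE/= => x0.
exact: inv_continuous.
Qed.

Section filtration.
Context {d : measure_display} {Omega : measurableType d} {R : realType}.
Variable T : R.
Hypothesis T0 : 0 < T.
Implicit Types (G : R -> set_system Omega) (rho xi : R -> Omega -> R).

Record filtration G : Prop := {
  filtration_sigma : forall t, 0 <= t <= T -> sigma_algebra setT (G t);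
  filtration_sub : forall t, 0 <= t <= T -> G t `<=` measurable;
  filtration_mono : forall s t, 0 <= s -> s <= t -> t <= T -> G s `<=` G t }.

Lemma usual_filtrationW (P : probability Omega R) G :
  usual_filtration P T G -> filtration G.
Proof. by case. Qed.

Lemma filtration_common G1 G2 : filtration G1 -> filtration G2 ->
  filtration (common_filtration G1 G2).
Proof.
move=> [s1 m1 n1] [s2 m2 n2]; split.
- move=> t tT; have [a1 b1 c1] := s1 t tT; have [a2 b2 c2] := s2 t tT.
  split; first by split.
    by move=> A [A1 A2]; split; [exact: b1|exact: b2].
  move=> A AG; split; [apply: c1 => n|apply: c2 => n]; by case: (AG n).
- by move=> t tT A [A1 _]; exact: (m1 t).
- by move=> s t s0 st tT A [A1 A2]; split; [exact: (n1 s)|exact: (n2 s)].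
Qed.

Lemma admissible_control G theta rho w : admissible T G theta rho ->
  control T (rho ^~ w).
Proof.
case=> [_ crho r0 rm _ rT]; split => //.
- by move=> t; exact: r0.
- by move=> s t; exact: rm.
- by move=> t; exact: (crho w).1.
Qed.

Lemma control_cadlag x : control T x -> cadlag T x.
Proof.
move=> cx; split; first exact: (control_rcont cx).
move=> t /andP[t0 tT]; have := left_lim_cvg cx t0 tT; exact: cvgP.
Qed.

Lemma admissibleW G theta rho : adapted T G rho -> (forall w, control T (rho ^~ w)) ->
  (forall w, left_at rho theta w = 0) -> admissible T G theta rho.
Proof.
move=> ad c l; split => //.
- by move=> w; exact: control_cadlag.
- by move=> w t; exact: (control_ge0 (c w)).
- by move=> w s t; exact: (control_mono (c w)).
- by move=> w; exact: (control_end (c w)).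
Qed.

Section stopped.
Variables (G : R -> set_system Omega) (theta : Omega -> R).
Hypotheses (fG : filtration G) (st : stopping_time T G theta).

Let thT w : 0 <= theta w <= T. Proof. exact: st.1. Qed.
Let TT : 0 <= T <= T. Proof. by rewrite lexx ltW. Qed.

Let le_theta t : 0 <= t <= T -> G t [set w | theta w <= t].
Proof. exact: st.2. Qed.

Let mG t A : 0 <= t <= T -> G t A = measurable (A : set (g_sigma_algebraType (G t))).
Proof. by move=> tT; rewrite (measurable_g_measurableTypeE (filtration_sigma fG tT)). Qed.

Lemma sigma_algebra_stopped : sigma_algebra setT (stopped_algebra T G theta).
Proof.
split.
- split=> [|t tT]; first by rewrite mG.
  by rewrite mG// set0I.
- move=> A [AT At]; split=> [|t tT].
    by move: AT; rewrite !mG// setTD; exact: measurableC.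
  rewrite mG//; have -> : (setT `\` A) `&` [set w | theta w <= t] =
    [set w | theta w <= t] `\` (A `&` [set w | theta w <= t]).
    apply/seteqP; split => w /=; first by move=> [[_ nA] wt]; split => // -[].
    by move=> [wt nA]; split => //; split => // Aw; exact: nA.
  apply: measurableD; first by rewrite -mG//; exact: le_theta.
  by rewrite -mG//; exact: At.
- move=> A AG; split=> [|t tT].
    rewrite mG//; apply: bigcupT_measurable => n.
    by rewrite -mG//; case: (AG n).
  rewrite mG// setI_bigcupl; apply: bigcupT_measurable => n.
  by rewrite -mG//; exact: (AG n).2.
Qed.

Lemma stopped_sub : stopped_algebra T G theta `<=` measurable.
Proof. by move=> A [AT _]; exact: (filtration_sub fG TT). Qed.

Lemma stopped_lt t : stopped_algebra T G theta [set w | t < theta w].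
Proof.
have [t0|t0] := ltP t 0.
  have -> : [set w | t < theta w] = setT.
    by apply/seteqP; split => // w _ /=; case/andP: (thT w) => /(lt_le_trans t0).
  split=> [|s sT]; first by rewrite mG.
  by rewrite setTI; exact: le_theta.
have lt s : t <= s -> s <= T -> G s [set w | t < theta w].
  move=> ts sT; have s0 := le_trans t0 ts.
  have -> : [set w | t < theta w] = ~` [set w | theta w <= t].
    by apply/seteqP; split => w /=; rewrite ltNge => /negP.
  rewrite mG ?s0//; apply: measurableC; rewrite -mG ?s0//.
  apply: (filtration_mono fG t0 ts sT); apply: le_theta.
  by rewrite t0 (le_trans ts).
have [tT|tT] := leP t T; last first.
  have -> : [set w | t < theta w] = set0.
    apply/seteqP; split => // w /=; case/andP: (thT w) => _ wT.
    by rewrite ltNge (le_trans wT)// ltW.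
  by have [] := sigma_algebra_stopped.
split=> [|s /andP[s0 sT]]; first exact: lt.
have [st'|ts] := ltP s t.
  rewrite (_ : _ `&` _ = set0); first by rewrite mG ?s0.
  apply/seteqP; split => // w /= [tw ws]; move: (lt_le_trans tw ws).
  by rewrite ltNge ltW.
rewrite mG ?s0//; apply: measurableI; rewrite -mG ?s0//; first exact: lt.
by apply: le_theta; rewrite s0.
Qed.

Lemma stopping_time_measurable : measurable_fun setT theta.
Proof.
apply: (measurability _ (RGenOInfty.measurableE R)) => _ [_ [t ->] <-].
rewrite setTI; apply: stopped_sub; have := stopped_lt t; congr (stopped_algebra _ _ _ _).
by apply/seteqP; split => w /=; rewrite in_itv/= andbT.
Qed.

(** Monotonicity replaces the left limit by values at earlier rational times. The bound 0 <= c
    covers t = 0, where the left limit is 0 and there is no earlier time. *)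
Lemma left_lim_gt x t c : control T x -> 0 <= t <= T -> 0 <= c ->
  c < left_lim x t <-> exists2 q : rat, 0 <= (ratr q : R) < t & c < x (ratr q).
Proof.
move=> cx /andP[t0 tT] c0; split=> [|[q /andP[q0 qt] cq]]; last first.
  by apply: (lt_le_trans cq); apply: (le_left_lim T0 cx) => //; rewrite q0.
move=> cl; have tgt0 : 0 < t.
  rewrite lt_neqAle t0 andbT; apply/eqP => te; move: cl.
  by rewrite /left_lim -te ltxx ltNge c0.
have cl' : c < lim (x s @[s --> t^'-]) by move: cl; rewrite /left_lim tgt0.
have [s [s0 sltt cs]] : exists s, [/\ 0 < s, s < t & c < x s].
  near (t^'-) => s; exists s; split.
  - by near: s; exact: nbhs_left_gt.
  - by near: s; exact: nbhs_left_lt.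
  - near: s; apply: (cvgr_gt _ (left_lim_cvg cx tgt0 tT)); exact: cl'.
have /rat_in_itvoo[q] := sltt; rewrite in_itv/= => /andP[sq qt].
exists q; first by rewrite (le_trans (ltW s0) (ltW sq)).
by apply: (lt_le_trans cs); apply: (control_mono cx); rewrite ?ltW// (lt_le_trans qt).
Unshelve. all: by end_near. Qed.

(** The left limit exceeds c >= 0 iff rho exceeds c at some rational q < theta. Each such event is
    known at theta: on theta <= t it is empty if t <= q, and otherwise rho at q is known at t. *)
Lemma measurable_left_at rho : adapted T G rho ->
  (forall w, control T (rho ^~ w)) ->
  measurable_wrt (stopped_algebra T G theta) (left_at rho theta).
Proof.
move=> ad cr; apply/(measurable_wrtP sigma_algebra_stopped).
apply: (measurability _ (RGenOInfty.measurableE R)) => _ [_ [c ->] <-].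
rewrite setTI; have -> : left_at rho theta @^-1` `]c, +oo[ = [set w | c < left_at rho theta w].
  by apply/seteqP; split => w /=; rewrite in_itv/= andbT.
have [c0|c0] := ltP c 0.
  rewrite (_ : [set _ | _] = setT)//; apply/seteqP; split => // w _ /=.
  exact: (lt_le_trans c0 (left_lim_ge0 T0 (cr w) (thT w))).
pose U (q : rat) : set Omega := if (0 <= ratr q :> R) && (ratr q <= T) then
  [set w | ratr q < theta w] `&` [set w | c < rho (ratr q) w] else set0.
have -> : [set w | c < left_at rho theta w] = \bigcup_q U q.
  apply/seteqP; split => [w /(left_lim_gt (cr w) (thT w) c0)[q /andP[q0 qt] cq]|w [q _]].
    exists q => //; rewrite /U q0 (le_trans (ltW qt))//.
    by case/andP: (thT w).
  rewrite /U; case: ifP => // /andP[q0 qT] [/= qt cq].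
  by apply/(left_lim_gt (cr w) (thT w) c0); exists q => //; rewrite q0.
apply: bigcupT_measurable_rat => q; rewrite /U; case: ifP => // qT.
rewrite (measurable_g_measurableTypeE sigma_algebra_stopped).
have /andP[q0 qT'] := qT.
have Gq : G (ratr q) [set w | c < rho (ratr q) w].
  have := ad _ qT _ (measurable_itv `]c, +oo[); congr (G _ _).
  by apply/seteqP; split => w /=; rewrite in_itv/= andbT.
split=> [|t /andP[t0 tT]].
  rewrite mG//; apply: measurableI; rewrite -mG//.
    by case: (stopped_lt (ratr q)).
  exact: (filtration_mono fG q0 qT').
have [tq|qt] := leP t (ratr q).
  rewrite (_ : _ `&` _ = set0); first by rewrite mG ?t0.
  apply/seteqP; split => // w /= [[qw _] wt]; move: (lt_le_trans qw wt).
  by rewrite ltNge tq.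
rewrite setIAC mG ?t0//; apply: measurableI; rewrite -mG ?t0//.
  by apply: (stopped_lt (ratr q)).2; rewrite t0.
exact: (filtration_mono fG q0 (ltW qt)).
Qed.

(** A quantity known at theta is known at t once theta <= t. The default 0 before theta gives an
    everywhere defined ingredient for the adaptedness of pasted and truncated controls. *)
Lemma measurable_stopped_ge (Y : Omega -> R) t :
  measurable_wrt (stopped_algebra T G theta) Y -> 0 <= t <= T ->
  measurable_wrt (G t) (fun w => if theta w <= t then Y w else 0).
Proof.
move=> mY tT B mB; rewrite mG//.
have [_ /(_ t tT) m1] := mY B mB.
have m2 := le_theta tT.
have -> : (fun w => if theta w <= t then Y w else 0) @^-1` B =
  (Y @^-1` B `&` [set w | theta w <= t]) `|`
  (if 0 \in B then ~` [set w | theta w <= t] else set0).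
  apply/seteqP; split => [w /=|w /= [[Yw ->//]|]].
    case: ifP => wt Bw; [by left|right].
    by rewrite mem_set//= => wt'; rewrite wt' in wt.
  case: ifPn => // /set_mem B0 /negP/negbTE /= ->//.
apply: measurableU; first by rewrite -mG.
by case: ifP => // _; apply: measurableC; rewrite -mG.
Qed.

Definition paste (A : set Omega) rho rhoh : R -> Omega -> R := fun t w =>
  if `[< A w >] then paste_path (rho ^~ w) (rhoh ^~ w) (theta w) t else rho t w.

Lemma control_paste A rho rhoh w : control T (rho ^~ w) -> control T (rhoh ^~ w) ->
  control T (paste A rho rhoh ^~ w).
Proof.
move=> c ch; rewrite /paste; case: asboolP => _ //; exact: (control_paste_path T0 c ch (thT w)).
Qed.

Lemma adapted_paste A rho rhoh : stopped_algebra T G theta A ->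
  adapted T G rho -> adapted T G rhoh -> (forall w, control T (rho ^~ w)) ->
  adapted T G (paste A rho rhoh).
Proof.
move=> GA ad adh cr t tT; have sGt := filtration_sigma fG tT.
have mY := measurable_stopped_ge (measurable_left_at ad cr) tT.
(* The left limit at theta enters only where theta <= t. There it equals its cut-off version, which
   is measurable for [G t]. *)
have -> : paste A rho rhoh t = (fun w => if w \in A `&` [set w | theta w <= t] then
   (if theta w <= t then left_at rho theta w else 0) +
   (1 - (if theta w <= t then left_at rho theta w else 0)) * rhoh t w else rho t w).
  apply/funext => w; rewrite /paste /paste_path ltNge; case: asboolP => Aw.
    case: ifPn => wt; last by move/negPn: wt => wt; rewrite mem_set ?wt.
    rewrite (_ : (w \in _) = false)//; apply: memNset => -[_] /=.
    exact/negP.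
  by rewrite (_ : (w \in _) = false)//; apply: memNset => -[].
apply/(measurable_wrtP sGt); apply: measurable_fun_ifT.
- apply: (measurable_fun_bool true); rewrite setTI.
  rewrite [X in measurable X](_ : _ = A `&` [set w | theta w <= t]).
    by rewrite -mG//; exact: GA.2.
  by apply/seteqP; split => w /=; [move/set_mem|move=> ?; exact/mem_set].
- apply: measurable_funD; first exact/(measurable_wrtP sGt).
  apply: measurable_funM; last by apply/(measurable_wrtP sGt); exact: adh.
  by apply: measurable_funB => //; exact/(measurable_wrtP sGt).
- by apply/(measurable_wrtP sGt); exact: ad.
Qed.

Lemma admissible_paste A rho rhoh : stopped_algebra T G theta A ->
  admissible T G (cst 0) rho -> admissible T G theta rhoh ->
  admissible T G (cst 0) (paste A rho rhoh).
Proof.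
move=> GA ar ah; have cr w := admissible_control w ar.
apply: admissibleW.
- by apply: adapted_paste => //; [case: ar|case: ah].
- by move=> w; apply: control_paste => //; exact: (admissible_control w ah).
- by move=> w; rewrite /left_at /left_lim/= ltxx.
Qed.

Lemma admissible_truncate rho : admissible T G (cst 0) rho ->
  admissible T G theta (truncate rho theta).
Proof.
move=> ar; have cr w := admissible_control w ar; apply: admissibleW; last 2 first.
- by move=> w; exact: control_truncate_path.
- by move=> w; exact: left_lim_truncate_path.
have ad := admissible_adapted ar.
move=> t tT; have sGt := filtration_sigma fG tT.
have /(measurable_wrtP sGt) mY := measurable_stopped_ge (measurable_left_at ad cr) tT.
have -> : truncate rho theta t = (fun w => if theta w <= t then
   (if 1 - (if theta w <= t then left_at rho theta w else 0) == 0 then 1 else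
    (rho t w - (if theta w <= t then left_at rho theta w else 0)) /
    (1 - (if theta w <= t then left_at rho theta w else 0))) else 0).
  apply/funext => w; rewrite /truncate /truncate_path ltNge.
  by case: (theta w <= t).
apply/(measurable_wrtP sGt).
have m1 : measurable_fun [set: g_sigma_algebraType (G t)]
    (fun w => 1 - (if theta w <= t then left_at rho theta w else 0)).
  by apply: measurable_funB.
apply: measurable_fun_ifT => //.
- by apply: (measurable_fun_bool true); rewrite setTI -mG//; exact: le_theta.
apply: measurable_fun_ifT => //.
- exact: measurable_fun_eqr.
apply: measurable_funM.
  by apply: measurable_funB => //; apply/(measurable_wrtP sGt); exact: ad.
exact: (measurableT_comp (@measurable_invr R)).
Qed.

End stopped.
End filtration.

(** * One player against a fixed opponent *)

Section weighted_cond_exp.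
Context {d : measure_display} {Omega : measurableType d} {R : realType}.
Variables (P : probability Omega R) (G : set_system Omega).
Hypotheses (sG : sigma_algebra setT G) (GM : G `<=` measurable).

Lemma cond_exp_eq (X Y : Omega -> \bar R) :
  P.-integrable setT X -> P.-integrable setT Y ->
  (forall A, G A -> (\int[P]_(w in A) X w = \int[P]_(w in A) Y w)%E) ->
  {ae P, forall w, cond_exp P G X w = cond_exp P G Y w}.
Proof.
move=> iX iY XY; apply: (cond_exp_unique sG GM iY).
- exact: cond_exp_measurable.
- exact: integrable_cond_exp.
- by move=> A GA; rewrite integral_cond_exp// XY.
Qed.

Lemma integrable_ae_eq (X Y : Omega -> \bar R) : measurable_fun setT Y ->
  P.-integrable setT X -> {ae P, forall w, X w = Y w} -> P.-integrable setT Y.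
Proof.
move=> mY /integrableP[mX iX] XY; apply/integrableP; split => //.
apply: le_lt_trans iX; rewrite le_eqVlt; apply/orP; left; apply/eqP.
apply: ge0_ae_eq_integral => //; first exact: measurableT_comp.
  exact: measurableT_comp.
by apply: filterS XY => w + _ /= => ->.
Qed.

Lemma cond_exp_ae (X Y : Omega -> \bar R) : measurable_fun setT Y ->
  P.-integrable setT X -> {ae P, forall w, X w = Y w} ->
  {ae P, forall w, cond_exp P G X w = cond_exp P G Y w}.
Proof.
move=> mY iX XY; have iY := integrable_ae_eq mY iX XY.
apply: cond_exp_eq => // A GA; apply: ae_eq_integral => //.
- exact: GM.
- by apply: measurable_funTS; case/integrableP: iX.
- exact: measurable_funTS.
- by apply: filterS XY => w + _ /= => ->.
Qed.

Variables p q N M : Omega -> R.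
Hypotheses (mp : measurable_wrt G p) (mq : measurable_fun setT q).
Hypotheses (p01 : forall w, 0 <= p w <= 1) (q01 : forall w, 0 <= q w <= 1).
Hypotheses (mN : measurable_fun setT N).
Hypotheses (iM : P.-integrable setT (EFin \o M)).
Hypothesis ME : forall w, M w = (1 - p w) * (1 - q w) * N w.

Let S := cond_exp P G (fun w => (1 - q w)%:E).
Let Pi w := if fine (S w) == 0 then 1 else (1 - q w) / fine (S w).
(** [S] is nonnegative and finite only almost surely. This version is so everywhere, as required of
    a factor in [cond_exp_mull]. *)
Let s w := Num.max 0 (fine (S w)).

Let iq : P.-integrable setT (EFin \o (fun w => 1 - q w)).
Proof.
apply: (@le_integrable _ _ _ _ _ _ _ (EFin \o cst 1)) => //.
- by apply/measurable_EFinP; apply: measurable_funB.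
- move=> w _ /=; rewrite lee_fin normr1 ger0_norm.
    by rewrite lerBlDr lerDl; case/andP: (q01 w).
  by rewrite subr_ge0; case/andP: (q01 w).
- exact: finite_measure_integrable_cst.
Qed.

Lemma cond_exp_survival_ge0 : {ae P, forall w, (0 <= S w)%E}.
Proof.
apply: (integrable_ae_le_sub sG GM (Y1 := cst 0%E)).
- apply/(measurable_wrtP sG); exact: measurable_cst.
- exact: cond_exp_measurable.
- exact: integrable0.
- exact: integrable_cond_exp.
- move=> A GA; rewrite integral0 integral_cond_exp//.
  by apply: integral_ge0 => w _; rewrite lee_fin subr_ge0; case/andP: (q01 w).
Qed.

Lemma cond_exp_survival_fin : {ae P, forall w, S w \is a fin_num}.
Proof.
have /(integrable_ae measurableT) := integrable_cond_exp sG GM iq.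
by apply: filterS => w; apply.
Qed.

Let mS : measurable_wrt G S. Proof. exact: cond_exp_measurable. Qed.

Let ms : measurable_wrt G s.
Proof.
apply/(measurable_wrtP sG); apply: measurable_maxr => //.
by apply: measurableT_comp => //; exact/(measurable_wrtP sG).
Qed.

(** The event s = 0 belongs to [G], so 1 - q and its conditional expectation have the same integral
    over it, namely 0; as 1 - q is nonnegative, it vanishes there. *)
Let s0_q : {ae P, forall w, s w = 0 -> 1 - q w = 0}.
Proof.
pose B := s @^-1` [set 0].
have GB : G B by apply: ms; exact: measurable_set1.
have mB := GM GB.
have mSB : measurable_fun B S by apply: measurable_funTS; exact: (measurable_wrt_fun GM).
have S0B : ae_eq P B S (cst 0%E).
  apply: filterS2 cond_exp_survival_fin cond_exp_survival_ge0 => w Sf S0 sw; rewrite /cst/=.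
  apply/eqP; rewrite eq_le S0 andbT -(fineK Sf) lee_fin.
  by rewrite -[leRHS]sw le_max lexx orbT.
have : (\int[P]_(w in B) `|(1 - q w)%:E| = 0)%E.
  transitivity (\int[P]_(w in B) (1 - q w)%:E)%E.
    apply: eq_integral => w _; rewrite gee0_abs// lee_fin subr_ge0.
    by case/andP: (q01 w).
  rewrite -(integral_cond_exp sG GM iq GB) -/S -(integral0 P B).
  exact: ae_eq_integral.
have mq' : measurable_fun B (fun w => (1 - q w)%:E).
  by apply/measurable_EFinP; apply: measurable_funTS; exact: measurable_funB.
move/(ae_eq_integral_abs _ mB mq'); apply: filterS => w + sw.
by move=> /(_ sw)[].
Qed.

(* The factor (1 - p) S clears the denominator of Pi, and 1 - q vanishes almost
   surely where S does. *)
Lemma weighted_cond_exp : {ae P, forall w, ((1 - p w)%:E * S w *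
    cond_exp P G (fun w => (Pi w * N w)%:E) w =
  cond_exp P G (EFin \o M) w)%E}.
Proof.
pose W w := (1 - p w) * s w.
have mW : measurable_wrt G W.
  apply/(measurable_wrtP sG); apply: measurable_funM; last exact/(measurable_wrtP sG).
  by apply: measurable_funB => //; exact/(measurable_wrtP sG).
have W0 w : 0 <= W w.
  by rewrite mulr_ge0// ?le_max ?lexx// subr_ge0; case/andP: (p01 w).
have mfS : measurable_fun setT (fine \o S).
  by apply: measurableT_comp => //; exact: (measurable_wrt_fun GM).
have mPi : measurable_fun setT Pi.
  apply: measurable_fun_ifT => //; first exact: measurable_fun_eqr.
  apply: measurable_funM; first exact: measurable_funB.
  exact: (measurableT_comp (@measurable_invr R) mfS).
have mX : measurable_fun setT (fun w => Pi w * N w) by exact: measurable_funM.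
have mWX : measurable_fun setT (W \* (fun w => Pi w * N w)).
  by apply: measurable_funM => //; exact: (measurable_wrt_fun GM).
have WM : {ae P, forall w, M w = (W \* (fun w => Pi w * N w)) w}.
  apply: filterS s0_q => w; rewrite ME /W /Pi /s /= => sq.
  have [s0|s0] := leP (fine (S w)) 0.
    by rewrite (sq (max_l s0)) !(mulr0, mul0r).
  rewrite gt_eqF// mulrA; congr (_ * _).
  by rewrite -[in RHS]mulrA; congr (_ * _); rewrite mulrCA divff ?mulr1// gt_eqF.
have mWX' : measurable_fun setT (EFin \o (W \* (fun w => Pi w * N w))).
  exact/measurable_EFinP.
have WM' : {ae P, forall w, (M w)%:E = (EFin \o (W \* (fun w => Pi w * N w))) w}.
  by apply: filterS WM => w ->.
have iWX := integrable_ae_eq mWX' iM WM'.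
have mull := cond_exp_mull sG GM mW W0 mX iWX.
have eqM := cond_exp_ae mWX' iM WM'.
have WS : {ae P, forall w, ((1 - p w)%:E * S w = (W w)%:E)%E}.
  apply: filterS2 cond_exp_survival_fin cond_exp_survival_ge0 => w Sf S0.
  by rewrite /W /s (max_r (fine_ge0 S0)) EFinM fineK.
by apply: filterS3 mull eqM WS => w mw ew ->; rewrite ew -mw.
Qed.

End weighted_cond_exp.

Lemma cond_exp_tower d (Omega : measurableType d) (R : realType)
    (P : probability Omega R) (K G : set_system Omega) (X Y : Omega -> \bar R) :
  sigma_algebra setT K -> sigma_algebra setT G -> K `<=` G -> G `<=` measurable ->
  P.-integrable setT X -> measurable_fun setT Y ->
  {ae P, forall w, Y w = cond_exp P G X w} ->
  {ae P, forall w, cond_exp P K Y w = cond_exp P K X w}.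
Proof.
move=> sK sG KG GM iX mY YX; have KM := subset_trans KG GM.
have iG := integrable_cond_exp sG GM iX.
have XY : {ae P, forall w, cond_exp P G X w = Y w} by apply: filterS YX => w ->.
apply: filterS2 (cond_exp_ae sK KM mY iG XY) (cond_exp_eq sK KM iG iX _).
  by move=> w <- <-.
by move=> A /KG GA; exact: integral_cond_exp.
Qed.

(** * Essential bounds after multiplication by a nonnegative factor *)

Section scaled_essential_bounds.
Context {d : measure_display} {Omega : measurableType d} {R : realType}.
Variable P : probability Omega R.
Local Open Scope ereal_scope.

(** Where W > 0, the quotient c / W bounds the family from below and is attained at X0. Where W = 0,
    attainment gives c = W X0 = 0, so both sides vanish even if Y is infinite. *)
Lemma ess_inf_scaled (W c X0 Y : Omega -> \bar R) (Phi : set (Omega -> \bar R)) :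
  measurable_fun setT W -> measurable_fun setT c ->
  {ae P, forall w, 0 <= W w} -> {ae P, forall w, W w \is a fin_num} ->
  (forall X, Phi X -> {ae P, forall w, c w <= W w * X w}) ->
  Phi X0 -> {ae P, forall w, W w * X0 w = c w} ->
  is_ess_inf_fam P Phi Y -> {ae P, forall w, W w * Y w = c w}.
Proof.
move=> mW mc W0 Wf cX PhiX0 WX0 [mY YX maxY].
(* c / W, set to -oo where W = 0, is a lower bound of the family. *)
pose Y' w := if (0 < fine (W w))%R then ((fine (W w))^-1)%:E * c w else -oo.
have mfW : measurable_fun setT (fine \o W) by exact: measurableT_comp.
have mY' : measurable_fun setT Y'.
  apply: measurable_fun_ifT => //; first exact: measurable_fun_ltr.
  apply: emeasurable_funM => //; apply/measurable_EFinP.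
  exact: (measurableT_comp (@measurable_invr R) mfW).
have Y'X X : Phi X -> {ae P, forall w, Y' w <= X w}.
  move=> /cX; apply: filterS3 W0 Wf => w _ Wf cWX; rewrite /Y'.
  case: ifPn => [W0|_]; last exact: leNye.
  by rewrite lee_pdivrMl// fineK.
have aeY' := maxY _ mY' Y'X; have aeY := YX _ PhiX0.
have {}W0 : {ae P, forall w, 0 <= W w /\ W w \is a fin_num}.
  by apply: filterS2 W0 Wf => w ? ?; split.
have {}aeY : {ae P, forall w, Y' w <= Y w /\ Y w <= X0 w}.
  by apply: filterS2 aeY' aeY => w ? ?; split.
apply: filterS3 W0 WX0 aeY => w [W0w Wfw] WX0w [Y'Y YX0].
apply/eqP; rewrite eq_le -{1}WX0w lee_wpmul2l//=.
have [W0'|W0'] := ltP 0%R (fine (W w)).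
  by move: Y'Y; rewrite /Y' W0' lee_pdivrMl// fineK.
have -> : W w = 0.
  by apply/eqP; rewrite eq_le W0w andbT -(fineK Wfw) lee_fin.
rewrite mul0e -WX0w (_ : W w = 0) ?mul0e//.
by apply/eqP; rewrite eq_le W0w andbT -(fineK Wfw) lee_fin.
Qed.

Lemma ess_sup_scaled (W c X0 Y : Omega -> \bar R) (Phi : set (Omega -> \bar R)) :
  measurable_fun setT W -> measurable_fun setT c ->
  {ae P, forall w, 0 <= W w} -> {ae P, forall w, W w \is a fin_num} ->
  (forall X, Phi X -> {ae P, forall w, W w * X w <= c w}) ->
  Phi X0 -> {ae P, forall w, W w * X0 w = c w} ->
  is_ess_sup_fam P Phi Y -> {ae P, forall w, W w * Y w = c w}.
Proof.
move=> mW mc W0 Wf cX PhiX0 WX0 [mY YX minY].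
have inf : is_ess_inf_fam P [set (fun w => - X w) | X in Phi] (fun w => - Y w).
  split.
  - exact: measurableT_comp.
  - by move=> _ [X /YX + <-]; apply: filterS => w; rewrite leeN2.
  - move=> Y' mY' Y'X.
    have mNY' : measurable_fun setT (fun w => - Y' w) by exact: measurableT_comp.
    have := minY (fun w => - Y' w) mNY'.
    have h X : Phi X -> {ae P, forall w, X w <= - Y' w}.
      move=> PhiX; have := Y'X _ (ex_intro2 _ _ X PhiX erefl).
      by apply: filterS => w; rewrite leeNr.
    by move=> /(_ h); apply: filterS => w; rewrite leeNr.
have := @ess_inf_scaled W (fun w => - c w) (fun w => - X0 w) _ _ mW _ W0 Wf _ _ _ inf.
have mc' : measurable_fun setT (fun w => - c w) by exact: measurableT_comp.
have cX' X : [set (fun w => - X w) | X in Phi] X -> {ae P, forall w, - c w <= W w * X w}.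
  by move=> [X' /cX + <-]; apply: filterS => w; rewrite muleN leeN2.
have PhiX0' : [set (fun w => - X w) | X in Phi] (fun w => - X0 w) by exists X0.
have WX0' : {ae P, forall w, W w * - X0 w = - c w}.
  by apply: filterS WX0 => w <-; rewrite muleN.
move=> /(_ mc' cX' PhiX0' WX0'); apply: filterS => w.
by rewrite muleN => /oppe_inj.
Qed.

End scaled_essential_bounds.

Lemma add_sub_ge (R : realDomainType) (x y u v : \bar R) : x = (y + (u - v))%E ->
  y \is a fin_num -> u \is a fin_num -> v \is a fin_num ->
  ((y <= x) = (v <= u))%E.
Proof.
move=> ->; case: y u v => [y||] [u||] [v||]// _ _ _.
by rewrite -EFinB -EFinD !lee_fin lerDl subr_ge0.
Qed.

Lemma add_sub_le (R : realDomainType) (x y u v : \bar R) : x = (y + (u - v))%E ->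
  y \is a fin_num -> u \is a fin_num -> v \is a fin_num ->
  ((x <= y) = (u <= v))%E.
Proof.
move=> ->; case: y u v => [y||] [u||] [v||]// _ _ _.
by rewrite -EFinB -EFinD !lee_fin gerDl subr_le0.
Qed.

(** * The best response of one player *)

Section one_player.
Context {d : measure_display} {Omega : measurableType d} {R : realType}.
Variables (P : probability Omega R) (T : R).
Hypothesis T0 : 0 < T.

Lemma admissible_process (G : R -> set_system Omega) theta rho : filtration T G ->
  admissible T G theta rho -> control_process T rho.
Proof.
move=> fG ar; split=> [t tT|w]; last exact: admissible_control ar.
apply: (measurable_wrt_fun (filtration_sub fG tT)).
by case: ar => + *; exact.
Qed.

Variables (G H : R -> set_system Omega) (lambda : Omega -> R).
Hypotheses (fG : filtration T G) (fH : filtration T H).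
Hypotheses (stG : stopping_time T G lambda) (stH : stopping_time T H lambda).
Variables rho opp : R -> Omega -> R.
Hypotheses (ar : admissible T G (cst 0) rho) (ao : admissible T H (cst 0) opp).
Variables a b c : R -> Omega -> R.
Hypotheses (ca : cadlag_process T a) (cb : cadlag_process T b)
  (cc : cadlag_process T c).
Hypotheses (sa : integrable_sup P T a) (sb : integrable_sup P T b)
  (sc : integrable_sup P T c).

Local Notation GL := (stopped_algebra T G lambda).
Let p := left_at rho lambda.
Let q := left_at opp lambda.

(** The opponent is not truncated here. At x = [rho] this is the common integrand M(xi) of the
    overview. *)
Definition continuation_value (x : R -> Omega -> R) (w : Omega) : R :=
  game_value T (a ^~ w) (b ^~ w) (c ^~ w) (lambda w) (x ^~ w) (opp ^~ w).

(** This realises M(x) of the overview as the payoff after lambda of an actual control;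
    [pasted_valueE] gives the product form. *)
Definition pasted_value (x : R -> Omega -> R) (w : Omega) : R :=
  game_value T (a ^~ w) (b ^~ w) (c ^~ w) (lambda w)
    (paste_path (rho ^~ w) (x ^~ w) (lambda w)) (opp ^~ w).

Definition truncated_value (x : R -> Omega -> R) (w : Omega) : R :=
  game_value T (a ^~ w) (b ^~ w) (c ^~ w) (lambda w) (x ^~ w)
    (truncate opp lambda ^~ w).

Let lT w : 0 <= lambda w <= T. Proof. by case: stG. Qed.
Let cr w : control T (rho ^~ w). Proof. exact: admissible_control ar. Qed.
Let co w : control T (opp ^~ w). Proof. exact: admissible_control ao. Qed.
Let ra w : regular T (a ^~ w). Proof. exact: cadlag_process_regular. Qed.
Let rb w : regular T (b ^~ w). Proof. exact: cadlag_process_regular. Qed.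
Let rc w : regular T (c ^~ w). Proof. exact: cadlag_process_regular. Qed.

Let sGL : sigma_algebra setT GL. Proof. exact: sigma_algebra_stopped. Qed.
Let GLM : GL `<=` measurable. Proof. exact: (stopped_sub T0 fG). Qed.

Let ml : measurable_fun setT lambda.
Proof. exact: (stopping_time_measurable T0 fG). Qed.

Let atru : admissible T H lambda (truncate opp lambda).
Proof. exact: admissible_truncate. Qed.

Lemma pasted_valueE x w : admissible T G lambda x ->
  pasted_value x w = (1 - p w) * (1 - q w) * truncated_value x w.
Proof.
move=> ax; apply: (game_value_scale T0) => //.
- exact: (control_paste_path T0 (cr w) (admissible_control w ax) (lT w)).
- exact: admissible_control ax.
- exact: admissible_control atru.
- exact: left_lim_paste_path.
- exact: (admissible_start ax).
- by move=> s /andP[ls _]; exact: paste_path_ge.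
- exact: left_lim_truncate_path.
- by move=> s; exact: (truncate_path_ge T0 (co w) (lT w)).
Qed.

(** Both sides are (1-p)(1-q) times the value of the two truncated controls. *)
Lemma pasted_value_truncate w :
  pasted_value (truncate rho lambda) w = continuation_value rho w.
Proof.
have at' : admissible T G lambda (truncate rho lambda) by exact: admissible_truncate.
rewrite pasted_valueE//; apply/esym; apply: (game_value_scale T0) => //.
- exact: admissible_control at'.
- exact: admissible_control atru.
- exact: left_lim_truncate_path.
- by move=> s; exact: (truncate_path_ge T0 (cr w) (lT w)).
- exact: left_lim_truncate_path.
- by move=> s; exact: (truncate_path_ge T0 (co w) (lT w)).
Qed.

Let po := admissible_process fH ao.

Let paste_setT x : (fun t w => paste_path (rho ^~ w) (x ^~ w) (lambda w) t) =
  paste lambda setT rho x.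
Proof.
by apply/funext => t; apply/funext => w; rewrite /paste asboolT.
Qed.

Lemma integrable_pasted_value x : admissible T G lambda x ->
  P.-integrable setT (EFin \o pasted_value x).
Proof.
move=> ax; apply: (integrable_game_value T0 ml lT ca cb cc sa sb sc _ po
  (rho1 := fun t w => paste_path (rho ^~ w) (x ^~ w) (lambda w) t)).
rewrite paste_setT; apply: (admissible_process fG (theta := cst 0)).
apply: admissible_paste => //.
by have [s0 sC _] := sGL; have := sC _ s0; rewrite setD0.
Qed.

Lemma integrable_continuation_value : P.-integrable setT (EFin \o continuation_value rho).
Proof.
exact: (integrable_game_value T0 ml lT ca cb cc sa sb sc (admissible_process fG ar) po).
Qed.

Let survival_lambda := survival P T G opp lambda.
Let Pi := weight P T G opp lambda.

Definition response_value (x : R -> Omega -> R) : Omega -> \bar R :=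
  cond_exp P GL (fun w => (Pi w * truncated_value x w)%:E).

Let p01 w : 0 <= p w <= 1.
Proof.
by rewrite (left_lim_ge0 T0 (cr w) (lT w)) (left_lim_le1 T0 (cr w) (lT w)).
Qed.

Let q01 w : 0 <= q w <= 1.
Proof.
by rewrite (left_lim_ge0 T0 (co w) (lT w)) (left_lim_le1 T0 (co w) (lT w)).
Qed.

Let mp : measurable_wrt GL p.
Proof. by apply: measurable_left_at => //; case: ar. Qed.

Let mq : measurable_fun setT q.
Proof.
apply: (measurable_wrt_fun (stopped_sub T0 fH (theta := lambda))).
by apply: measurable_left_at => //; case: ao.
Qed.

Lemma weighted_response_value x : admissible T G lambda x ->
  {ae P, forall w, ((1 - p w)%:E * survival_lambda w * response_value x w =
    cond_exp P GL (EFin \o pasted_value x) w)%E}.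
Proof.
move=> ax; apply: weighted_cond_exp => //.
- apply: (measurable_game_value T0 ml lT ca cb cc (admissible_process fG ax)).
  exact: admissible_process atru.
- exact: integrable_pasted_value.
- by move=> w; exact: pasted_valueE.
Qed.

Let iN0 x : admissible T G (cst 0) x -> P.-integrable setT (EFin \o (fun w =>
  game_value T (a ^~ w) (b ^~ w) (c ^~ w) 0 (x ^~ w) (opp ^~ w))).
Proof.
move=> ax; apply: (integrable_game_value (theta := cst 0) T0) => //.
- by move=> w; rewrite /= lexx ltW.
- exact: admissible_process ax.
Qed.

Lemma integral_paste A x : GL A -> admissible T G lambda x ->
  (\int[P]_w (game_value T (a ^~ w) (b ^~ w) (c ^~ w) 0
     (paste lambda A rho x ^~ w) (opp ^~ w))%:E =
   \int[P]_w (game_value T (a ^~ w) (b ^~ w) (c ^~ w) 0 (rho ^~ w) (opp ^~ w))%:E +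
   (\int[P]_(w in A) (pasted_value x w)%:E -
    \int[P]_(w in A) (continuation_value rho w)%:E))%E.
Proof.
move=> GA ax; have mA := GLM GA.
have iM := integrable_pasted_value ax; have i0 := integrable_continuation_value.
rewrite [X in (_ = _ + (X - _))%E]integral_mkcond.
rewrite [X in (_ = _ + (_ - X))%E]integral_mkcond.
have iMA : P.-integrable setT ((EFin \o pasted_value x) \_ A).
  by apply/(integrable_mkcond _ mA); exact: integrableS iM.
have i0A : P.-integrable setT ((EFin \o continuation_value rho) \_ A).
  by apply/(integrable_mkcond _ mA); exact: integrableS i0.
rewrite -integralB// -integralD//; [|exact: iN0|exact: integrableB].
apply: eq_integral => w _; rewrite !patchE /paste.
case: asboolP => Aw; last by rewrite memNset//= sube0 adde0.
rewrite mem_set//= -EFinB -EFinD; congr EFin.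
rewrite -(game_value_sub T0 (ra w) (rb w) (rc w) (cr w) _ (co w) (lT w)).
- by rewrite addrC subrK.
- exact: (control_paste_path T0 (cr w) (admissible_control w ax) (lT w)).
- by move=> s sl; rewrite paste_path_lt.
Qed.

Let finite_sub A x : GL A -> admissible T G lambda x ->
  [/\ (\int[P]_(w in A) (pasted_value x w)%:E \is a fin_num)%E,
    (\int[P]_(w in A) (continuation_value rho w)%:E \is a fin_num)%E &
    (\int[P]_w (game_value T (a ^~ w) (b ^~ w) (c ^~ w) 0 (rho ^~ w) (opp ^~ w))%:E
      \is a fin_num)%E].
Proof.
move=> /GLM mA ax; split; apply: integrable_fin_num => //.
- exact: integrableS (integrable_pasted_value ax).
- exact: integrableS integrable_continuation_value.
- exact: iN0.
Qed.

Let mc0 : measurable_fun setT (cond_exp P GL (EFin \o continuation_value rho)).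
Proof. exact: (measurable_wrt_fun GLM (cond_exp_measurable _ sGL _)). Qed.

Let mW : measurable_fun setT (fun w => (1 - p w)%:E * survival_lambda w)%E.
Proof.
apply: emeasurable_funM.
  apply/measurable_EFinP; apply: measurable_funB => //.
  exact: (measurable_wrt_fun GLM).
exact: (measurable_wrt_fun GLM (cond_exp_measurable _ sGL _)).
Qed.

Let W0 : {ae P, forall w, (0 <= (1 - p w)%:E * survival_lambda w)%E}.
Proof.
apply: filterS (cond_exp_survival_ge0 P sGL GLM mq q01) => w S0.
by rewrite mule_ge0// lee_fin subr_ge0; case/andP: (p01 w).
Qed.

Let Wfin : {ae P, forall w, ((1 - p w)%:E * survival_lambda w)%E \is a fin_num}.
Proof.
apply: filterS (cond_exp_survival_fin P sGL GLM mq q01) => w S0.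
by rewrite fin_numM.
Qed.

Let mresponse X : [set response_value x | x in admissible T G lambda] X ->
  measurable_fun setT X.
Proof.
by move=> [x _ <-]; exact: (measurable_wrt_fun GLM (cond_exp_measurable _ sGL _)).
Qed.

Let response0 : {ae P, forall w,
  ((1 - p w)%:E * survival_lambda w * response_value (truncate rho lambda) w =
   cond_exp P GL (EFin \o continuation_value rho) w)%E}.
Proof.
have -> : continuation_value rho = pasted_value (truncate rho lambda).
  by apply/funext => w; rewrite pasted_value_truncate.
by apply: weighted_response_value; exact: admissible_truncate.
Qed.

Local Notation N0 x := (fun w =>
  game_value T (a ^~ w) (b ^~ w) (c ^~ w) 0 (x ^~ w) (opp ^~ w)).

Let W V w := ((1 - left_at rho lambda w)%:E * survival P T G opp lambda w * V w)%E.

(** Measurability of the product is recorded for the tower property: V is given as measurable for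
    the ambient sigma-algebra, and only the almost sure equality ties the product to [GL]. *)
Lemma weighted_ess_inf :
  (forall x, admissible T G (cst 0) x ->
    (\int[P]_w (N0 rho w)%:E <= \int[P]_w (N0 x w)%:E)%E) ->
  let V := ess_inf_fam P [set response_value x | x in admissible T G lambda] in
  measurable_fun setT (W V) /\
  {ae P, forall w, W V w = cond_exp P GL (EFin \o continuation_value rho) w}.
Proof.
move=> opt V; have essV := ess_inf_famP P mresponse.
split; first by apply: emeasurable_funM => //; case: essV.
apply: (ess_inf_scaled mW mc0 W0 Wfin _ _ response0 essV); last first.
  by exists (truncate rho lambda) => //; exact: admissible_truncate.
move=> _ [x ax <-].
apply: filterS2 (weighted_response_value ax)
  (cond_exp_le sGL GLM integrable_continuation_value (integrable_pasted_value ax) _).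
  by move=> w ->.
move=> A GA; have [f1 f2 f3] := finite_sub GA ax.
rewrite -(add_sub_ge (integral_paste GA ax) f3 f1 f2).
exact: opt (admissible_paste T0 fG stG GA ar ax).
Qed.

Lemma weighted_ess_sup :
  (forall x, admissible T G (cst 0) x ->
    (\int[P]_w (N0 x w)%:E <= \int[P]_w (N0 rho w)%:E)%E) ->
  let V := ess_sup_fam P [set response_value x | x in admissible T G lambda] in
  measurable_fun setT (W V) /\
  {ae P, forall w, W V w = cond_exp P GL (EFin \o continuation_value rho) w}.
Proof.
move=> opt V; have essV := ess_sup_famP P mresponse.
split; first by apply: emeasurable_funM => //; case: essV.
apply: (ess_sup_scaled mW mc0 W0 Wfin _ _ response0 essV); last first.
  by exists (truncate rho lambda) => //; exact: admissible_truncate.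
move=> _ [x ax <-].
apply: filterS2 (weighted_response_value ax)
  (cond_exp_le sGL GLM (integrable_pasted_value ax) integrable_continuation_value _).
  by move=> w ->.
move=> A GA; have [f1 f2 f3] := finite_sub GA ax.
rewrite -(add_sub_le (integral_paste GA ax) f3 f1 f2).
exact: opt (admissible_paste T0 fG stG GA ar ax).
Qed.

End one_player.

(** * Measurability through the terminal sigma-algebra and exchange of the players *)

Section process_structure.
Context {d : measure_display} {Omega : measurableType d} {R : realType}.
Variables (P : probability Omega R) (T : R).
Hypothesis T0 : 0 < T.
Variable H : set_system Omega.
Hypotheses (sH : sigma_algebra setT H) (HM : H `<=` measurable).
Local Notation HT := (g_sigma_algebraType H).

Lemma control_process_sub (G : R -> set_system Omega) theta rho :
  (forall t, 0 <= t <= T -> G t `<=` H) -> admissible T G theta rho ->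
  control_process T (rho : R -> HT -> R).
Proof.
move=> GH ar; split=> [t tT|w]; last exact: admissible_control ar.
apply/(measurable_wrtP sH) => B mB; apply: GH (tT) _ _.
by case: ar => + *; exact.
Qed.

Lemma cadlag_process_sub (G : R -> set_system Omega) X :
  (forall t, 0 <= t <= T -> G t `<=` H) -> adapted T G X -> Lb P T X ->
  cadlag_process T (X : R -> HT -> R).
Proof.
move=> GH aX [cX _ _]; split=> // t tT.
by apply/(measurable_wrtP sH) => B mB; apply: GH (tT) _ _; exact: aX.
Qed.

Lemma adapted_cadlag_process (G : R -> set_system Omega) X :
  (forall t, 0 <= t <= T -> G t `<=` H) -> adapted T G X -> Lb P T X ->
  cadlag_process T X.
Proof.
move=> GH aX [cX _ _]; split=> // t tT.
by apply: (measurable_wrt_fun HM) => B mB; apply: GH (tT) _ _; exact: aX.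
Qed.

(** In [J] the first player's control always comes first, whereas [response_value] lists the
    responding player first. For the second player this exchanges f and g. *)
Lemma response_valueC (G : R -> set_system Omega) (lambda : Omega -> R)
    (rho f g h x : R -> Omega -> R) :
  J P T f g h (weight P T G rho lambda) (stopped_algebra T G lambda) lambda
    (truncate rho lambda) x = response_value P T G lambda rho g f h x.
Proof.
rewrite /J /response_value.
apply: (congr1 (cond_exp P (stopped_algebra T G lambda))); apply/funext => w.
apply: (congr1 (fun v => (weight P T G rho lambda w * v)%:E)).
exact: (game_valueC T (f ^~ w)).
Qed.

End process_structure.

Theorem proposition3p10 (R : realType) (d : measure_display)
  (Omega : measurableType d) (P : probability Omega R) (T : R)
  (F F1 F2 : R -> set_system Omega) (f g h : R -> Omega -> R)
  (T_gt0 : 0 < T)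
  (P_complete : measure_is_complete P)
  (F_usual : usual_filtration P T F)
  (F_proper : F T `<` measurable)
  (F1_usual : usual_filtration P T F1)
  (F2_usual : usual_filtration P T F2)
  (F12_sub : forall t, 0 <= t <= T -> <<s F1 t `|` F2 t >> `<=` F t)
  (f_Lb : Lb P T f) (g_Lb : Lb P T g) (h_Lb : Lb P T h)
  (f_adapted : adapted T F f) (g_adapted : adapted T F g)
  (h_adapted : adapted T F h)
  (fhg : {ae P, forall w, forall t, 0 <= t <= T -> g t w <= h t w <= f t w})
  (xi zeta : R -> Omega -> R)
  (xi_adm : admissible T F1 (cst 0) xi)
  (zeta_adm : admissible T F2 (cst 0) zeta)
  (xi_zeta_optimal : optimal P T F F1 F2 f g h xi zeta)
  (lambda : Omega -> R)
  (lambda_st : stopping_time T (common_filtration F1 F2) lambda) :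
  let F12_lambda := stopped_algebra T (common_filtration F1 F2) lambda in
  let E1 := cond_exp P F12_lambda (fun w =>
    (1 - left_at xi lambda w)%:E * survival P T F1 zeta lambda w *
    value1 P T F1 f g h zeta lambda w)%E in
  let E2 := cond_exp P F12_lambda (fun w =>
    (1 - left_at zeta lambda w)%:E * survival P T F2 xi lambda w *
    value2 P T F2 f g h xi lambda w)%E in
  let E3 := cond_exp P F12_lambda (fun w =>
    (\int[dpath T (xi ^~ w)]_(t in `[lambda w, T[)
        ((1 - zeta t w) * f t w) +
     \int[dpath T (zeta ^~ w)]_(t in `[lambda w, T[)
        ((1 - xi t w) * g t w + h t w * jump (xi ^~ w) t) +
     h T w * jump (zeta ^~ w) T * jump (xi ^~ w) T)%:E) in
  E1 = E2 %[ae P] /\ E2 = E3 %[ae P].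
Proof.
move=> F12L E1 E2 E3.
have TT : 0 <= T <= T by rewrite lexx ltW.
have fF := usual_filtrationW F_usual.
have fF1 := usual_filtrationW F1_usual.
have fF2 := usual_filtrationW F2_usual.
have fF12 := filtration_common fF1 fF2.
have F1F t : 0 <= t <= T -> F1 t `<=` F T.
  move=> tT A A1; have /andP[t0 tT'] := tT.
  apply: (filtration_mono fF t0 tT' (lexx _)); apply: F12_sub => //.
  by apply: sub_gen_smallest; left.
have F2F t : 0 <= t <= T -> F2 t `<=` F T.
  move=> tT A A2; have /andP[t0 tT'] := tT.
  apply: (filtration_mono fF t0 tT' (lexx _)); apply: F12_sub => //.
  by apply: sub_gen_smallest; right.
have FF t : 0 <= t <= T -> F t `<=` F T.
  by move=> /andP[t0 tT]; exact: (filtration_mono fF t0 tT (lexx _)).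
have sFT := filtration_sigma fF TT.
have FTM := filtration_sub fF TT.
have st1 : stopping_time T F1 lambda.
  by case: lambda_st => l0 lt; split => // t /lt[].
have st2 : stopping_time T F2 lambda.
  by case: lambda_st => l0 lt; split => // t /lt[].
have sub1 : F12L `<=` stopped_algebra T F1 lambda.
  by move=> A [[A1 _] At]; split => // t /At[].
have sub2 : F12L `<=` stopped_algebra T F2 lambda.
  by move=> A [[_ A2] At]; split => // t /At[].
have cf := adapted_cadlag_process FTM FF f_adapted f_Lb.
have cg := adapted_cadlag_process FTM FF g_adapted g_Lb.
have ch := adapted_cadlag_process FTM FF h_adapted h_Lb.
have [_ _ sf] := f_Lb; have [_ _ sg] := g_Lb; have [_ _ sh] := h_Lb.
have payoffE (Z1 Z2 : {RV P >-> R}) x y : randomisation_devices (F T) Z1 Z2 ->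
    admissible T F1 (cst 0) x -> admissible T F2 (cst 0) y ->
    ('E_P[payoff f g h (generated_time T x Z1) (generated_time T y Z2)] =
    \int[P]_w (game_value T (f ^~ w) (g ^~ w) (h ^~ w) 0 (x ^~ w) (y ^~ w))%:E)%E.
  move=> dev ax ay; apply: (expected_payoff sFT FTM T_gt0 dev) => //.
  - exact: control_process_sub ax.
  - exact: control_process_sub ay.
  - exact: cadlag_process_sub f_adapted f_Lb.
  - exact: cadlag_process_sub g_adapted g_Lb.
  - exact: cadlag_process_sub h_adapted h_Lb.
have [Z1 [Z2 [dev opt2 opt1]]] := xi_zeta_optimal.
have le1 x : admissible T F1 (cst 0) x ->
    (\int[P]_w (game_value T (f ^~ w) (g ^~ w) (h ^~ w) 0 (xi ^~ w) (zeta ^~ w))%:E <=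
     \int[P]_w (game_value T (f ^~ w) (g ^~ w) (h ^~ w) 0 (x ^~ w) (zeta ^~ w))%:E)%E.
  move=> ax; rewrite -!(payoffE Z1 Z2)//.
  (* The deviation keeps the device of the saddle point, so the required independence is that of the
     given pair of devices. *)
  by apply: (opt1 Z1) => //; exists x.
(* The second player is written as the first, with f and g exchanged, to match the hypothesis of
   [weighted_ess_sup]. *)
have le2 x : admissible T F2 (cst 0) x ->
    (\int[P]_w (game_value T (g ^~ w) (f ^~ w) (h ^~ w) 0 (x ^~ w) (xi ^~ w))%:E <=
     \int[P]_w (game_value T (g ^~ w) (f ^~ w) (h ^~ w) 0 (zeta ^~ w) (xi ^~ w))%:E)%E.
  move=> ax; under eq_integral do rewrite game_valueC.
  under [leRHS]eq_integral do rewrite game_valueC.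
  rewrite -!(payoffE Z1 Z2)//.
  by apply: (opt2 Z2) => //; exists x.
have [mV1 V1E] := weighted_ess_inf T_gt0 fF1 fF2 st1 st2 xi_adm zeta_adm
  cf cg ch sf sg sh le1.
have [mV2 V2E] := weighted_ess_sup T_gt0 fF2 fF1 st2 st1 zeta_adm xi_adm
  cg cf ch sg sf sh le2.
pose M w := game_value T (f ^~ w) (g ^~ w) (h ^~ w) (lambda w) (xi ^~ w) (zeta ^~ w).
have s12 := sigma_algebra_stopped T_gt0 fF12 lambda_st.
have s1 := sigma_algebra_stopped T_gt0 fF1 st1.
have s2 := sigma_algebra_stopped T_gt0 fF2 st2.
have iM1 := integrable_continuation_value T_gt0 fF1 fF2 st1 xi_adm zeta_adm
  cf cg ch sf sg sh.
have iM2 := integrable_continuation_value T_gt0 fF2 fF1 st2 zeta_adm xi_adm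
  cg cf ch sg sf sh.
have E1M : {ae P, forall w, E1 w = cond_exp P F12L (EFin \o M) w}.
  apply: (cond_exp_tower s12 s1 sub1 (stopped_sub T_gt0 fF1) iM1 mV1).
  (* [value1] unfolds to the family of [response_value], as [game_value] is convertible with the
     bracket of [J]. *)
  exact: V1E.
have value2E : value2 P T F2 f g h xi lambda = ess_sup_fam P
    [set response_value P T F2 lambda xi g f h y | y in admissible T F2 lambda].
  by rewrite -(funext (response_valueC P T F2 lambda xi f g h)).
have M2E : continuation_value T lambda xi g f h zeta = M.
  by apply/funext => w; exact: game_valueC.
have E2M : {ae P, forall w, E2 w = cond_exp P F12L (EFin \o M) w}.
  rewrite /E2 value2E -M2E.
  exact: (cond_exp_tower s12 s2 sub2 (stopped_sub T_gt0 fF2) iM2 mV2 V2E).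
have E3M : E3 = cond_exp P F12L (EFin \o M).
  apply: (congr1 (cond_exp P F12L)); apply/funext => w.
  apply: (congr1 EFin); apply/esym.
  apply: (game_value_end T_gt0).
  - exact: admissible_control xi_adm.
  - exact: admissible_control zeta_adm.
  - by case: lambda_st.
  - exact: cadlag_process_regular.
  - exact: cadlag_process_regular.
rewrite E3M; split.
  by apply: filterS2 E1M E2M => w -> ->.
by apply: filterS E2M => w ->.
Qed.
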